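(* Let $N\ge 3$, let $n=\lfloor N/2\rfloor$ (so $N=2n$ or $N=2n+1$), $\eta\in\{-1,+1\}$, let $r,s$ be coprime integers with $s\ge1$, and let $\varpi\in\mathbb{R}$ with $X:=\varpi+2\pi\frac rs\ne0$. Consider $N$ unit masses and the relative equilibrium of the regular $N$-gon $$\bar x(t)=e^{\mathbb{J}Xt}\,a\,C,\qquad C=(1,\zeta,\dots,\zeta^{N-1}),\quad \zeta=e^{2\pi i/N},\quad a=(\omega_1/|X|)^{2/3},$$ which in the frame rotating with frequency $\varpi$ becomes the $s$-periodic loop $\bar y(t)=e^{-\mathbb{J}\varpi t}\bar x(t)$ of frequency $2\pi\frac rs$. Let $$V=\inf_{p\ge0}\frac{\omega_1}{\omega_{(1+2p)n\eta}}|(1+2p)2\pi|,$$ with $p$ ranging over integers. If $$-V\le\varpi+2\pi\tfrac rs\le V,$$ then this relative equilibrium is the sole absolute minimizer of the action among paths which in the frame rotating with frequency $\varpi$ are $s$-periodic loops with the $G_{r/s}(N,n,\eta)$-symmetry; that is, $\bar y$ is the sole absolute minimizer of $\mathcal{A}_\varpi$ in $\Lambda^G$, $G=G_{r/s}(N,n,\eta)$.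
   Context: Bodies are labelled by $j\in\mathbb{Z}/N\mathbb{Z}$; positions are in $\mathbb{R}^3=\mathbb{C}\times\mathbb{R}$ (horizontal plane $\times$ vertical axis), and configurations are taken with center of mass at the origin (i.e. modulo translations). $e^{\mathbb{J}\phi}$ acts on each body by $(h,z)\mapsto(e^{i\phi}h,z)$; $\mathbb{J}(h,z)=(ih,0)$. $C$ is placed in the horizontal plane. Frequencies: $\rho_j=|\zeta^j-1|$ and, for $l\in\mathbb{Z}$, $\omega_l=\left(\sum_{j=1}^{N-1}\frac{1-\zeta^{jl}}{\rho_j^3}\right)^{1/2}\ge 0$; it depends only on $l$ mod $N$, $\omega_{-l}=\omega_l$, and $\omega_l=0$ iff $l\equiv0$ mod $N$. The path $e^{\mathbb{J}\omega_1t}C$ is a solution of Newton's equations with unit masses and gravitational constant $1$. In $V$ the terms with $(1+2p)n\equiv0\pmod N$ are omitted. Symmetry: $\Lambda$ is the space of $s$-periodic $H^1$ loops $y=(y_j)_{j}$ of configurations. With $k=n$, $\Lambda^G$ for $G=G_{r/s}(N,k,\eta)$ is the set of $y=(h_j,z_j)_j\in\Lambda$ such that for every $(\theta,\delta,\beta,\xi)\in\mathbb{R}/s\mathbb{Z}\times\mathbb{Z}/N\mathbb{Z}\times\mathbb{Z}/2\mathbb{Z}\times\{\pm1\}$ with $\theta\equiv\frac{\beta}{2}+k\eta\frac{\delta}{N}\pmod 1$, and all $j,t$, $$h_j(t)=e^{2\pi i\alpha}\,\overline{h_{\xi(j+\delta)}(\xi(t-\theta))}^{\,\xi},\qquad z_j(t)=(-1)^{\beta}z_{\xi(j+\delta)}(\xi(t-\theta)),\qquad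 \alpha=\frac rs\theta-\frac{\delta}{N}\pmod 1,$$ where $\overline{h}^{\,\xi}=h$ if $\xi=1$ and $\bar h$ (complex conjugate) if $\xi=-1$. Action: $\mathcal{A}_\varpi(y)=\int_0^{s}\left(\frac12|\dot y+\varpi\mathbb{J}y|^2+U(y)\right)dt$, $|\dot y|^2=\sum_j\|\dot y_j\|^2$, $U(y)=\sum_{i<j}\frac{1}{\|y_i-y_j\|}$ ($+\infty$ allowed); it is the Lagrangian action over $[0,s]$ of $x(t)=e^{\mathbb{J}\varpi t}y(t)$.
   Formalization: ''Sole'' fails literally, since −ȳ is also in Λ^G with the same action; the formal claim is that every minimizer is ȳ or −ȳ, except for N=3 and ϖ+2πr/s=2πη, where tilted copies exist and every minimizer is the image of x̄ under a fixed isometry of space. *)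

(* Defs.v *)
From HB Require Import structures.
From mathcomp Require Import all_boot all_order all_algebra.
From mathcomp Require Import complex.
From mathcomp Require Import all_classical all_reals all_analysis.
Import Order.TTheory GRing.Theory Num.Theory.
Import numFieldNormedType.Exports.

Set Implicit Arguments.
Unset Strict Implicit.
Unset Printing Implicit Defensive.

Local Open Scope classical_set_scope.
Local Open Scope ring_scope.

(* Physical space is C x R (horizontal plane, vertical axis).  Bodies are
   labelled by 'Z_N, which is Z/NZ as soon as 1 < N. *)
Definition space3 (R : realType) : Type := (R[i] * R)%type.
Definition config (R : realType) (N : nat) : Type := 'Z_N -> space3 R.
Definition motion (R : realType) (N : nat) : Type := R -> config R N.

Definition cmod {R : realType} (w : R[i]) : R := ComplexField.Normc.normc w.

Definition norm3 {R : realType} (u : space3 R) : R :=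
  Num.sqrt (cmod u.1 ^+ 2 + u.2 ^+ 2).

Definition expi {R : realType} (phi : R) : R[i] :=
  (cos phi +i* sin phi)%C.

Definition rotJ {R : realType} (phi : R) (u : space3 R) : space3 R :=
  (expi phi * u.1, u.2).

Definition Jmap {R : realType} (u : space3 R) : space3 R := ('i%C * u.1, 0).

Definition zeta (R : realType) (N : nat) : R[i] := expi (2 * pi / N%:R).

Definition rho (R : realType) (N j : nat) : R := cmod (zeta R N ^+ j - 1).

(* The sum is a real number, because the terms j and N - j are conjugate. *)
Definition omega (R : realType) (N : nat) (l : int) : R :=
  Num.sqrt (complex.Re
    (\sum_(1 <= j < N) (1 - zeta R N ^ (j%:Z * l)) / (rho R N j ^+ 3)%:C%C)).

Definition Vbound (R : realType) (N : nat) (eta : int) : R :=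
  let n := N./2 in
  inf [set v : R | exists2 p : nat, ~~ (N %| (1 + 2 * p) * n)%N
    & v = omega R N 1 / omega R N (((1 + 2 * p) * n)%N%:Z * eta)
          * `| (1 + 2 * p)%:R * (2 * pi) |].

Definition xbar (R : realType) (N : nat) (X : R) : motion R N :=
  fun t j =>
    let a := (omega R N 1 / `|X|) `^ (2 / 3) in
    rotJ (X * t) (a%:C%C * zeta R N ^+ j, 0).
Arguments xbar {R} N X t j.

Definition ybar (R : realType) (N : nat) (r s : int) (varpi : R) : motion R N :=
  fun t j => rotJ (- (varpi * t))
    (xbar N (varpi + 2 * pi * (r%:~R / s%:~R)) t j).
Arguments ybar {R} N r s varpi t j.

(* f belongs to H^1(0, T): f is absolutely continuous, i.e. the indefinite
   Lebesgue integral of its (almost everywhere defined) derivative, and this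
   derivative is square integrable.  [derive1 f] is a total function whose values
   at the points where f is not derivable are irrelevant. *)
Definition sobolev_H1 {R : realType} (T : R) (f : R -> R) : Prop :=
  [/\ measurable_fun `[0, T] (derive1 f),
      (\int[lebesgue_measure]_(t in `[0%R, T]) ((derive1 f t) ^+ 2)%:E < +oo)%E
    & forall t, 0 <= t <= T ->
        f t = f 0 + \int[lebesgue_measure]_(u in `[0, t]) derive1 f u].

Definition loop_space {R : realType} {N : nat} (s : int) (y : motion R N) : Prop :=
  [/\ forall t j, y (t + s%:~R) j = y t j,
      forall t, \sum_(j : 'Z_N) (y t j).1 = 0 /\ \sum_(j : 'Z_N) (y t j).2 = 0
    & forall j, [/\ sobolev_H1 s%:~R (fun t => complex.Re (y t j).1),
                    sobolev_H1 s%:~R (fun t => complex.Im (y t j).1)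
                  & sobolev_H1 s%:~R (fun t => (y t j).2)]].

(* The group element is (theta, delta, beta, xi) with xi encoded by the
   boolean x, xi = (-1)^x, so that [x = true] is the case xi = -1.  The angle
   theta and the residue delta are given by representatives; alpha is only
   relevant modulo 1. *)
Definition G_symmetric {R : realType} {N : nat} (r s : int) (k : nat) (eta : int)
    (y : motion R N) : Prop :=
  forall (theta : R) (delta : 'Z_N) (beta x : bool),
    (exists m : int, theta = beta%:R / 2
       + k%:R * eta%:~R * ((delta : nat)%:R / N%:R) + m%:~R) ->
  forall (j : 'Z_N) (t : R),
    let alpha := r%:~R / s%:~R * theta - (delta : nat)%:R / N%:R in
    let u := y ((-1) ^+ x * (t - theta)) ((-1) ^+ x * (j + delta)) in
    (y t j).1 = expi (2 * pi * alpha) * (if x then (u.1 ^*)%C else u.1)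
    /\ (y t j).2 = (-1) ^+ beta * u.2.

Definition LambdaG {R : realType} {N : nat} (r s : int) (k : nat) (eta : int)
    (y : motion R N) : Prop :=
  loop_space s y /\ G_symmetric r s k eta y.

Definition velocity {R : realType} {N : nat} (y : motion R N) (t : R) :
    config R N := fun j =>
  ((derive1 (fun u => complex.Re (y u j).1) t
      +i* derive1 (fun u => complex.Im (y u j).1) t)%C,
   derive1 (fun u => (y u j).2) t).

(* The inverse is that of the extended reals, for which 0^-1 = +oo: the
   potential is +oo at collisions. *)
Definition potential {R : realType} {N : nat} (c : config R N) : \bar R :=
  (\sum_(i : 'Z_N) \sum_(j : 'Z_N | (i < j)%N) (norm3 (c i - c j)%R)%:E^-1)%E.

Definition kinetic {R : realType} {N : nat} (varpi : R) (y : motion R N) (t : R) :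
    R :=
  2^-1 * \sum_(j : 'Z_N)
    norm3 ((velocity y t j).1 + varpi%:C%C * (Jmap (y t j)).1,
           (velocity y t j).2 + varpi * (Jmap (y t j)).2) ^+ 2.

Definition action_of {R : realType} {N : nat} (s : int) (varpi : R)
    (y : motion R N) : \bar R :=
  (\int[lebesgue_measure]_(t in `[0%R, s%:~R])
     ((kinetic varpi y t)%:E + potential (y t)))%E.

(* Main.v *)
Require Import Defs.
From mathcomp Require Import all_boot all_order all_algebra.
From mathcomp Require Import complex.
From mathcomp Require Import all_classical all_reals all_analysis.
From mathcomp Require Import measurable_realfun ring lra zify.
Import Order.TTheory GRing.Theory Num.Theory.
Import numFieldNormedType.Exports.
Set Implicit Arguments.
Unset Strict Implicit.
Unset Printing Implicit Defensive.
Local Open Scope classical_set_scope.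
Local Open Scope ring_scope.

(** Write a path in the frame that rotates with the relative equilibrium: body [j]
has a horizontal position [W j], which is 1/2-periodic, and a height [z j],
which changes sign after a half period.  The proof compares the Lagrangian with
a quadratic one.

For a pair of bodies at distance [r], whose distance in the polygon is [d], the
potential [1/r] lies above its tangent [2/d - r/d^2], and this tangent equals
[3/(2d) - r^2/(2d^3)] plus a multiple of [(r - d)^2] ([newton_tangent]).  So the
action is at least a constant, plus a quadratic functional of the path, plus the
integral of a square that vanishes only on paths with the mutual distances of
the polygon.  The constant is the action of the relative equilibrium.

The quadratic functional is nonnegative for two reasons.  In the bodies, the sum
of [|x_i - x_j|^2/rho_ij^3] is diagonal in the discrete Fourier basis with
eigenvalues [omega_l^2], of which the one for [l = N/2] is the largest
([circulant_le], [omega2_max]).  The maximality is a concavity argument: the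
increments of [omega_l^2] are positive before [N/2] ([omega2_incr_gt0]).  In
time, the symmetries leave only frequencies of modulus at least [2 pi] for the
heights and [4 pi] for the deviation of [W j] from its mean, by Wirtinger's
inequality ([Wirtinger_antiperiodic], [Wirtinger_periodic]).  In the inertial
frame the deviation then has frequencies of modulus at least [4 pi - |X|], and
[|X| <= V] gives [|X| omega_(N/2) <= 2 pi omega_1], hence [|X| <= 2 pi]: both
frequency bounds reach [2 pi], while the largest frequency of the attraction is
[|X| omega_(N/2) / omega_1 <= 2 pi].  The mean of [W j] is a regular polygon
([meanE]), the mode [l = 1], for which the functional vanishes exactly
([energy_ge]).  Wirtinger's inequality itself is a completion of squares with a
tangent function ([tangent_identity]).  It is needed for functions that are only
absolutely continuous; their product rule is Fubini's theorem on a triangle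
([ac_by_parts]).

If a path has the minimal action, its mutual distances are those of the polygon
at all times ([energy_eq]).  When [|X| < 2 pi] the deviation vanishes, the
horizontal motion is a rotating regular polygon, and the distances leave no room
for heights, so the path is the relative equilibrium up to sign
([steady_eq_ybar]).  As [omega_l] is strictly increasing up to [N/2], the value
[|X| = 2 pi] is possible only for three bodies ([critical_triangle]).  Then the
deviation is a single harmonic ([corot_twist]).  For [X = - eta 2 pi] it is the
same for the three bodies, and the center of mass excludes it
([untwisted_steady]).  For [X = eta 2 pi] it is genuinely possible: the path is
a linear image of the rotating triangle, and it is congruent to it because the
distances agree ([extremal_triangle_congruent]). *)

(** * Continuous, integrable and square integrable functions on a segment *)
(** The integral of a nonnegative function is the supremum over the simple functions
below it, so it is monotone whether or not the functions are measurable.  This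
covers the Lagrangian, whose potential is infinite at collisions. *)
Lemma ge0_le_integral_any d (T : measurableType d) (R : realType)
    (mu : {measure set T -> \bar R}) (D : set T) (f g : T -> \bar R) :
  (forall x, D x -> 0 <= f x)%E -> (forall x, D x -> f x <= g x)%E ->
  (\int[mu]_(x in D) f x <= \int[mu]_(x in D) g x)%E.
Proof.
move=> f0 fg; rewrite !(integral_mkcond D).
have h0 x : (0 <= (f \_ D) x)%E by apply: erestrict_ge0.
have hg x : ((f \_ D) x <= (g \_ D) x)%E by apply: lee_restrict.
rewrite !ge0_integralTE//; last by move=> x; apply: le_trans (hg x).
apply: le_ereal_sup => _ [h hf <-]; exists h => // x.
exact: le_trans (hf x) (hg x).
Qed.

(** A signed integrable minorant of a nonnegative function may be replaced by its
positive part. *)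
Lemma Rintegral_le_integral d (T : measurableType d) (R : realType)
    (mu : {measure set T -> \bar R}) (D : set T) (f : T -> R) (g : T -> \bar R) :
  measurable D -> mu.-integrable D (EFin \o f) ->
  (forall x, D x -> 0 <= g x)%E -> (forall x, D x -> (f x)%:E <= g x)%E ->
  ((\int[mu]_(x in D) f x)%:E <= \int[mu]_(x in D) g x)%E.
Proof.
move=> mD fi g0 fg.
rewrite /Rintegral fineK; last exact: integrable_fin_num.
apply: (@le_trans _ _ (\int[mu]_(x in D) (Order.max (f x) 0)%:E)%E).
  apply: le_integral => //; last by move=> x _; rewrite lee_fin le_max lexx.
  have := integrable_funrpos mD fi; apply: eq_integrable => // x _.
apply: ge0_le_integral_any => x Dx; first by rewrite lee_fin le_max lexx orbT.
have [f0|f0] := leP (f x) 0; first exact: g0.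
exact: fg.
Qed.

Section L1L2.
Context {R : realType}.
Notation mu := (@lebesgue_measure R).
Implicit Types (f g : R -> R) (a b k : R).

Definition C0 a b f := {within `[a, b], continuous f}.

Lemma C0_cst a b k : C0 a b (fun=> k).
Proof. by move=> x; apply: cst_continuous. Qed.

Lemma C0D a b f g : C0 a b f -> C0 a b g -> C0 a b (fun t => f t + g t).
Proof. by move=> cf cg x; apply: cvgD; [exact: cf|exact: cg]. Qed.

Lemma C0N a b f : C0 a b f -> C0 a b (fun t => - f t).
Proof. by move=> cf x; apply: cvgN; exact: cf. Qed.

Lemma C0B a b f g : C0 a b f -> C0 a b g -> C0 a b (fun t => f t - g t).
Proof. by move=> cf cg; apply: C0D => //; exact: C0N. Qed.

Lemma C0M a b f g : C0 a b f -> C0 a b g -> C0 a b (fun t => f t * g t).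
Proof. by move=> cf cg x; apply: cvgM; [exact: cf|exact: cg]. Qed.

Lemma C0X a b n f : C0 a b f -> C0 a b (fun t => f t ^+ n).
Proof.
move=> cf; elim: n => [|n IH]; first exact: C0_cst.
by under eq_fun do rewrite exprS; exact: C0M.
Qed.

Lemma C0_sum (I : Type) (r : seq I) (P : pred I) a b (F : I -> R -> R) :
  (forall i, C0 a b (F i)) -> C0 a b (fun t => \sum_(i <- r | P i) F i t).
Proof.
move=> Fi; elim: r => [|i r IH].
  by under eq_fun do rewrite big_nil; exact: C0_cst.
have [Pi|Pi] := boolP (P i).
- by under eq_fun do rewrite big_cons Pi; exact: C0D.
- by under eq_fun do rewrite big_cons (negbTE Pi).
Qed.

Lemma C0_continuous a b f : continuous f -> C0 a b f.
Proof. exact: continuous_subspaceT. Qed.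

Lemma C0_comp a b f g : continuous g -> C0 a b f -> C0 a b (fun t => g (f t)).
Proof. by move=> cg cf x; exact: cvg_comp (cf x) (cg (f x)). Qed.

Lemma C0_sub a b c d f : a <= c -> d <= b -> C0 a b f -> C0 c d f.
Proof.
move=> ac db; apply: continuous_subspaceW.
by apply: subset_itvScc; rewrite bnd_simp.
Qed.

Definition L1 a b f := mu.-integrable `[a, b] (EFin \o f).

Definition L2 a b f :=
  measurable_fun `[a, b] f /\ L1 a b (fun t => f t ^+ 2).

Lemma L1_eq a b f g : {in `[a, b], f =1 g} -> L1 a b f -> L1 a b g.
Proof. by move=> fg; apply: eq_integrable => // x /set_mem xab /=; rewrite fg. Qed.

Lemma L1_continuous a b f : C0 a b f -> L1 a b f.
Proof.
by move=> cf; apply: continuous_compact_integrable => //; exact: segment_compact.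
Qed.

Lemma L1_cst a b k : L1 a b (fun=> k).
Proof. by apply: L1_continuous; exact: C0_cst. Qed.

Lemma L1D a b f g : L1 a b f -> L1 a b g -> L1 a b (fun t => f t + g t).
Proof. by move=> fi gi; exact: (integrableD _ fi gi). Qed.

Lemma L1B a b f g : L1 a b f -> L1 a b g -> L1 a b (fun t => f t - g t).
Proof. by move=> fi gi; exact: (integrableB _ fi gi). Qed.

Lemma L1Z a b k f : L1 a b f -> L1 a b (fun t => k * f t).
Proof. by move=> fi; exact: (integrableZl _ k fi). Qed.

Lemma L1N a b f : L1 a b f -> L1 a b (fun t => - f t).
Proof. by move=> fi; exact: (integrableN fi). Qed.

Lemma L1_sum (I : Type) (r : seq I) (P : pred I) a b (F : I -> R -> R) :
  (forall i, L1 a b (F i)) -> L1 a b (fun t => \sum_(i <- r | P i) F i t).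
Proof.
move=> Fi; rewrite /L1.
have := @integrable_sum _ _ _ mu _ (measurable_itv `[a, b]) I r P
  (fun i => EFin \o F i) (fun i _ => Fi i).
by apply: eq_integrable => // x _ /=; rewrite sumEFin.
Qed.

Lemma L1_measurable a b f : L1 a b f -> measurable_fun `[a, b] f.
Proof. by move=> /measurable_int/measurable_EFinP. Qed.

Lemma L1_sub a b c d f : a <= c -> d <= b -> L1 a b f -> L1 c d f.
Proof.
move=> ac db; apply: integrableS => //.
by apply: subset_itvScc; rewrite bnd_simp.
Qed.

Lemma L1_le a b f g : measurable_fun `[a, b] f ->
  (forall t, t \in `[a, b] -> `|f t| <= g t) -> L1 a b g -> L1 a b f.
Proof.
move=> mf fg; apply: le_integrable => //; first exact/measurable_EFinP.
move=> x /= xab; rewrite lee_fin (le_trans (fg _ xab))//.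
exact: ler_norm.
Qed.

Lemma L2M a b f g : L2 a b f -> L2 a b g -> L1 a b (fun t => f t * g t).
Proof.
move=> [mf f2] [mg g2]; apply: (@L1_le _ _ _ (fun t => f t ^+ 2 + g t ^+ 2)).
- exact: measurable_funM.
- move=> t _; have := sqr_ge0 (`|f t| - `|g t|).
  rewrite normrM -(normr_id (f t)) -(real_normK (num_real (f t))).
  rewrite -(real_normK (num_real (g t))).
  have := sqr_ge0 (`|f t|); have := sqr_ge0 (`|g t|); rewrite normr_id.
  nra.
- exact: L1D.
Qed.

Lemma L2_continuous a b f : C0 a b f -> L2 a b f.
Proof.
move=> cf; split; first exact: (L1_measurable (L1_continuous cf)).
by apply: L1_continuous; exact: C0X.
Qed.

Lemma L2_cst a b k : L2 a b (fun=> k).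
Proof. by apply: L2_continuous; exact: C0_cst. Qed.

Lemma L2_L1 a b f : L2 a b f -> L1 a b f.
Proof.
move=> f2; have := L2M (L2_cst a b 1) f2.
by apply: L1_eq => t _; rewrite mul1r.
Qed.

Lemma L2D a b f g : L2 a b f -> L2 a b g -> L2 a b (fun t => f t + g t).
Proof.
move=> f2 g2; split; first by apply: measurable_funD; [case: f2|case: g2].
apply: (@L1_eq _ _ (fun t => f t ^+ 2 + (2 * (f t * g t) + g t ^+ 2))).
  by move=> t _; ring.
by apply: L1D; [case: f2|apply: L1D; [exact/L1Z/L2M|case: g2]].
Qed.

Lemma L2Z a b k f : L2 a b f -> L2 a b (fun t => k * f t).
Proof.
move=> [mf f2]; split; first exact: measurable_funM.
by apply: (L1_eq _ (L1Z (k ^+ 2) f2)) => t _; ring.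
Qed.

Lemma L2N a b f : L2 a b f -> L2 a b (fun t => - f t).
Proof.
move=> [mf f2]; split; first exact: measurableT_comp.
by apply: (L1_eq _ f2) => t _; rewrite sqrrN.
Qed.

Lemma L2B a b f g : L2 a b f -> L2 a b g -> L2 a b (fun t => f t - g t).
Proof. by move=> f2 g2; apply: L2D => //; exact: L2N. Qed.

(** A continuous function is bounded on a segment. *)
Lemma L2_bounded a b f g : C0 a b f -> L2 a b g ->
  L2 a b (fun t => f t * g t).
Proof.
move=> cf g2; have f2 := L2_continuous cf.
split; first by apply: measurable_funM; [case: f2|case: g2].
have [ab|ba] := leP a b; last first.
  by rewrite /L1 set_itv_ge ?bnd_simp -?ltNge//; exact: integrable_set0.
have [c cab fc] : exists2 c, c \in `[a, b] &
    forall t, t \in `[a, b] -> f t ^+ 2 <= f c ^+ 2.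
  apply: (@EVT_max R (fun t => f t ^+ 2)) => //.
  exact: C0X.
apply: (@L1_le _ _ _ (fun t => f c ^+ 2 * g t ^+ 2)).
- by apply: measurable_funX; apply: measurable_funM; [case: f2|case: g2].
- move=> t tab; rewrite ger0_norm ?sqr_ge0// exprMn ler_wpM2r ?sqr_ge0//.
  exact: fc.
- by apply: L1Z; case: g2.
Qed.

Lemma L2_sub a b c d f : a <= c -> d <= b -> L2 a b f -> L2 c d f.
Proof.
move=> ac db [mf f2]; split; last exact: L1_sub f2.
apply: measurable_funS mf => //.
by apply: subset_itvScc; rewrite bnd_simp.
Qed.

End L1L2.

(** * The integral over a segment *)
Section Int.
Context {R : realType}.
Notation mu := (@lebesgue_measure R).
Implicit Types (f g : R -> R) (a b c k : R).

Definition Int a b f := \int[mu]_(t in `[a, b]) f t.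

Lemma Int_eq a b f g : {in `[a, b], f =1 g} -> Int a b f = Int a b g.
Proof. by move=> fg; apply: eq_Rintegral => x /set_mem; exact: fg. Qed.

Lemma IntD a b f g : L1 a b f -> L1 a b g ->
  Int a b (fun t => f t + g t) = Int a b f + Int a b g.
Proof. by move=> fi gi; rewrite /Int RintegralD. Qed.

Lemma IntB a b f g : L1 a b f -> L1 a b g ->
  Int a b (fun t => f t - g t) = Int a b f - Int a b g.
Proof. by move=> fi gi; rewrite /Int RintegralB. Qed.

Lemma IntZ a b k f : L1 a b f -> Int a b (fun t => k * f t) = k * Int a b f.
Proof. by move=> fi; rewrite /Int RintegralZl. Qed.

Lemma IntN a b f : L1 a b f -> Int a b (fun t => - f t) = - Int a b f.
Proof.
by move=> fi; rewrite -mulN1r -IntZ//; apply: Int_eq => t _; rewrite mulN1r.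
Qed.

Lemma Int_sum (I : Type) (r : seq I) (P : pred I) a b (F : I -> R -> R) :
  (forall i, L1 a b (F i)) ->
  Int a b (fun t => \sum_(i <- r | P i) F i t) =
  \sum_(i <- r | P i) Int a b (F i).
Proof.
move=> Fi; elim: r => [|i r IH].
  rewrite big_nil; under [in LHS]Int_eq do rewrite big_nil.
  by rewrite /Int Rintegral_cst// mul0r.
rewrite big_cons; have [Pi|Pi] := boolP (P i).
- under [in LHS]Int_eq do rewrite big_cons Pi.
  by rewrite IntD ?IH//; exact: L1_sum.
- by under [in LHS]Int_eq do rewrite big_cons (negbTE Pi).
Qed.

Lemma Int_le a b f g : L1 a b f -> L1 a b g ->
  (forall t, a <= t <= b -> f t <= g t) -> Int a b f <= Int a b g.
Proof.
move=> fi gi fg; apply: le_Rintegral => // t /=; rewrite in_itv/=; exact: fg.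
Qed.

Lemma Int_ge0 a b f : (forall t, a <= t <= b -> 0 <= f t) -> 0 <= Int a b f.
Proof.
by move=> f0; apply: Rintegral_ge0 => t /=; rewrite in_itv/=; exact: f0.
Qed.

Lemma Int_cst a b k : a <= b -> Int a b (fun=> k) = k * (b - a).
Proof.
move=> ab; rewrite /Int Rintegral_cst//; congr (_ * _).
rewrite /= lebesgue_measure_itv/= lte_fin.
have [_|ba] := ltP a b; first by [].
by have -> : b = a by [apply/eqP; rewrite eq_le ba]; rewrite subrr.
Qed.

Lemma Int_point a f : Int a a f = 0.
Proof. by rewrite /Int set_itv1 Rintegral_set1. Qed.

Lemma Int_cat a b c f : a <= c -> c <= b -> L1 a b f ->
  Int a b f = Int a c f + Int c b f.
Proof.
move=> ac cb fi; apply/eqP; rewrite addrC -subr_eq; apply/eqP.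
rewrite /Int Rintegral_itvB ?bnd_simp// Rintegral_itv_obnd_cbnd//.
by apply: integrableS fi => //; apply: subset_itvr; rewrite bnd_simp.
Qed.

(** Both sides integrate [f t * g u] over the half plane [u <= t]. *)
Lemma Fubini_triangle f g :
  mu.-integrable setT (EFin \o f) -> mu.-integrable setT (EFin \o g) ->
  \int[mu]_t (f t * \int[mu]_(u in `]-oo, t]) g u) =
  \int[mu]_u (g u * \int[mu]_(t in `[u, +oo[) f t).
Proof.
move=> fi gi.
pose k (z : R * R) := (if z.2 <= z.1 then f z.1 * g z.2 else 0)%:E.
have mf : measurable_fun setT f by exact: (measurable_EFinP _ _).1 (measurable_int mu fi).
have mg : measurable_fun setT g by exact: (measurable_EFinP _ _).1 (measurable_int mu gi).
have mk : measurable_fun setT k.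
  apply/measurable_EFinP; apply: measurable_fun_ifT => //.
    by apply: measurable_fun_ler => //.
  by apply: measurable_funM; apply: measurableT_comp.
have int_le (h : R -> R) (A : set R) : measurable A ->
    mu.-integrable setT (EFin \o h) -> mu.-integrable A (EFin \o h).
  by move=> mA; apply: integrableS.
have ki : (mu \x mu)%E.-integrable setT k.
  apply: (@integrable12ltyP _ _ _ _ R mu mu k mk).2.
  have [_ gfin] := integrableP _ _ _ gi; have [_ ffin] := integrableP _ _ _ fi.
  pose c := (\int[mu]_u `|(g u)%:E|)%E.
  have c0 : (0 <= c)%E by exact: integral_ge0.
  apply: (@le_lt_trans _ _ (\int[mu]_t (`|(f t)%:E| * c))%E).
    apply: ge0_le_integral_any => [t _|t _]; first exact: integral_ge0.
    rewrite -ge0_integralZl//; last by apply: measurableT_comp => //; exact/measurable_EFinP.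
    apply: ge0_le_integral_any => [u _|u _]; first exact: abse_ge0.
    rewrite /k /=; case: ifP => _; first by rewrite normrM EFinM.
    by rewrite normr0 mule_ge0.
  rewrite ge0_integralZr//; last by apply: measurableT_comp => //; exact/measurable_EFinP.
  by rewrite lte_mul_pinfty// ?ge0_fin_numE// ?integral_ge0.
have E1 t : (f t * \int[mu]_(u in `]-oo, t]) g u)%:E = (\int[mu]_u k (t, u))%E.
  rewrite EFinM /Rintegral fineK; last first.
    by apply: integrable_fin_num => //; exact: int_le.
  rewrite -integralZl//; last exact: int_le.
  rewrite integral_mkcond; apply: eq_integral => u _.
  rewrite patchE /k /=; case: ifPn => ut; case: ifPn => //.
  - by move: ut; rewrite inE/= in_itv/= => ->.
  - by move=> ut'; move: ut; rewrite notin_setE/= in_itv/= ut'.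
have E2 u : (g u * \int[mu]_(t in `[u, +oo[) f t)%:E = (\int[mu]_t k (t, u))%E.
  rewrite EFinM /Rintegral fineK; last first.
    by apply: integrable_fin_num => //; exact: int_le.
  rewrite -integralZl//; last exact: int_le.
  rewrite integral_mkcond; apply: eq_integral => t _.
  rewrite patchE /k /=; case: ifPn => ut; case: ifPn => //.
  - by move=> _; rewrite mulrC.
  - by move: ut; rewrite inE/= in_itv/= andbT => ->.
  - by move=> ut'; move: ut; rewrite notin_setE/= in_itv/= andbT ut'.
rewrite /Rintegral; congr fine.
transitivity (\int[mu]_t \int[mu]_u k (t, u))%E.
  by apply: eq_integral => t _; exact: E1.
transitivity (\int[mu]_u \int[mu]_t k (t, u))%E; first exact: Fubini.
by apply: eq_integral => u _; rewrite -E2.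
Qed.

End Int.

(** * Absolutely continuous functions *)
Section AC.
Context {R : realType}.
Notation mu := (@lebesgue_measure R).
Implicit Types (f g df dg : R -> R) (a b c k t : R).

(** [f] is a primitive of [df] in the sense of Lebesgue.  The density is kept as a
separate argument: products and rotations of such functions have a density given
by a formula, which [derive1] follows only almost everywhere. *)
Definition ac a b f df :=
  L1 a b df /\ forall t, a <= t <= b -> f t = f a + Int a t df.

Lemma ac_sub a b c d f df : a <= c -> c <= d -> d <= b ->
  ac a b f df -> ac c d f df.
Proof.
move=> ac_ cd db [fi fE]; split; first exact: L1_sub fi.
move=> t /andP[ct td]; have [tb cb] : t <= b /\ c <= b by split; lra.
have fi' : L1 a t df by apply: L1_sub fi.
rewrite (fE t) ?(fE c) ?ac_ ?cb ?tb ?(le_trans ac_)//.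
by rewrite (Int_cat ac_ ct fi') addrA.
Qed.

Lemma ac_C0 a b f df : a <= b -> ac a b f df -> C0 a b f.
Proof.
move=> ab [fi fE].
have := parameterized_integral_continuous ab fi => cI.
have : C0 a b (fun t => f a + Int a t df) by apply: C0D => //; exact: C0_cst.
apply: subspace_eq_continuous => t /set_mem; rewrite /= in_itv /= => tab.
exact/esym/fE.
Qed.

Lemma ac_eq a b f g df dg : {in `[a, b], f =1 g} -> {in `[a, b], df =1 dg} ->
  ac a b f df -> ac a b g dg.
Proof.
move=> fg dfg [fi fE]; split; first exact: (L1_eq dfg fi).
move=> t atb; have /andP[at_ tb] := atb.
have ab : a <= b by lra.
rewrite -fg ?in_itv// -fg ?in_itv/= ?lexx// fE//; congr (_ + _).
apply: Int_eq => u; rewrite in_itv/= => /andP[au ut].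
by rewrite dfg// in_itv/= au (le_trans ut).
Qed.

Lemma acD a b f g df dg : ac a b f df -> ac a b g dg ->
  ac a b (fun t => f t + g t) (fun t => df t + dg t).
Proof.
move=> [fi fE] [gi gE]; split; first exact: L1D.
move=> t atb; have /andP[at_ tb] := atb.
have fi' : L1 a t df := L1_sub (lexx a) tb fi.
have gi' : L1 a t dg := L1_sub (lexx a) tb gi.
by rewrite (fE t atb) (gE t atb) (IntD fi' gi') addrACA.
Qed.

Lemma acZ a b k f df : ac a b f df ->
  ac a b (fun t => k * f t) (fun t => k * df t).
Proof.
move=> [fi fE]; split; first exact: L1Z.
move=> t atb; have /andP[at_ tb] := atb.
by rewrite (fE t atb) (IntZ k (L1_sub (lexx a) tb fi)) mulrDr.
Qed.

Lemma ac_cst a b k : ac a b (fun=> k) (fun=> 0).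
Proof.
split; first exact: L1_cst.
by move=> t /andP[at_ _]; rewrite Int_cst// mul0r addr0.
Qed.

Lemma ac_end a b f df : a <= b -> ac a b f df -> Int a b df = f b - f a.
Proof. by move=> ab [_ fE]; rewrite (fE b) ?ab ?lexx// addrC addKr. Qed.

Lemma ac_C1 a b f df : a <= b ->
  (forall t, a <= t <= b -> is_derive t (1:R) f (df t)) ->
  C0 a b df -> ac a b f df.
Proof.
move=> ab fd cdf; split; first exact: L1_continuous.
have cf x : a <= x <= b -> {for x, continuous f}.
  by move=> xab; apply/differentiable_continuous/derivable1_diffP; case: (fd x xab).
move=> t /andP[at_ tb]; move: at_; rewrite le_eqVlt => /predU1P[<-|at_].
  by rewrite Int_point addr0.
have inat x : x \in `]a, t[ -> a <= x <= b.
  by rewrite in_itv/= => /andP[? ?]; apply/andP; split; lra.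
have := @continuous_FTC2 R df f a t at_ (C0_sub (lexx a) tb cdf).
rewrite /Int /Rintegral => ->.
- by rewrite /= [RHS]addrC subrK.
- split.
  + by move=> x /inat xab; case: (fd x xab).
  + by apply/cvg_at_right_filter/cf; apply/andP; split; lra.
  + by apply/cvg_at_left_filter/cf; apply/andP; split; lra.
- by move=> x /inat xab; rewrite derive1E; case: (fd x xab).
Qed.

Lemma L1_C0M a b f g : a <= b -> L1 a b f -> C0 a b g -> L1 a b (fun t => f t * g t).
Proof.
move=> ab fi cg.
have [c cab gc] := @EVT_max R (fun t => `|g t|) a b ab (C0_comp (@norm_continuous R R^o) cg).
apply: (@L1_le _ _ _ _ (fun t => `|g c| * `|f t|)).
- by apply: measurable_funM; apply: L1_measurable => //; exact: L1_continuous.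
- by move=> t tab; rewrite normrM mulrC ler_wpM2r// gc.
- by apply: L1Z; apply: integrable_norm.
Qed.

(** [Fubini_triangle] for the densities extended by zero: the inner integrals are
[g t - g a] on one side and [f b - f u] on the other. *)
Lemma ac_by_parts a b f df g dg : a <= b -> ac a b f df -> ac a b g dg ->
  f b * g b = f a * g a + Int a b (fun t => df t * g t + f t * dg t).
Proof.
move=> ab fac gac.
have [fi fE] := fac; have [gi gE] := gac.
have patchi (h : R -> R) : L1 a b h ->
    mu.-integrable setT (EFin \o (h \_ `[a, b])).
  move=> hi; have /integrable_mkcond := hi.
  by rewrite restrict_EFin; apply.
have := Fubini_triangle (patchi _ fi) (patchi _ gi).
rewrite (_ : \int[mu]_t _ = Int a b (fun t => df t * (g t - g a))); last first.
  rewrite /Int [RHS]Rintegral_mkcond; apply: eq_Rintegral => t _.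
  rewrite !patchE; case: ifPn => [/set_mem tab|]; last by rewrite mul0r.
  move: (tab); rewrite /= in_itv/= => atb; have /andP[at_ tb] := atb.
  congr (_ * _); rewrite (gE t)// [RHS]addrC addKr /Int.
  rewrite -Rintegral_mkcondr; congr Rintegral.
  apply/seteqP; split => u /=; rewrite !in_itv/=.
    by move=> [-> /andP[-> _]].
  by move=> /andP[-> ut]; rewrite ut (le_trans ut).
rewrite (_ : \int[mu]_u _ = Int a b (fun t => dg t * (f b - f t))); last first.
  rewrite /Int [RHS]Rintegral_mkcond; apply: eq_Rintegral => t _.
  rewrite !patchE; case: ifPn => [/set_mem tab|]; last by rewrite mul0r.
  move: (tab); rewrite /= in_itv/= => atb; have /andP[at_ tb] := atb.
  congr (_ * _); rewrite -(ac_end tb (ac_sub at_ tb (lexx b) fac)) /Int.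
  rewrite -Rintegral_mkcondr; congr Rintegral.
  apply/seteqP; split => u /=; rewrite !in_itv/= ?andbT.
    by move=> [-> /andP[_ ->]].
  by move=> /andP[ut ->]; rewrite ut (le_trans at_).
have fM := L1_C0M ab fi (ac_C0 ab gac).
have gM : L1 a b (fun t => f t * dg t).
  by apply: (L1_eq _ (L1_C0M ab gi (ac_C0 ab fac))) => t _; rewrite mulrC.
rewrite (@Int_eq _ _ _ _ (fun t => df t * g t - g a * df t)); last by move=> t _; ring.
rewrite IntB//; last exact: L1Z.
rewrite IntZ// (@Int_eq _ _ _ (fun t => dg t * _) (fun t => f b * dg t - f t * dg t)); last by move=> t _; ring.
rewrite IntB//; last exact: L1Z.
rewrite IntZ// IntD// (ac_end ab fac) (ac_end ab gac) => E.
have -> : Int a b (fun t => df t * g t) = f b * (g b - g a) -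
  Int a b (fun t => f t * dg t) + g a * (f b - f a) by rewrite -E; ring.
by ring.
Qed.

Lemma acM a b f df g dg : ac a b f df -> ac a b g dg ->
  ac a b (fun t => f t * g t) (fun t => df t * g t + f t * dg t).
Proof.
move=> fac gac; have [ab|ba] := leP a b; last first.
  split; last by move=> t /andP[? ?]; lra.
  by rewrite /L1 set_itv_ge ?bnd_simp -?ltNge//; exact: integrable_set0.
split.
  apply: L1D; first exact: L1_C0M fac.1 (ac_C0 ab gac).
  by apply: (L1_eq _ (L1_C0M ab gac.1 (ac_C0 ab fac))) => t _; rewrite mulrC.
by move=> t /andP[at_ tb]; rewrite -ac_by_parts//; exact: ac_sub (lexx a) at_ tb _.
Qed.

End AC.

(** * Wirtinger's inequality for functions with equally spaced zeros *)
Section Wirtinger.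
Context {R : realType}.
Implicit Types (f g df dg : R -> R) (a b c k t : R).

(** The Sobolev space, with the density explicit as in [ac]. *)
Definition H1 a b f df := ac a b f df /\ L2 a b df.

Lemma H1_sub a b c d f df : a <= c -> c <= d -> d <= b ->
  H1 a b f df -> H1 c d f df.
Proof.
by move=> ac_ cd db [fa f2]; split; [exact: ac_sub fa|exact: L2_sub f2].
Qed.

Lemma H1_C0 a b f df : a <= b -> H1 a b f df -> C0 a b f.
Proof. by move=> ab [fa _]; exact: ac_C0 fa. Qed.

Lemma L2_sq a b f : L2 a b f -> L1 a b (fun t => f t ^+ 2).
Proof. by case. Qed.

(** The function [g t = k tan (k (t - m))] satisfies [g' = k^2 + g^2], so that
[df^2 - k^2 f^2 = (df + f g)^2 - (f^2 g)'].  The angles are restricted to keep [g]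
finite on the segment. *)
Lemma tangent_identity a b f df k m : a <= b -> H1 a b f df ->
  (forall t, a <= t <= b -> - (pi / 2) < k * (t - m) < pi / 2) ->
  f a ^+ 2 * (k * tan (k * (a - m))) - f b ^+ 2 * (k * tan (k * (b - m))) <=
  Int a b (fun t => df t ^+ 2) - k ^+ 2 * Int a b (fun t => f t ^+ 2).
Proof.
move=> ab fH km.
have cos0 t : a <= t <= b -> cos (k * (t - m)) != 0.
  by move=> tab; rewrite gt_eqF// cos_gt0_pihalf// km.
pose g t := k * tan (k * (t - m)).
pose dg t := k ^+ 2 + g t ^+ 2.
have gd t : a <= t <= b -> is_derive t (1:R) g (dg t).
  move=> tab.
  have l : is_derive t (1:R) (fun t => k * (t - m)) k.
    by apply: is_derive_eq; rewrite subr0 /GRing.scale/= mulr1.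
  have T := is_derive_tan (cos0 t tab).
  have Tl : is_derive t (1:R) (tan \o (fun t => k * (t - m)))
      ((cos (k * (t - m))) ^- 2 * k).
    exact: is_derive1_comp.
  apply: is_derive_eq.
  rewrite /dg /g cos2_tan2 ?cos0// /GRing.scale/=; ring.
have cf := H1_C0 ab fH.
have cg : C0 a b g.
  apply: derivable_within_continuous => t; rewrite in_itv/= => tab.
  by case: (gd t tab).
have cdg : C0 a b dg by apply: C0D; [exact: C0_cst|exact: C0X].
have ga : ac a b g dg by exact: ac_C1.
have fa := fH.1; have f2 := fH.2.
have /(ac_end ab) := acM (acM fa fa) ga.
set h := (fun t => _) => hE.
have hi : L1 a b h.
  by have := acM (acM fa fa) ga; case.
have q2 : L2 a b (fun t => df t + f t * g t).
  by apply: L2D => //; apply/L2_continuous/C0M.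
have : Int a b (fun t => df t ^+ 2 - k ^+ 2 * f t ^+ 2) =
       Int a b (fun t => (df t + f t * g t) ^+ 2 - h t).
  by apply: Int_eq => t _; rewrite /h /dg; ring.
have fi : L1 a b (fun t => f t ^+ 2) by apply: L1_continuous; exact: C0X.
rewrite IntB; [|exact: L2_sq|exact: L1Z].
rewrite IntZ// IntB//; last exact: L2_sq.
rewrite hE => ->; rewrite -!expr2 -/(g a) -/(g b).
have : 0 <= Int a b (fun t => (df t + f t * g t) ^+ 2).
  by apply: Int_ge0 => t _; exact: sqr_ge0.
lra.
Qed.

(** The critical frequency [p] is reached as a limit, because at [k = p] the tangent
of [tangent_identity] is infinite at the zeros of the function. *)
Lemma sqr_mul_le_limit (p J K : R) : 0 < p -> 0 <= J -> 0 <= K ->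
  (forall k, 0 < k < p -> k ^+ 2 * J <= K) -> p ^+ 2 * J <= K.
Proof.
move=> p0 J0 K0 H; rewrite leNgt; apply/negP => KJ.
have pJ : 0 < p ^+ 2 * J by exact: le_lt_trans KJ.
(* [K] is [(1 - 4 e) * (p^2 J)], and [(1 - e)^2 >= 1 - 2 e]. *)
pose e := (p ^+ 2 * J - K) / (4 * (p ^+ 2 * J)).
have eE : e * (4 * (p ^+ 2 * J)) = p ^+ 2 * J - K.
  by rewrite /e mulfVK// mulf_neq0 ?gt_eqF.
have e0 : 0 < e by rewrite /e divr_gt0//; lra.
have e1 : e < 1 by rewrite /e ltr_pdivrMr; lra.
have : (p * (1 - e)) ^+ 2 * J <= K by apply: H; apply/andP; split; nra.
rewrite exprMn; nra.
Qed.

(** Between consecutive zeros the boundary terms of [tangent_identity] vanish.  The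
segment starts and ends inside a step of length [L]; if each of its two end pieces
is centred like a full step, the tangents at [0] and at [s] are equal, and the
two boundary terms cancel since [f 0 = f s]. *)
Lemma Wirtinger_zeros (s L a : R) (M : nat) f df :
  0 < L -> s = M.+1%:R * L -> 0 <= a <= L ->
  (forall k : nat, (k <= M)%N -> f (a + k%:R * L) = 0) -> f 0 = f s ->
  H1 0 s f df ->
  (pi / L) ^+ 2 * Int 0 s (fun t => f t ^+ 2) <= Int 0 s (fun t => df t ^+ 2).
Proof.
move=> L0 sE /andP[a0 aL] fz f0s fH.
apply: sqr_mul_le_limit; first by rewrite divr_gt0// pi_gt0.
  by apply: Int_ge0 => t _; exact: sqr_ge0.
  by apply: Int_ge0 => t _; exact: sqr_ge0.
move=> k /andP[k0 kL].
have kL2 : k * L < pi by move: kL; rewrite ltr_pdivlMr.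
have sqL1 b c : 0 <= b -> c <= s -> L1 b c (fun t => df t ^+ 2).
  by move=> b0 cs; apply: L1_sub (L2_sq fH.2).
have s0 : 0 <= s by rewrite sE mulr_ge0// ltW.
have fL1 b c : 0 <= b -> c <= s -> L1 b c (fun t => f t ^+ 2).
  move=> b0 cs; apply: (@L1_sub _ 0 s) => //; apply: L1_continuous.
  by apply: C0X; exact: H1_C0 fH.
have aM (j : nat) : (j <= M)%N -> a + j%:R * L <= s.
  move=> jM; rewrite sE -natr1 mulrDl mul1r.
  have : j%:R * L <= M%:R * L by rewrite ler_pM2r// ler_nat.
  lra.
have mid (j : nat) : (j <= M)%N ->
  k ^+ 2 * Int a (a + j%:R * L) (fun t => f t ^+ 2) <=
  Int a (a + j%:R * L) (fun t => df t ^+ 2).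
  elim: j => [_|j IH jM].
    by rewrite mul0r addr0 !Int_point mulr0.
  have {}IH := IH (ltnW jM); have jM1 := aM _ jM; have jM0 := aM _ (ltnW jM).
  have j0 : 0 <= j%:R * L by rewrite mulr_ge0// ltW.
  set c := a + j%:R * L in IH jM0 *; set d := a + j.+1%:R * L in jM1 *.
  have dE : d = c + L by rewrite /c /d -natr1; ring.
  have ac' : a <= c by rewrite /c; lra.
  have cd : c <= d by lra.
  rewrite (@Int_cat _ a d c)//; last by apply: fL1; lra.
  rewrite [leRHS](@Int_cat _ a d c)//; last by apply: sqL1; lra.
  have fH' : H1 c d f df by apply: H1_sub fH => //; lra.
  have := @tangent_identity c d f df k (c + L / 2) cd fH'.
  rewrite (fz j (ltnW jM)) (fz j.+1 jM) expr0n/= !mul0r subrr subr_ge0 => P.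
  rewrite mulrDr lerD// P// => t /andP[ct td]; apply/andP; split; nra.
have := mid M (leqnn M); set c := a + M%:R * L => midM.
have cE : c = s - L + a by rewrite /c sE -natr1; ring.
have as_ : a <= c by rewrite /c lerDl mulr_ge0// ltW.
have cs : c <= s by lra.
have as2 : a <= s by lra.
rewrite (@Int_cat _ 0 s a)//; last exact: fL1.
rewrite [leRHS](@Int_cat _ 0 s a)//; last exact: sqL1.
rewrite (@Int_cat _ a s c)//; last exact: fL1.
rewrite [X in _ <= _ + X](@Int_cat _ a s c)//; last exact: sqL1.
(* The end pieces, each centred like a full step of length [L]. *)
have P1 := @tangent_identity 0 a f df k (a - L / 2) a0 (H1_sub (lexx 0) a0 as2 fH).
have c0 : 0 <= c by lra.
have P2 := @tangent_identity c s f df k (c + L / 2) cs (H1_sub c0 cs (lexx s) fH).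
have fc0 : f c = 0 := fz M (leqnn M).
have fa0 : f a = 0 by have := fz 0%N isT; rewrite mul0r addr0.
move: P1 P2; rewrite fc0 fa0.
rewrite expr0n/= !mul0r subr0 !sub0r -f0s.
have -> : s - (c + L / 2) = - (a - L / 2) by rewrite cE; field.
set T := f 0 ^+ 2 * _ => P1 P2.
have {}P1 : T <= Int 0 a (fun t => df t ^+ 2) - k ^+ 2 * Int 0 a (fun t => f t ^+ 2).
  apply: P1 => t /andP[t0 ta]; apply/andP; split; nra.
have {}P2 : - T <= Int c s (fun t => df t ^+ 2) - k ^+ 2 * Int c s (fun t => f t ^+ 2).
  apply: P2 => t /andP[ct ts]; apply/andP; split; nra.
lra.
Qed.

End Wirtinger.

(** * Periodic and antiperiodic functions *)
Section Periodic.
Context {R : realType}.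
Notation mu := (@lebesgue_measure R).
Implicit Types (f g df dg : R -> R) (a b c k t : R).

Lemma C0_eq a b f g : {in `[a, b], f =1 g} -> C0 a b f -> C0 a b g.
Proof. by move=> fg; apply: subspace_eq_continuous => t /set_mem; exact: fg. Qed.

(** In this form continuity on a segment is easily translated and glued. *)
Lemma C0_dist a b f : C0 a b f <-> forall x, a <= x <= b -> forall e, 0 < e ->
  exists2 d, 0 < d & forall y, a <= y <= b -> `|x - y| < d -> `|f x - f y| < e.
Proof.
rewrite /C0 subspace_continuousP; split.
- move=> cf x xab e e0; have := cf x; rewrite /= in_itv/= => /(_ xab).
  move=> /(@cvgrPdist_lt R R^o) /(_ e e0); rewrite near_withinE.
  move=> /nbhs_ballP[d /= d0 H]; exists d => // y yab xy.
  by apply: H; rewrite /= ?in_itv.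
- move=> H x; rewrite /= in_itv/= => xab.
  apply/(@cvgrPdist_lt R R^o) => e e0; rewrite near_withinE.
  have [d d0 Hd] := H x xab e e0.
  by apply/nbhs_ballP; exists d => //= y xy; rewrite in_itv/= => yab; exact: Hd.
Qed.

Lemma C0_shift a b c f : C0 (a + c) (b + c) f -> C0 a b (fun t => f (t + c)).
Proof.
move=> /C0_dist cf; apply/C0_dist => x xab e e0.
have [|d d0 H] := cf (x + c) _ e e0; first by move: xab; lra.
exists d => // y yab xy; apply: H; first by move: yab; lra.
by rewrite (_ : x + c - (y + c) = x - y)//; ring.
Qed.

(** Substitution for the increasing function [t |-> t + c]. *)
Lemma Int_shift a b c f : a <= b -> C0 (a + c) (b + c) f ->
  Int a b (fun t => f (t + c)) = Int (a + c) (b + c) f.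
Proof.
move=> ab cf; rewrite /Int /Rintegral; congr fine.
pose F t := t + c.
have dF t : is_derive t (1:R) F 1 by apply: is_derive_eq; rewrite addr0.
have F1 : derive1 F = cst 1 by apply/funext => t; rewrite derive1E; case: (dF t).
have cF : continuous F.
  by move=> t; apply/differentiable_continuous/derivable1_diffP; case: (dF t).
have := @integration_by_substitution_increasing R F f a b ab.
rewrite F1 => ->//.
- by apply: eq_integral => t _; rewrite /= mulr1.
- by move=> x y _ _ xy; rewrite /F ltrD2r.
- by move=> x _; exact: cst_continuous.
- exact: is_cvg_cst.
- exact: is_cvg_cst.
- split; [by move=> x _; case: (dF x)|exact/cvg_at_right_filter/cF|exact/cvg_at_left_filter/cF].
Qed.

Lemma C0_glue a b c f : a <= c <= b -> C0 a c f -> C0 c b f -> C0 a b f.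
Proof.
move=> /andP[ac_ cb] /C0_dist f1 /C0_dist f2; apply/C0_dist => x xab e e0.
have [xc|xc|xc] := ltgtP x c.
- have [|d d0 H] := f1 x _ e e0; first by move: xab; lra.
  exists (Num.min d (c - x)); first by rewrite lt_min d0 subr_gt0.
  move=> y yab; rewrite lt_min => /andP[xd xy]; apply: H => //.
  by move: xy; rewrite ltr_norml; move: yab; lra.
- have [|d d0 H] := f2 x _ e e0; first by move: xab; lra.
  exists (Num.min d (x - c)); first by rewrite lt_min d0 subr_gt0.
  move=> y yab; rewrite lt_min => /andP[xd xy]; apply: H => //.
  by move: xy; rewrite ltr_norml; move: yab; lra.
- have [|d d0 H] := f1 x _ e e0; first by move: xab; lra.
  have [|d' d0' H'] := f2 x _ e e0; first by move: xab; lra.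
  exists (Num.min d d'); first by rewrite lt_min d0.
  move=> y yab; rewrite lt_min => /andP[xd xd'].
  by have [yc|yc] := leP y c; [apply: H|apply: H'] => //; move: yab; lra.
Qed.

Lemma C0_periodic_shift T c f : 0 <= c <= T -> (forall t, f (t + T) = f t) ->
  C0 0 T f -> C0 0 T (fun t => f (t + c)).
Proof.
move=> /andP[c0 cT] fT cf; apply: (@C0_glue _ _ (T - c)); first lra.
- by apply: C0_shift; apply: C0_sub cf; lra.
- have : C0 (T - c) T (fun t => f (t + (c - T))).
    by apply: C0_shift; apply: C0_sub cf; lra.
  by apply: C0_eq => t _; rewrite -fT; congr f; ring.
Qed.

(** The part of the translated segment that lies beyond [T] is moved back by one
period. *)
Lemma Int_periodic_shift T c f : 0 <= c <= T -> (forall t, f (t + T) = f t) ->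
  C0 0 T f -> Int 0 T (fun t => f (t + c)) = Int 0 T f.
Proof.
move=> cT fT cf; have [c0 cT'] := andP cT.
rewrite (@Int_cat _ 0 T (T - c)); [|lra|lra|].
  rewrite Int_shift; [|lra|by apply: C0_sub cf; lra].
  rewrite (@Int_eq _ _ _ (fun t => f (t + c)) (fun t => f (t + (c - T)))); last first.
    by move=> t _; rewrite -[RHS]fT; congr f; ring.
  rewrite Int_shift; [|lra|by apply: C0_sub cf; lra].
  rewrite addrC (_ : T - c + (c - T) = 0); last by ring.
  rewrite (_ : T + (c - T) = c); last by ring.
  rewrite (_ : T - c + c = T); last by ring.
  by rewrite add0r -Int_cat//; exact: L1_continuous.
by apply: L1_continuous; exact: C0_periodic_shift.
Qed.

Lemma Int_sqr_eq0 a b f : a < b -> C0 a b f -> Int a b (fun t => f t ^+ 2) = 0 ->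
  forall t, a <= t <= b -> f t = 0.
Proof.
move=> ab cf I0 t tab; apply/eqP/negPn/negP => ft0.
have fi c d : a <= c -> d <= b -> L1 c d (fun t => f t ^+ 2).
  by move=> ? ?; apply: L1_continuous; apply: C0X; exact: C0_sub cf.
have e0 : 0 < `|f t| / 2 by rewrite divr_gt0// normr_gt0.
have /C0_dist/(_ t tab _ e0)[d d0 H] := cf.
(* A segment around [t] where [|f|] stays above half of its value at [t]. *)
pose p := Num.max a (t - d / 2); pose q := Num.min b (t + d / 2).
have [tp pa] : p <= t /\ a <= p.
  by split; rewrite /p ?ge_max ?le_max ?lexx//; move: tab; lra.
have [tq qb] : t <= q /\ q <= b.
  by split; rewrite /q ?le_min ?ge_min ?lexx//; move: tab; lra.
have pq : p < q.
  rewrite /p /q gt_max !lt_min ab/=; move: tab; lra.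
have pd : t - d / 2 <= p by rewrite /p le_max lexx orbT.
have qd : q <= t + d / 2 by rewrite /q ge_min lexx orbT.
have pos : 0 < Int p q (fun t => f t ^+ 2).
  apply: (@lt_le_trans _ _ ((`|f t| / 2) ^+ 2 * (q - p))).
    by rewrite mulr_gt0 ?subr_gt0// exprn_gt0.
  rewrite -Int_cst ?(ltW pq)//; apply: Int_le => [||y /andP[py yq]].
  - exact: L1_cst.
  - exact: fi.
  have yt : `|f t - f y| < `|f t| / 2.
    by apply: H; [|rewrite ltr_norml]; lra.
  have : `|f t| <= `|f t - f y| + `|f y|.
    by rewrite -{1}(subrK (f y) (f t)) ler_normD.
  rewrite -[f y ^+ 2]real_normK ?num_real// => ?.
  by rewrite ler_sqr ?nnegrE ?normr_ge0//; lra.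
move: I0; rewrite (@Int_cat _ a b p); [|lra|lra|exact: fi].
rewrite (@Int_cat _ p b q); [|lra|lra|by apply: fi; lra].
have sq (u v : R) : 0 <= Int u v (fun t => f t ^+ 2).
  by apply: Int_ge0 => ? _; exact: sqr_ge0.
have := sq a p; have := sq q b; lra.
Qed.

(** From [|x| <= e + x^2 / (4 e)] the variation of [f] on [[a, t]] is at most
[e (t - a)], for every positive [e]. *)
Lemma Int_dsqr_eq0 a b f df : H1 a b f df -> Int a b (fun t => df t ^+ 2) = 0 ->
  forall t, a <= t <= b -> f t = f a.
Proof.
move=> fH I0 t /andP[at_ tb].
have fi : L1 a t df := L1_sub (lexx a) tb fH.1.1.
have f2 : L1 a t (fun t => df t ^+ 2) := L1_sub (lexx a) tb fH.2.2.
have It : Int a t (fun t => df t ^+ 2) <= 0.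
  rewrite -I0 (@Int_cat _ a b t)//; last exact: fH.2.2.
  by rewrite lerDl; apply: Int_ge0 => ? _; exact: sqr_ge0.
have ftE : f t - f a = Int a t df by rewrite fH.1.2 ?at_// addrC addKr.
have bound (e : R) : 0 < e -> `|f t - f a| <= e * (t - a).
  move=> e0.
  have up : Int a t df <= Int a t (fun t => e + (4 * e)^-1 * df t ^+ 2).
    apply: Int_le => //; first by apply: L1D; [exact: L1_cst|exact: L1Z].
    move=> x _; have : 0 <= (4 * e)^-1 * (df x - 2 * e) ^+ 2.
      by rewrite mulr_ge0 ?sqr_ge0// invr_ge0; lra.
    rewrite (_ : _ * _ ^+ 2 = (4 * e)^-1 * df x ^+ 2 - df x + e); last by field; lra.
    lra.
  have dn : Int a t (fun t => - df t) <= Int a t (fun t => e + (4 * e)^-1 * df t ^+ 2).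
    apply: Int_le => //; [exact: L1N|by apply: L1D; [exact: L1_cst|exact: L1Z]|].
    move=> x _; have : 0 <= (4 * e)^-1 * (df x + 2 * e) ^+ 2.
      by rewrite mulr_ge0 ?sqr_ge0// invr_ge0; lra.
    rewrite (_ : _ * _ ^+ 2 = (4 * e)^-1 * df x ^+ 2 + df x + e); last by field; lra.
    lra.
  move: up dn; rewrite IntN// IntD; [|exact: L1_cst|exact: L1Z].
  rewrite IntZ// Int_cst// -ftE => up dn.
  have : (4 * e)^-1 * Int a t (fun t => df t ^+ 2) <= 0.
    by rewrite mulr_ge0_le0// invr_ge0; lra.
  by rewrite ler_norml; lra.
apply/eqP; rewrite -subr_eq0 -normr_le0; apply/ler_addgt0Pl => e e0.
have ta : 0 <= t - a by lra.
apply: le_trans (bound (e / (1 + (t - a))) _) _; first by rewrite divr_gt0//; lra.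
by rewrite addr0 mulrAC ler_pdivrMr; nra.
Qed.

(** A function that changes sign after a half period has equally spaced zeros with
step [1/2]. *)
Lemma Wirtinger_antiperiodic (S : nat) f df : H1 0 S.+1%:R f df ->
  f S.+1%:R = f 0 -> (forall t, f (t + 1 / 2) = - f t) ->
  (2 * pi) ^+ 2 * Int 0 S.+1%:R (fun t => f t ^+ 2) <=
  Int 0 S.+1%:R (fun t => df t ^+ 2).
Proof.
move=> fH fS fa.
have S1 : (1 : R) <= S.+1%:R by rewrite ler1n.
have cf : C0 0 (1 / 2) f by apply: (@C0_sub _ 0 S.+1%:R); [lra|lra|apply: H1_C0 fH; lra].
have f12 : f (1 / 2) = - f 0 by rewrite -fa add0r.
have [||a a12 fa0] := @IVT R f 0 (1 / 2) 0 _ cf; first lra.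
  by rewrite f12 ge_min le_max; case: (lerP 0 (f 0)) => ?; apply/andP; split; apply/orP; lra.
move: a12; rewrite in_itv/= => a12.
(* [2 S + 2] steps of length [1/2]. *)
have := @Wirtinger_zeros R S.+1%:R (1 / 2) a (S.*2.+1) f df.
have -> : pi / (1 / 2) = 2 * pi :> R by field.
apply=> //.
- by rewrite -addn1 -addnn !natrD -natr1; field.
- move=> k _; elim: k => [|k IH]; first by rewrite mul0r addr0.
  rewrite (_ : _ + _ = a + k%:R * (1 / 2) + 1 / 2); last by rewrite -natr1; ring.
  by rewrite fa IH oppr0.
Qed.

Lemma Wirtinger_zeros_quarter (S : nat) f df : H1 0 S.+1%:R f df ->
  f S.+1%:R = f 0 -> forall a : R, 0 <= a <= 1 / 4 ->
  f a = 0 -> f (a + 1 / 4) = 0 ->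
  (forall t, f t = 0 -> f (t + 1 / 2) = 0) ->
  (4 * pi) ^+ 2 * Int 0 S.+1%:R (fun t => f t ^+ 2) <=
  Int 0 S.+1%:R (fun t => df t ^+ 2).
Proof.
move=> fH fS a a14 fa0 fa1 fa.
(* [4 S + 4] steps of length [1/4]. *)
have := @Wirtinger_zeros R S.+1%:R (1 / 4) a (4 * S + 3) f df.
have -> : pi / (1 / 4) = 4 * pi :> R by field.
apply=> //.
- by rewrite -(addn1 (4 * S + 3)) -natr1 2!natrD (natrM _ 4 S); field.
- have H (k : nat) : f (a + k%:R * (1 / 4)) = 0 /\ f (a + k.+1%:R * (1 / 4)) = 0.
    elim: k => [|k [IH1 IH2]].
      by rewrite mul0r addr0 (mul1r (1 / 4)).
    split=> //; have := fa _ IH1; congr (_ = _); congr f.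
    by rewrite -[k.+2%:R]natr1 -natr1; field.
  by move=> k _; case: (H k).
Qed.

(** By the intermediate value theorem [f] takes a common value [c] at some [a] and at
[a + 1/4], hence at all the points [a + k/4].  Subtracting [c] does not lower the
integral of the square, because [f] has mean zero. *)
Lemma Wirtinger_periodic (S : nat) f df : H1 0 S.+1%:R f df ->
  f S.+1%:R = f 0 -> (forall t, f (t + 1 / 2) = f t) ->
  Int 0 S.+1%:R f = 0 ->
  (4 * pi) ^+ 2 * Int 0 S.+1%:R (fun t => f t ^+ 2) <=
  Int 0 S.+1%:R (fun t => df t ^+ 2).
Proof.
move=> fH fS fp f0.
have S1 : (1 : R) <= S.+1%:R by rewrite ler1n.
have cf : C0 0 S.+1%:R f by apply: H1_C0 fH; lra.
pose g t := f (t + 1 / 4) - f t.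
have cg : C0 0 (1 / 4) g.
  apply: C0B; last by apply: C0_sub cf; lra.
  by apply: C0_shift; apply: C0_sub cf; lra.
have g14 : g (1 / 4) = - g 0.
  rewrite /g add0r (_ : 1 / 4 + 1 / 4 = 0 + 1 / 2); last by field.
  by rewrite fp; ring.
have [||a a14 ga0] := @IVT R g 0 (1 / 4) 0 _ cg; first lra.
  by rewrite g14 ge_min le_max; case: (lerP 0 (g 0)) => ?; apply/andP; split; apply/orP; lra.
move: a14; rewrite in_itv/= => a14.
pose c := f a; have fH' : H1 0 S.+1%:R (fun t => f t + - c) df.
  split; last exact: fH.2.
  have := acD fH.1 (ac_cst 0 S.+1%:R (- c)).
  by apply: ac_eq => // t _; rewrite addr0.
apply: le_trans (Wirtinger_zeros_quarter fH' _ a14 _ _ _).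
- rewrite ler_wpM2l ?sqr_ge0//.
  rewrite [leRHS](@Int_eq _ _ _ _ (fun t => f t ^+ 2 + (- (2 * c) * f t + c ^+ 2))); last first.
    by move=> t _; ring.
  have fi : L1 0 S.+1%:R f by exact: L1_continuous.
  rewrite IntD; [|by apply: L1_continuous; exact: C0X|by apply: L1D; [exact: L1Z|exact: L1_cst]].
  rewrite IntD; [|exact: L1Z|exact: L1_cst].
  rewrite IntZ// f0 mulr0 add0r Int_cst; last lra.
  by rewrite lerDl mulr_ge0 ?sqr_ge0//; lra.
- by rewrite fS.
- by rewrite subrr.
- by move: ga0; rewrite /g -/c => /eqP; rewrite subr_eq0 => /eqP ->; rewrite subrr.
- by move=> t; rewrite fp.
Qed.

Lemma sobolev_H1P T f : sobolev_H1 T f -> H1 0 T f (derive1 f).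
Proof.
move=> [mf f2 fE].
have L : L2 0 T (derive1 f).
  split=> //; apply/integrableP; split.
    by apply/measurable_EFinP; apply: measurable_funX.
  apply: le_lt_trans f2; apply: ge0_le_integral_any => t _ //=.
  by rewrite ger0_norm// sqr_ge0.
split=> //; split; first exact: L2_L1.
by move=> t tT; rewrite [LHS]fE.
Qed.

Lemma sobolev_C1 T f df : 0 <= T -> (forall t, is_derive t (1:R) f (df t)) ->
  continuous df -> sobolev_H1 T f.
Proof.
move=> T0 fd cdf.
have dE : derive1 f = df by apply/funext => t; rewrite derive1E; case: (fd t).
have [fi fE] : ac 0 T f df.
  by apply: ac_C1 => // ; apply: C0_continuous.
have cd : C0 0 T df by exact: C0_continuous.
rewrite /sobolev_H1 dE; split.
- exact: L1_measurable.
- apply: integrable_lty => //.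
  by have := L1_continuous (C0X (n:=2) cd).
- exact: fE.
Qed.

End Periodic.

(** * The frequencies of the regular polygon *)
Section Expi.
Context {R : realType}.
Implicit Types (a b : R) (w z : R[i]).

Lemma expiD a b : expi (a + b) = expi a * expi b.
Proof.
by rewrite /expi cosD sinD [sin a * _ + _]addrC.
Qed.

Lemma expi0 : expi (0 : R) = 1.
Proof. by rewrite /expi cos0 sin0. Qed.

Lemma expiN a : expi (- a) = ((expi a)^*)%C.
Proof. by rewrite /expi cosN sinN. Qed.

Lemma expiNK a : expi a * expi (- a) = 1.
Proof. by rewrite -expiD subrr expi0. Qed.

Lemma expi_neq0 a : expi a != 0.
Proof. by apply/eqP => e0; have := expiNK a; rewrite e0 mul0r => /esym/eqP; rewrite oner_eq0. Qed.

Lemma expiV a : (expi a)^-1 = expi (- a).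
Proof. by rewrite -[RHS]mul1r -(mulVf (expi_neq0 a)) -mulrA expiNK mulr1. Qed.

Lemma expiX a n : expi a ^+ n = expi (n%:R * a).
Proof.
elim: n => [|n IH]; first by rewrite mul0r expi0.
by rewrite exprS IH -expiD -natr1 mulrDl mul1r addrC.
Qed.

Lemma expiXz a (m : int) : expi a ^ m = expi (m%:~R * a).
Proof.
case: m => n; first by rewrite -exprnP expiX.
by rewrite NegzE -exprnN expiX expiV mulrNz mulNr.
Qed.

Lemma expi2pi (m : int) : expi (2 * pi * m%:~R : R) = 1.
Proof.
rewrite mulrC -expiXz (_ : expi (2 * pi) = 1) ?exp1rz//.
by rewrite /expi mulr_natl cos2pi sin2pi.
Qed.

Lemma expi2piD a (m : int) : expi (a + 2 * pi * m%:~R) = expi a.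
Proof. by rewrite expiD expi2pi mulr1. Qed.

Lemma cmod_sqr w : cmod w ^+ 2 = complex.Re w ^+ 2 + complex.Im w ^+ 2.
Proof. by case: w => x y; rewrite /cmod /= sqr_sqrtr// addr_ge0 ?sqr_ge0. Qed.

Lemma cmod_ge0 w : 0 <= cmod w.
Proof. by case: w => x y; rewrite /cmod /= sqrtr_ge0. Qed.

Lemma cmodM w z : cmod (w * z) = cmod w * cmod z.
Proof. exact: ComplexField.Normc.normcM. Qed.

Lemma cmod_expi a : cmod (expi a) = 1.
Proof. by rewrite /cmod /= cos2Dsin2 sqrtr1. Qed.

Lemma cmod_real (k : R) : cmod (k%:C)%C = `|k|.
Proof. by rewrite /cmod /= expr0n/= addr0 sqrtr_sqr. Qed.

Lemma cmodN w : cmod (- w) = cmod w.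
Proof. by case: w => x y; rewrite /cmod /= !sqrrN. Qed.

Lemma zetaE N : zeta R N = expi (2 * pi / N%:R).
Proof. by []. Qed.

Lemma zetaX N j : zeta R N ^+ j = expi (2 * pi * j%:R / N%:R).
Proof. by rewrite zetaE expiX; congr expi; ring. Qed.

Lemma zeta_neq0 N : zeta R N != 0.
Proof. exact: expi_neq0. Qed.

Lemma zetaXN N : (0 < N)%N -> zeta R N ^+ N = 1.
Proof.
move=> N0; rewrite zetaX (_ : _ / _ = 2 * pi * 1%:~R) ?expi2pi//.
by rewrite mulr1 mulfK// pnatr_eq0 -lt0n.
Qed.

Lemma zetaX_mod N j : (0 < N)%N -> zeta R N ^+ (j %% N) = zeta R N ^+ j.
Proof.
move=> N0; rewrite [in RHS](divn_eq j N) exprD mulnC exprM zetaXN//.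
by rewrite expr1n mul1r.
Qed.

(** The chord of an arc is twice the sine of half the angle. *)
Lemma rhoE N j : (0 < N)%N -> (j <= N)%N -> rho R N j = 2 * sin (pi * j%:R / N%:R).
Proof.
move=> N0 jN.
have N0r : 0 < N%:R :> R by rewrite ltr0n.
have s0 : 0 <= sin (pi * j%:R / N%:R) :> R.
  apply: sin_ge0_pi; apply/andP; split.
    by rewrite !mulr_ge0// ?invr_ge0 ?pi_ge0.
  by rewrite -mulrA ler_piMr ?pi_ge0// ler_pdivrMr// mul1r ler_nat.
apply/eqP; rewrite -(@eqrXn2 _ 2)//; [|exact: cmod_ge0|by rewrite mulr_ge0].
rewrite /rho cmod_sqr zetaX /expi /=.
set u := pi * _ / _; rewrite (_ : 2 * pi * _ / _ = u *+ 2); last by rewrite /u; ring.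
rewrite cos_mulr2n sin_mulr2n; apply/eqP.
have := cos2Dsin2 u; move: (cos u) (sin u) => c s cs.
rewrite subr0; have -> : c ^+ 2 = 1 - s ^+ 2 by lra.
rewrite exprMn_n exprMn (_ : c ^+ 2 = 1 - s ^+ 2); [ring|lra].
Qed.

Lemma rho_gt0 N j : (0 < j < N)%N -> 0 < rho R N j.
Proof.
move=> /andP[j0 jN]; rewrite rhoE; [|lia|lia].
have N0r : 0 < N%:R :> R by rewrite ltr0n; lia.
rewrite mulr_gt0// sin_gt0_pi//; apply/andP; split.
  by rewrite !mulr_gt0 ?invr_gt0 ?pi_gt0// ltr0n.
by rewrite -mulrA gtr_pMr ?pi_gt0// ltr_pdivrMr// mul1r ltr_nat.
Qed.

Lemma Re_sum (I : Type) (r : seq I) (P : pred I) (F : I -> R[i]) :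
  complex.Re (\sum_(i <- r | P i) F i) = \sum_(i <- r | P i) complex.Re (F i).
Proof. by apply: (big_morph (@complex.Re R)) => // -[? ?] [? ?]. Qed.

Lemma Re_divC w (k : R) : complex.Re (w / (k%:C)%C) = complex.Re w / k.
Proof. by rewrite -fmorphV; case: w => x y /=; rewrite mulr0 subr0. Qed.

End Expi.

Section Omega.
Context {R : realType} (N : nat).
Hypothesis N2 : (2 <= N)%N.
Implicit Types (l d : nat).

(** The square of the frequency [omega_l], written with real terms. *)
Definition omega2 l : R :=
  \sum_(1 <= d < N) (1 - cos (2 * pi * (d * l)%:R / N%:R)) / rho R N d ^+ 3.

Let N0 : N%:R != 0 :> R.
Proof. by rewrite pnatr_eq0; lia. Qed.

Lemma omega_omega2 l (e : int) : e = 1 \/ e = -1 ->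
  omega R N (l%:Z * e) = Num.sqrt (omega2 l).
Proof.
move=> e1; rewrite /omega; congr Num.sqrt.
rewrite Re_sum.
apply: eq_bigr => d _.
rewrite Re_divC; congr (_ / _).
rewrite zetaE expiXz; case: e1 => ->.
- by rewrite mulr1 -PoszM pmulrn /=; congr (1 - cos _); ring.
- rewrite mulrN1 mulrN -PoszM mulrNz mulNr expiN pmulrn /=.
  by congr (1 - cos _); ring.
Qed.

Let angle d : R := pi * d%:R / N%:R.

Let sin_angle_gt0 d : (1 <= d < N)%N -> 0 < sin (angle d).
Proof.
move=> dN; have := @rho_gt0 R N d dN.
by rewrite rhoE ?pmulr_rgt0//; lia.
Qed.

(** Four times the increment of [omega2], by [omega2_incrE]. *)
Let incr l : R := \sum_(1 <= d < N) sin ((2 * l + 1)%:R * angle d) / sin (angle d) ^+ 2.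

Lemma omega2_incrE l : omega2 l.+1 - omega2 l = incr l / 4.
Proof.
rewrite /omega2 /incr mulr_suml -sumrB; apply: eq_big_nat => d dN.
rewrite rhoE; [|lia|lia].
have s0 := sin_angle_gt0 dN.
rewrite -/(angle d); set A := (2 * l + 1)%:R * angle d.
have -> : 2 * pi * (d * l.+1)%:R / N%:R = A + angle d.
  by rewrite /A /angle natrM natrD natrM -natr1; field.
have -> : 2 * pi * (d * l)%:R / N%:R = A - angle d.
  by rewrite /A /angle natrM natrD natrM; field.
rewrite cosD cosB; field.
by rewrite gt_eqF.
Qed.

(** The factor [sin^2] cancels: what remains is a sum of sines of equally spaced
angles. *)
Lemma omega2_incr_diff2 l : incr l.+2 + incr l - 2 * incr l.+1 =
  - 4 * \sum_(1 <= d < N) sin ((2 * l + 3)%:R * angle d).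
Proof.
rewrite /incr !mulr_sumr -big_split/= -sumrB; apply: eq_big_nat => d dN.
have s0 := sin_angle_gt0 dN.
set B := (2 * l + 3)%:R * angle d.
have -> : (2 * l.+2 + 1)%:R * angle d = B + angle d *+ 2.
  by rewrite /B (_ : (2 * l.+2 + 1)%N = (2 * l + 3 + 2)%N) ?natrD; [ring|lia].
have -> : (2 * l + 1)%:R * angle d = B - angle d *+ 2.
  by rewrite /B (_ : (2 * l + 3)%N = (2 * l + 1 + 2)%N) ?natrD; [ring|lia].
have -> : (2 * l.+1 + 1)%:R * angle d = B.
  by rewrite /B (_ : (2 * l.+1 + 1)%N = (2 * l + 3)%N)//; lia.
rewrite sinB sinD cos_mulr2n cos2sin2; field.
by rewrite gt_eqF.
Qed.

(** Put [p = (2 l + 3) pi / N].  After multiplication by [2 sin (p / 2)] the sum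
telescopes to [2 cos (p / 2)], and [p <= pi]. *)
Lemma sum_sin_ge0 l : (2 * l + 3 <= N)%N ->
  0 <= \sum_(1 <= d < N) sin ((2 * l + 3)%:R * angle d) :> R.
Proof.
move=> lN; pose p : R := (2 * l + 3)%:R * pi / N%:R.
have N0r : 0 < N%:R :> R by rewrite ltr0n; lia.
have p0 : 0 < p by rewrite /p !mulr_gt0 ?invr_gt0 ?pi_gt0// ltr0n; lia.
have ppi : p <= pi.
  by rewrite /p mulrAC ler_piMl ?pi_ge0// ler_pdivrMr// mul1r ler_nat.
have sp : 0 < sin (p / 2) by apply: sin_gt0_pi; apply/andP; split; lra.
rewrite -(pmulr_rge0 _ (_ : 0 < 2 * sin (p / 2))); last by rewrite mulr_gt0.
rewrite mulr_sumr.
rewrite (_ : \sum_(1 <= d < N) _ =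
    \sum_(1 <= d < N) (- cos (d.+1%:R * p - p / 2) - - cos (d%:R * p - p / 2))).
  rewrite telescope_sumr ?(ltnW N2)// mul1r.
  have -> : N%:R * p - p / 2 = - (p / 2) + pi + pi *+ 2 *+ l.+1.
    rewrite (_ : N%:R * p = (2 * l + 3)%:R * pi); last by rewrite /p; field.
    by rewrite -[_ *+ l.+1]mulr_natr -[pi *+ 2]mulr_natr -[l.+1%:R]natr1 natrD natrM; ring.
  rewrite (periodicn (@cosD2pi R)) cosDpi cosN opprK opprK (_ : p - p / 2 = p / 2); last by field.
  have := @cos_ge0_pihalf R (p / 2); have := @pi_gt0 R.
  by move=> ? H; rewrite addr_ge0// H//; apply/andP; split; lra.
apply: eq_big_nat => d dN.
have -> : (2 * l + 3)%:R * angle d = d%:R * p by rewrite /angle /p; field.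
have -> : d.+1%:R * p - p / 2 = d%:R * p + p / 2 by rewrite -natr1; field.
by rewrite cosB cosD; ring.
Qed.

Lemma omega2_incr0_gt0 : 0 < incr 0.
Proof.
rewrite /incr big_ltn//; apply: ltr_wpDr.
  rewrite big_nat; apply: sumr_ge0 => d dN; rewrite mul1r.
  have s0 : 0 < sin (angle d) by apply: sin_angle_gt0; lia.
  by rewrite divr_ge0 ?sqr_ge0// ltW.
have s0 : 0 < sin (angle 1) by apply: sin_angle_gt0; lia.
by rewrite mul1r divr_gt0 ?exprn_gt0.
Qed.

Lemma omega2_incr_antisym l : (l < N)%N -> incr (N - 1 - l) = - incr l.
Proof.
move=> lN; rewrite /incr -sumrN; apply: eq_big_nat => d dN.
rewrite -mulNr; congr (_ / _).
have -> : (2 * (N - 1 - l) + 1)%:R * angle d =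
  - ((2 * l + 1)%:R * angle d) + pi *+ 2 *+ d.
  have -> : (2 * (N - 1 - l) + 1)%:R = 2 * N%:R - (2 * l + 1)%:R :> R.
    by rewrite -natrM -natrB; [congr (_%:R)|]; lia.
  by rewrite /angle -[_ *+ d]mulr_natr -[pi *+ 2]mulr_natr; field.
by rewrite (periodicn (@sinD2pi R)) sinN.
Qed.

(** Before [N/2] the increments are concave in [l], and the first one is positive.  If
one of them were not positive, they would stay nonpositive and decrease strictly
from there on, up to index [N/2].  This contradicts [omega2_incr_antisym], by which
the increment at [N/2] is the opposite of itself ([N] odd) or of the one
before it ([N] even). *)
Lemma omega2_incr_gt0 l : (l < N./2)%N -> 0 < incr l.
Proof.
elim: l => [_|l IH lN]; first exact: omega2_incr0_gt0.
have {}IH := IH (ltnW lN); rewrite ltNge; apply/negP => Dl.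
have key k : (l.+1 + k < N./2)%N -> incr (l.+1 + k) <= 0 /\ incr (l.+1 + k).+1 < incr (l.+1 + k).
  elim: k => [|k IHk] kN.
    rewrite addn0; split=> //.
    have := omega2_incr_diff2 l; have := @sum_sin_ge0 l; rewrite addn0 in kN.
    by move=> /(_ ltac:(lia)) ? ?; lra.
  have [IH1 IH2] := IHk ltac:(lia).
  rewrite addnS; split; first lra.
  have := omega2_incr_diff2 (l.+1 + k); have := @sum_sin_ge0 (l.+1 + k).
  by move=> /(_ ltac:(lia)) ? ?; lra.
have [m mE] : exists m, N./2 = (l.+1 + m).+1 by exists (N./2 - l.+2)%N; lia.
have [K1 K2] := key m ltac:(lia).
have := @omega2_incr_antisym N./2 ltac:(lia).
have [->|->] : (N - 1 - N./2 = N./2 \/ N - 1 - N./2 = l.+1 + m)%N by lia.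
- by rewrite mE; lra.
- by rewrite mE; lra.
Qed.

Lemma omega2_ltS l : (l < N./2)%N -> omega2 l < omega2 l.+1.
Proof. by move=> /omega2_incr_gt0; have := omega2_incrE l; lra. Qed.

Lemma omega2_lt l m : (l < m)%N -> (m <= N./2)%N -> omega2 l < omega2 m.
Proof.
elim: m => // m IH; rewrite ltnS leq_eqVlt => /predU1P[->|lm] mN.
  exact: omega2_ltS.
by apply: lt_trans (omega2_ltS mN); apply: IH => //; exact: ltnW.
Qed.

Lemma omega2_0 : omega2 0 = 0.
Proof.
rewrite /omega2 big1// => d _.
by rewrite muln0 mulr0 mul0r cos0 subrr mul0r.
Qed.

Lemma omega2_sub l : (l <= N)%N -> omega2 (N - l) = omega2 l.
Proof.
move=> lN; apply: eq_bigr => d _; congr ((1 - _) / _).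
rewrite -[RHS]cosN -[RHS](periodicn (@cosD2pi R) d); congr cos.
by rewrite !natrM natrB// -[_ *+ d]mulr_natr -[pi *+ 2]mulr_natr; field.
Qed.

Lemma omega2_max l : (l < N)%N -> omega2 l <= omega2 N./2.
Proof.
move=> lN; have H m : (m <= N./2)%N -> omega2 m <= omega2 N./2.
  rewrite leq_eqVlt => /predU1P[->//|mN].
  by apply/ltW/omega2_lt.
have [lh|lh] := leqP l N./2; first exact: H.
by rewrite -omega2_sub ?(ltnW lN)// H//; lia.
Qed.

Lemma omega2_1_gt0 : 0 < omega2 1.
Proof. by rewrite -omega2_0 omega2_lt//; lia. Qed.

End Omega.

(** * The quadratic form of the polygon and its Fourier modes *)
Section Polygon.
Context {R : realType} (N : nat).
Hypothesis N2 : (1 < N)%N.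
Implicit Types (i j d l : 'Z_N) (f x : 'Z_N -> R).
Local Notation z := (zeta R N).

Let N0 : (0 < N)%N. Proof. exact: ltnW. Qed.

Let ltZ i : (i < N)%N.
Proof. by have := ltn_ord i; rewrite [X in (_ < X)%N]Zp_cast. Qed.

Lemma zetaZD i j : z ^+ (i + j)%R = z ^+ i * z ^+ j.
Proof. by rewrite -exprD /= [X in (_ %% X)%N]Zp_cast// zetaX_mod. Qed.

Lemma zetaZN i : z ^+ (- i)%R = ((z ^+ i)^*)%C.
Proof.
have : z ^+ i * z ^+ (- i)%R = z ^+ i * ((z ^+ i)^*)%C.
  by rewrite -zetaZD subrr expr0 zetaX -expiN expiNK.
by apply: mulfI; rewrite expf_neq0// zeta_neq0.
Qed.

Lemma zetaZ0 : z ^+ (0%R : 'Z_N) = 1.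
Proof. by []. Qed.

Lemma cmod_zeta n : cmod (z ^+ n) = 1.
Proof. by rewrite zetaX cmod_expi. Qed.

Definition rhoZ i j : R := cmod (z ^+ i - z ^+ j).

Lemma rhoZE i j : rhoZ i j = rho R N (i - j)%R.
Proof.
have -> : rhoZ i j = cmod ((z ^+ (i - j)%R - 1) * z ^+ j).
  by rewrite mulrBl mul1r -zetaZD subrK.
by rewrite cmodM cmod_zeta mulr1.
Qed.

Lemma rhoZC i j : rhoZ i j = rhoZ j i.
Proof. by rewrite /rhoZ -cmodN opprB. Qed.

Lemma rhoZii i : rhoZ i i = 0.
Proof. by rewrite /rhoZ subrr /cmod /= expr0n/= addr0 sqrtr0. Qed.

Lemma rhoZ_gt0 i j : i != j -> 0 < rhoZ i j.
Proof.
move=> ij; rewrite rhoZE rho_gt0// ltZ andbT lt0n.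
by apply: contraNneq ij => /eqP/= e; rewrite -subr_eq0; apply/eqP/val_inj/eqP.
Qed.

Lemma sum_zeta_eq0 d : d != 0 -> \sum_(l : 'Z_N) z ^+ (d * l)%N = 0.
Proof.
move=> d0; have zd : z ^+ d - 1 != 0.
  have := @rhoZ_gt0 d 0 d0; rewrite /rhoZ zetaZ0.
  by apply: contraTneq => ->; rewrite /cmod /= expr0n/= addr0 sqrtr0 ltxx.
apply: (mulfI zd); rewrite mulr0.
have := subrX1 (z ^+ d) N; rewrite -exprM mulnC exprM zetaXN// expr1n subrr => E.
rewrite [RHS]E; congr (_ * _).
rewrite -(big_mkord xpredT (fun l : nat => z ^+ (d * l)%N)).
rewrite -(big_mkord xpredT (fun l : nat => (z ^+ d) ^+ l)).
by rewrite [X in index_iota 0 X]Zp_cast//; apply: eq_bigr => l _; rewrite exprM.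
Qed.

(** The discrete Fourier transform of a real function of the bodies. *)
Definition dft f l : R[i] := \sum_(j : 'Z_N) (f j)%:C%C * z ^+ (j * l)%N.

Lemma mul_conj (w : R[i]) : w * (w^*)%C = ((cmod w ^+ 2)%:C)%C.
Proof.
by rewrite cmod_sqr; case: w => a b; rewrite /= /real_complex_def; congr Complex; ring.
Qed.

Lemma Parseval f : \sum_(l : 'Z_N) cmod (dft f l) ^+ 2 = N%:R * \sum_(j : 'Z_N) f j ^+ 2.
Proof.
apply: (@complexI R); rewrite rmorph_sum rmorphM rmorph_sum /=.
under eq_bigr => l _.
  rewrite -mul_conj /dft (rmorph_sum (@conjc R)) mulr_suml.
  under eq_bigr => j _ do rewrite mulr_sumr.
  over.
rewrite exchange_big/= mulr_sumr; apply: eq_bigr => j _.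
rewrite exchange_big/=.
have E k : \sum_(l : 'Z_N) (f j)%:C%C * z ^+ (j * l)%N * (((f k)%:C%C * z ^+ (k * l)%N)^*)%C =
   (f j)%:C%C * (f k)%:C%C * \sum_(l : 'Z_N) z ^+ ((j - k)%R * l)%N.
  rewrite mulr_sumr; apply: eq_bigr => l _.
  rewrite (exprM _ (j - k)%R) zetaZD zetaZN exprMn -exprM rmorphM /=.
  by rewrite -(rmorphXn (@conjc R)) -exprM oppr0 -/(real_complex R _); ring.
pose S d := \sum_(l : 'Z_N) z ^+ (d * l)%N.
have S0 : S 0 = N%:R.
  rewrite /S; under eq_bigr do rewrite mul0n expr0.
  by rewrite sumr_const card_ord [X in _ *+ X]Zp_cast.
under eq_bigr do rewrite E -/(S _).
rewrite (bigD1 j)//= subrr S0 big1 ?addr0; last first.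
  by move=> k kj; rewrite /S sum_zeta_eq0 ?mulr0// subr_eq0 eq_sym.
by rewrite mulrC expr2 rmorphM rmorph_nat.
Qed.

Lemma dft_shift f d l : dft (fun j => f (j + d)) l = (z ^+ (d * l)%N)^-1 * dft f l.
Proof.
rewrite /dft [in RHS](reindex_inj (addIr d))/= mulr_sumr; apply: eq_bigr => j _.
rewrite [in RHS](exprM _ (j + d)%R) zetaZD exprMn -!exprM.
rewrite mulrCA; congr (_ * _); rewrite mulrC mulfK//.
by rewrite expf_neq0// zeta_neq0.
Qed.

Lemma cmod_dft_diff f d l : cmod (dft (fun j => f (j + d) - f j) l) ^+ 2 =
  2 * (1 - cos (2 * pi * (d * l)%:R / N%:R)) * cmod (dft f l) ^+ 2.
Proof.
have -> : dft (fun j => f (j + d) - f j) l = ((z ^+ (d * l)%N)^-1 - 1) * dft f l.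
  rewrite mulrBl mul1r -dft_shift /dft -sumrB; apply: eq_bigr => j _.
  by rewrite rmorphB /= mulrBl.
rewrite cmodM exprMn; congr (_ * _); rewrite cmod_sqr zetaX expiV expiN /expi /=.
set u := _ / _; have := cos2Dsin2 u; rewrite subr0 sqrrN => E.
rewrite (_ : sin u ^+ 2 = 1 - cos u ^+ 2); [by ring|lra].
Qed.

Lemma sum_pairs (F : 'Z_N -> 'Z_N -> R) : (forall i j, F i j = F j i) ->
  (forall i, F i i = 0) ->
  \sum_(i : 'Z_N) \sum_(j : 'Z_N | (i < j)%N) F i j = 2^-1 * \sum_(i : 'Z_N) \sum_(j : 'Z_N) F i j.
Proof.
move=> Fs F0; have E : \sum_(i : 'Z_N) \sum_(j : 'Z_N) F i j =
    \sum_(i : 'Z_N) \sum_(j : 'Z_N | (i < j)%N) F i j + \sum_(i : 'Z_N) \sum_(j : 'Z_N | (j < i)%N) F i j.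
  rewrite -big_split; apply: eq_bigr => i _ /=.
  rewrite (bigID (fun j => (i < j)%N))/=; congr (_ + _).
  rewrite [LHS](bigD1 i) ?ltnn//= F0 add0r; apply: eq_bigl => j.
  by rewrite -leqNgt ltn_neqAle andbC.
have E2 : \sum_(i : 'Z_N) \sum_(j : 'Z_N | (j < i)%N) F i j = \sum_(i : 'Z_N) \sum_(j : 'Z_N | (i < j)%N) F i j.
  rewrite (exchange_big_dep xpredT)//=; apply: eq_bigr => i _.
  by apply: eq_bigr => j _.
by rewrite E E2; field.
Qed.

(** A circulant form is a sum over the difference [d] of the two indices. *)
Lemma circulantE (k : 'Z_N -> R) f :
  \sum_(i : 'Z_N) \sum_(j : 'Z_N) k (i - j) * (f i - f j) ^+ 2 =
  \sum_(d : 'Z_N) k d * \sum_(j : 'Z_N) (f (j + d) - f j) ^+ 2.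
Proof.
rewrite exchange_big/=.
under eq_bigr => j _.
  rewrite (reindex_inj (addrI j))/=.
  under eq_bigr => d _ do rewrite [j + d - j]addrAC subrr add0r.
  over.
by rewrite exchange_big/=; apply: eq_bigr => d _; rewrite mulr_sumr.
Qed.

(** In Fourier coordinates the form is diagonal, with eigenvalue [omega2 N l] on the
mode [l]. *)
Lemma circulant_le f :
  \sum_(i : 'Z_N) \sum_(j : 'Z_N | (i < j)%N) (f i - f j) ^+ 2 / rhoZ i j ^+ 3 <=
  omega2 N N./2 * \sum_(j : 'Z_N) f j ^+ 2.
Proof.
rewrite (@sum_pairs (fun i j => (f i - f j) ^+ 2 / rhoZ i j ^+ 3)); last 2 first.
- by move=> i j; rewrite rhoZC -sqrrN opprB.
- by move=> i; rewrite subrr expr0n mul0r.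
under eq_bigr do under eq_bigr do rewrite rhoZE mulrC.
rewrite (circulantE (fun d => (rho R N d ^+ 3)^-1)).
have Nr : 0 < N%:R :> R by rewrite ltr0n.
have -> : \sum_(d : 'Z_N) (rho R N d ^+ 3)^-1 * \sum_(j : 'Z_N) (f (j + d) - f j) ^+ 2 =
    2 / N%:R * \sum_(l : 'Z_N) omega2 N l * cmod (dft f l) ^+ 2.
  under eq_bigr => d _.
    rewrite (_ : \sum_(j : 'Z_N) _ = N%:R^-1 * \sum_(l : 'Z_N) cmod (dft (fun j => f (j + d) - f j) l) ^+ 2).
      rewrite mulrCA mulr_sumr; under eq_bigr do rewrite cmod_dft_diff.
      over.
    by rewrite Parseval mulKf// gt_eqF.
  rewrite -mulr_sumr exchange_big/= [2 / _]mulrC -[RHS]mulrA; congr (_ * _).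
  rewrite mulr_sumr; apply: eq_bigr => l _.
  rewrite mulrA /omega2 mulr_sumr mulr_suml.
  rewrite -(big_mkord xpredT (fun d : nat => (rho R N d ^+ 3)^-1 *
     (2 * (1 - cos (2 * pi * (d * l)%:R / N%:R)) * cmod (dft f l) ^+ 2))).
  rewrite [X in index_iota 0 X]Zp_cast// big_ltn//.
  rewrite mul0n mulr0 mul0r cos0 subrr mulr0 mul0r mulr0 add0r.
  by apply: eq_bigr => d _; ring.
rewrite mulrA (_ : 2^-1 * (2 / N%:R) = N%:R^-1); last by field; rewrite gt_eqF.
rewrite ler_pdivrMl// mulrCA -Parseval mulr_sumr; apply: ler_sum => l _.
by rewrite ler_wpM2r ?sqr_ge0// omega2_max.
Qed.

(** This is the value of the form of [circulant_le] on a regular polygon inscribed in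
the unit circle: [rho^2 / rho^3 = 1 / rho]. *)
Lemma sum_inv_rho :
  \sum_(i : 'Z_N) \sum_(j : 'Z_N | (i < j)%N) (rhoZ i j)^-1 = N%:R * omega2 N 1.
Proof.
rewrite (@sum_pairs (fun i j => (rhoZ i j)^-1)); last 2 first.
- by move=> i j; rewrite rhoZC.
- by move=> i; rewrite rhoZii invr0.
have E i : \sum_(j : 'Z_N) (rhoZ i j)^-1 = 2 * omega2 N 1.
  rewrite (reindex_inj (addrI i))/=.
  under eq_bigr do rewrite rhoZC rhoZE addrC addKr.
  rewrite -(big_mkord xpredT (fun d : nat => (rho R N d)^-1)).
  rewrite [X in index_iota 0 X]Zp_cast// big_ltn//.
  rewrite {1}/rho expr0 subrr /cmod /= expr0n/= addr0 sqrtr0 invr0 add0r.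
  rewrite /omega2 mulr_sumr; apply: eq_big_nat => d dN.
  have r0 := @rho_gt0 R N d dN.
  have : rho R N d ^+ 2 = 2 * (1 - cos (2 * pi * (d * 1)%:R / N%:R)).
    rewrite /rho cmod_sqr zetaX muln1 /expi /= subr0.
    set u := _ / _; have := cos2Dsin2 u => E.
    rewrite (_ : sin u ^+ 2 = 1 - cos u ^+ 2); [by ring|lra].
  by rewrite mulrA => <-; field; rewrite gt_eqF.
under eq_bigr do rewrite E.
by rewrite sumr_const card_ord [X in _ * (_ *+ X)]Zp_cast// -[_ *+ N]mulr_natr; field.
Qed.

End Polygon.

(** * The energy estimate *)
Section Null.
Context {R : realType}.
Implicit Types (f g : R -> R) (a b k : R).

(** Integrable functions with vanishing integral. *)
Definition null a b f := L1 a b f /\ Int a b f = 0.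

Lemma nullD a b f g : null a b f -> null a b g -> null a b (fun t => f t + g t).
Proof. by move=> [fi f0] [gi g0]; split; [exact: L1D|rewrite IntD// f0 g0 addr0]. Qed.

Lemma nullB a b f g : null a b f -> null a b g -> null a b (fun t => f t - g t).
Proof. by move=> [fi f0] [gi g0]; split; [exact: L1B|rewrite IntB// f0 g0 subr0]. Qed.

Lemma nullZ a b k f : null a b f -> null a b (fun t => k * f t).
Proof. by move=> [fi f0]; split; [exact: L1Z|rewrite IntZ// f0 mulr0]. Qed.

Lemma null_sum (I : Type) (r : seq I) (P : pred I) a b (F : I -> R -> R) :
  (forall i, null a b (F i)) -> null a b (fun t => \sum_(i <- r | P i) F i t).
Proof.
move=> F0; split; first by apply: L1_sum => i; case: (F0 i).
rewrite Int_sum; last by move=> i; case: (F0 i).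
by apply: big1 => i _; case: (F0 i).
Qed.

End Null.

(** The velocity in the inertial frame is [e + i X (m + v)], where [m] is the mean and
[v] the deviation.  The square of its modulus is split into a constant, a part that
is linear in [(e, v)], and a quadratic part.  With [s] the sign of [X] and
[aX = k p] its absolute value, the quadratic part combines the Wirtinger term
[|e|^2 - p^2 |v|^2], the square [|e + i s p v|^2] and [(p - aX)^2 |v|^2]. *)
Lemma twisted_kinetic (R : realType) (e1 e2 v1 v2 m1 m2 X p k s aX : R) :
  aX * s = X -> s ^+ 2 = 1 -> aX = k * p -> X ^+ 2 = aX ^+ 2 ->
  (e1 - X * (m2 + v2)) ^+ 2 + (e2 + X * (m1 + v1)) ^+ 2 =
  X ^+ 2 * (m1 ^+ 2 + m2 ^+ 2) +
  2 * (X * (m1 * (e2 + X * v1) - m2 * (e1 - X * v2))) +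
  ((1 - k) * ((e1 ^+ 2 - p ^+ 2 * v1 ^+ 2) + (e2 ^+ 2 - p ^+ 2 * v2 ^+ 2)) +
   k * ((e1 - s * p * v2) ^+ 2 + (e2 + s * p * v1) ^+ 2) +
   (p - aX) ^+ 2 * (v1 ^+ 2 + v2 ^+ 2)).
Proof.
move=> sX s1 kp X2.
have kX : k * s * p = X by rewrite -sX kp; ring.
have kss : k * (s * p) ^+ 2 = k * p ^+ 2 by rewrite exprMn s1 mul1r.
have E1 : k * (e1 - s * p * v2) ^+ 2 = k * e1 ^+ 2 - 2 * X * e1 * v2 + k * p ^+ 2 * v2 ^+ 2.
  by rewrite -kss -kX; ring.
have E2 : k * (e2 + s * p * v1) ^+ 2 = k * e2 ^+ 2 + 2 * X * e2 * v1 + k * p ^+ 2 * v1 ^+ 2.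
  by rewrite -kss -kX; ring.
have E3 : (p - aX) ^+ 2 = p ^+ 2 - 2 * (k * p ^+ 2) + X ^+ 2.
  by rewrite X2 sqrrB kp; ring.
rewrite mulrDr mulrDr [k * (_ + _)]mulrDr E1 E2 E3; ring.
Qed.

(** The left hand side is the tangent of [r |-> 1/r] at [d].  Unlike [1/r] it is finite
at a collision, and the right hand side isolates the term in [r^2], which a
quadratic functional can control. *)
Lemma newton_tangent (R : realType) (r d : R) : 0 < d ->
  2 / d - r / d ^+ 2 = 3 / 2 / d - r ^+ 2 / d ^+ 3 / 2 + (r - d) ^+ 2 / d ^+ 3 / 2.
Proof. by move=> d0; field; rewrite gt_eqF. Qed.

(** The horizontal paths [w1 j + i w2 j] are seen in the corotating frame, the [z j] are
the heights, and [m1 j + i m2 j] is the mean position.  The hypothesis [mE]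
holds for means in the mode [l = 1]; [aE] is the equation of the relative
equilibrium of radius [a] and frequency [X]. *)
Section Energy.
Context {R : realType} (N S : nat).
Notation T := (S.+1%:R : R).
Variables (w1 w2 z dw1 dw2 dz : 'Z_N -> R -> R) (m1 m2 : 'Z_N -> R) (X a : R).
Hypothesis N2 : (2 <= N)%N.
Hypothesis w1H : forall j, H1 0 T (w1 j) (dw1 j).
Hypothesis w2H : forall j, H1 0 T (w2 j) (dw2 j).
Hypothesis zH : forall j, H1 0 T (z j) (dz j).
Hypothesis w1T : forall j, w1 j T = w1 j 0.
Hypothesis w2T : forall j, w2 j T = w2 j 0.
Hypothesis zT : forall j, z j T = z j 0.
Hypothesis w1p : forall j t, w1 j (t + 1 / 2) = w1 j t.
Hypothesis w2p : forall j t, w2 j (t + 1 / 2) = w2 j t.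
Hypothesis zp : forall j t, z j (t + 1 / 2) = - z j t.
Hypothesis m1I : forall j, Int 0 T (w1 j) = m1 j * T.
Hypothesis m2I : forall j, Int 0 T (w2 j) = m2 j * T.

Notation rho := (@rhoZ R N).
Notation O1 := (omega2 N 1 : R).
Notation On := (omega2 N N./2 : R).

Hypothesis mE :
  \sum_(i : 'Z_N) \sum_(j : 'Z_N | (i < j)%N) (m1 i - m1 j) ^+ 2 / rho i j ^+ 3 +
  \sum_(i : 'Z_N) \sum_(j : 'Z_N | (i < j)%N) (m2 i - m2 j) ^+ 2 / rho i j ^+ 3 =
  O1 * (\sum_(j : 'Z_N) (m1 j ^+ 2 + m2 j ^+ 2)).
Hypothesis X0 : X != 0.
Hypothesis Xb : X ^+ 2 * On <= (2 * pi) ^+ 2 * O1.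
Hypothesis a0 : 0 < a.
Hypothesis aE : a ^+ 3 * X ^+ 2 = O1.

Let dist i j t : R := Num.sqrt ((w1 i t - w1 j t) ^+ 2 +
  (w2 i t - w2 j t) ^+ 2 + (z i t - z j t) ^+ 2).

Let kin t : R := 2^-1 * \sum_(j : 'Z_N)
  ((dw1 j t - X * w2 j t) ^+ 2 + (dw2 j t + X * w1 j t) ^+ 2 + dz j t ^+ 2).

(** A minorant of the Lagrangian that stays finite at collisions. *)
Let low t : R := kin t + \sum_(i : 'Z_N) \sum_(j : 'Z_N | (i < j)%N)
  (2 / (a * rho i j) - dist i j t / (a * rho i j) ^+ 2).

(** The value of the Lagrangian on the relative equilibrium. *)
Let E0 : R := 2^-1 * N%:R * X ^+ 2 * a ^+ 2 +
  \sum_(i : 'Z_N) \sum_(j : 'Z_N | (i < j)%N) (a * rho i j)^-1.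

Let v1 j t : R := w1 j t - m1 j.
Let v2 j t : R := w2 j t - m2 j.
Let sg : R := Num.sg X.
Let k : R := `|X| / (4 * pi).
Let c : R := X ^+ 2 / O1.

(** The polarization of the quadratic form of [circulant_le]. *)
Let B (m : 'Z_N -> R) (v : 'Z_N -> R -> R) t : R :=
  \sum_(i : 'Z_N) \sum_(j : 'Z_N | (i < j)%N)
     (m i - m j) / rho i j ^+ 3 * (v i t - v j t).

Let lin t : R := \sum_(j : 'Z_N)
    (X * (m1 j * (dw2 j t + X * v1 j t) - m2 j * (dw1 j t - X * v2 j t)))
  - c * (B m1 v1 t + B m2 v2 t).

Let P j t : R := (dw1 j t ^+ 2 - (4 * pi) ^+ 2 * v1 j t ^+ 2) +
  (dw2 j t ^+ 2 - (4 * pi) ^+ 2 * v2 j t ^+ 2).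
Let G j t : R := (dw1 j t - sg * (4 * pi) * v2 j t) ^+ 2 +
  (dw2 j t + sg * (4 * pi) * v1 j t) ^+ 2.
Let V j t : R := v1 j t ^+ 2 + v2 j t ^+ 2.
Let Z j t : R := dz j t ^+ 2 - (2 * pi) ^+ 2 * z j t ^+ 2.

Let pos j t : R :=
  (1 - k) * P j t + k * G j t + ((4 * pi - `|X|) ^+ 2 - (2 * pi) ^+ 2) * V j t + Z j t.

Let gap t : R := \sum_(i : 'Z_N) \sum_(j : 'Z_N | (i < j)%N)
  ((a * rho i j) ^+ 3)^-1 / 2 * (dist i j t - a * rho i j) ^+ 2.

Let T0 : 0 < T. Proof. by rewrite ltr0n. Qed.
Let pi0 : 0 < pi :> R. Proof. exact: pi_gt0. Qed.
Let O10 : 0 < O1. Proof. exact: omega2_1_gt0. Qed.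
Let O1n : O1 <= On. Proof. by apply: omega2_max. Qed.
Let absX : X ^+ 2 = `|X| ^+ 2. Proof. by rewrite real_normK// num_real. Qed.
Let absX0 : 0 < `|X|. Proof. by rewrite normr_gt0. Qed.

(** From [Xb], because the eigenvalue [On] is at least [O1]. *)
Lemma X_le_2pi : `|X| <= 2 * pi.
Proof.
rewrite -ler_sqr ?nnegrE ?mulr_ge0 ?pi_ge0// -absX.
rewrite -(ler_pM2r O10); apply: le_trans Xb.
by rewrite ler_wpM2l ?sqr_ge0.
Qed.

Let sgX : `|X| * sg = X. Proof. by rewrite mulrC -numEsg. Qed.
Let sg1 : sg ^+ 2 = 1. Proof. by rewrite /sg sqr_sg X0. Qed.

(** The sum of [newton_tangent] over the pairs.  The coefficient [1/a^3] equals [c], and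
[sum_inv_rho] with [aE] turns three halves of the potential into [E0]. *)
Lemma potential_split t :
  \sum_(i : 'Z_N) \sum_(j : 'Z_N | (i < j)%N)
     (2 / (a * rho i j) - dist i j t / (a * rho i j) ^+ 2) =
  E0 - c / 2 * \sum_(i : 'Z_N) \sum_(j : 'Z_N | (i < j)%N)
     ((w1 i t - w1 j t) ^+ 2 + (w2 i t - w2 j t) ^+ 2 + (z i t - z j t) ^+ 2)
       / rho i j ^+ 3 + gap t.
Proof.
have S1 : \sum_(i : 'Z_N) \sum_(j : 'Z_N | (i < j)%N) (a * rho i j)^-1 =
    N%:R * O1 / a.
  rewrite -sum_inv_rho// mulr_suml; apply: eq_bigr => i _.
  by rewrite mulr_suml; apply: eq_bigr => j _; rewrite invfM mulrC.
have -> : E0 = 3 / 2 * \sum_(i : 'Z_N) \sum_(j : 'Z_N | (i < j)%N) (a * rho i j)^-1.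
  by rewrite /E0 S1 -aE; field; rewrite gt_eqF.
rewrite /gap !mulr_sumr -sumrB -big_split; apply: eq_bigr => i _ /=.
rewrite !mulr_sumr -sumrB -big_split; apply: eq_bigr => j ij /=.
have r0 : 0 < rho i j by apply: rhoZ_gt0 => //; rewrite neq_ltn ij.
rewrite newton_tangent ?mulr_gt0// /dist sqr_sqrtr ?addr_ge0 ?sqr_ge0//.
set q := Num.sqrt _; set D := (w1 i t - _) ^+ 2 + _ + _; rewrite /c -aE.
by field; rewrite X0 !gt_eqF.
Qed.

Lemma sqr_dist_split t :
  \sum_(i : 'Z_N) \sum_(j : 'Z_N | (i < j)%N)
     ((w1 i t - w1 j t) ^+ 2 + (w2 i t - w2 j t) ^+ 2 + (z i t - z j t) ^+ 2)
       / rho i j ^+ 3 <=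
  O1 * (\sum_(j : 'Z_N) (m1 j ^+ 2 + m2 j ^+ 2)) + 2 * (B m1 v1 t + B m2 v2 t) +
  On * \sum_(j : 'Z_N) (V j t + z j t ^+ 2).
Proof.
have L := @circulant_le R N N2.
have -> : \sum_(j : 'Z_N) (V j t + z j t ^+ 2) =
    \sum_(j : 'Z_N) v1 j t ^+ 2 + \sum_(j : 'Z_N) v2 j t ^+ 2 + \sum_(j : 'Z_N) z j t ^+ 2.
  by rewrite -!big_split.
rewrite 2!mulrDr -mE.
have := L (fun j => z j t); have := L (fun j => v2 j t); have := L (fun j => v1 j t).
set Lv1 := (X in X <= _ -> _); set Lv2 := (X in _ -> X <= _ -> _).
set Lz := (X in _ -> _ -> X <= _ -> _).
set Lm1 := (X in _ -> _ -> _ -> _ <= X + _ + _ + _).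
set Lm2 := (X in _ -> _ -> _ -> _ <= _ + X + _ + _).
suff -> : \sum_(i : 'Z_N) \sum_(j : 'Z_N | (i < j)%N)
     ((w1 i t - w1 j t) ^+ 2 + (w2 i t - w2 j t) ^+ 2 + (z i t - z j t) ^+ 2)
       / rho i j ^+ 3 = Lm1 + Lm2 + 2 * (B m1 v1 t + B m2 v2 t) + (Lv1 + Lv2 + Lz).
  by lra.
rewrite /Lm1 /Lm2 /B /Lv1 /Lv2 /Lz mulrDr !mulr_sumr -!big_split.
apply: eq_bigr => i _ /=.
rewrite !mulr_sumr -!big_split; apply: eq_bigr => j ij /=.
by rewrite /v1 /v2; ring.
Qed.

(** The means contribute nothing: the centrifugal term [X^2] and the attraction [c * O1]
are equal.  On the deviations and on the heights the attraction is at most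
[c * On <= (2 * pi)^2]. *)
Lemma low_ge t : E0 + lin t + 2^-1 * \sum_(j : 'Z_N) pos j t + gap t <= low t.
Proof.
rewrite /low potential_split.
have c0 : 0 < c by rewrite /c divr_gt0// exprn_even_gt0.
have := sqr_dist_split t; rewrite -(ler_pM2l c0).
set Q := \sum_i _; move=> QE.
have kE : kin t = 2^-1 * (X ^+ 2 * \sum_(j : 'Z_N) (m1 j ^+ 2 + m2 j ^+ 2)) +
  \sum_(j : 'Z_N) (X * (m1 j * (dw2 j t + X * v1 j t) - m2 j * (dw1 j t - X * v2 j t))) +
  2^-1 * \sum_(j : 'Z_N) (pos j t + (2 * pi) ^+ 2 * (V j t + z j t ^+ 2)).
  rewrite /kin !mulr_sumr -!big_split; apply: eq_bigr => j _ /=.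
  have -> : w1 j t = m1 j + v1 j t by rewrite /v1; ring.
  have -> : w2 j t = m2 j + v2 j t by rewrite /v2; ring.
  rewrite (@twisted_kinetic R _ _ _ _ _ _ X (4 * pi) k sg `|X|)//; last first.
    by rewrite /k mulfVK// mulf_neq0// gt_eqF.
  by rewrite /pos /P /G /V /Z; field.
rewrite kE /lin.
have cO : c * O1 = X ^+ 2 by rewrite /c mulfVK// gt_eqF.
set M := \sum_(j : 'Z_N) (m1 j ^+ 2 + m2 j ^+ 2) in QE *.
move: QE; rewrite [c * (_ + _)]mulrDr [c * (_ + _)]mulrDr mulrA cO => QE.
have cOn : c * On <= (2 * pi) ^+ 2.
  by rewrite /c mulrAC ler_pdivrMr.
set VZ := \sum_(j : 'Z_N) (V j t + z j t ^+ 2) in QE *.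
have VZ0 : 0 <= VZ.
  by apply: sumr_ge0 => j _; rewrite !addr_ge0 ?sqr_ge0.
have -> : \sum_(j : 'Z_N) (pos j t + (2 * pi) ^+ 2 * (V j t + z j t ^+ 2)) = \sum_(j : 'Z_N) pos j t + (2 * pi) ^+ 2 * VZ.
  by rewrite /VZ mulr_sumr -big_split.
have := ler_wpM2r VZ0 cOn; lra.
Qed.

Let cw1 j : C0 0 T (w1 j). Proof. exact: H1_C0 (ltW T0) (w1H j). Qed.
Let cw2 j : C0 0 T (w2 j). Proof. exact: H1_C0 (ltW T0) (w2H j). Qed.
Let cz j : C0 0 T (z j). Proof. exact: H1_C0 (ltW T0) (zH j). Qed.
Let cv1 j : C0 0 T (v1 j). Proof. by apply: C0B => //; exact: C0_cst. Qed.
Let cv2 j : C0 0 T (v2 j). Proof. by apply: C0B => //; exact: C0_cst. Qed.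
Let d1 j : L2 0 T (dw1 j). Proof. by case: (w1H j). Qed.
Let d2 j : L2 0 T (dw2 j). Proof. by case: (w2H j). Qed.
Let d3 j : L2 0 T (dz j). Proof. by case: (zH j). Qed.

Lemma dist_C0 i j : C0 0 T (dist i j).
Proof.
apply: C0_comp; first exact: sqrt_continuous.
by apply: C0D; [apply: C0D|]; apply: C0X; apply: C0B.
Qed.

Lemma low_L1 : L1 0 T low.
Proof.
apply: L1D.
  apply: L1Z; apply: L1_sum => j.
  apply: L1D; last exact: L2_sq.
  apply: L1D; apply: L2_sq.
    by apply: L2B => //; apply: L2Z; exact: L2_continuous.
  by apply: L2D => //; apply: L2Z; exact: L2_continuous.
apply: L1_continuous; apply: C0_sum => i; apply: C0_sum => j.
apply: C0B; first exact: C0_cst.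
by apply: C0M; [exact: dist_C0|exact: C0_cst].
Qed.

Let v1_null j : null 0 T (v1 j).
Proof.
split; first exact: L1_continuous.
rewrite /v1 IntB; [|exact: L1_continuous|exact: L1_cst].
by rewrite m1I Int_cst ?ltW// subr0 subrr.
Qed.

Let v2_null j : null 0 T (v2 j).
Proof.
split; first exact: L1_continuous.
rewrite /v2 IntB; [|exact: L1_continuous|exact: L1_cst].
by rewrite m2I Int_cst ?ltW// subr0 subrr.
Qed.

Let dw1_null j : null 0 T (dw1 j).
Proof.
split; first exact: L2_L1.
by rewrite (ac_end (ltW T0) (w1H j).1) w1T subrr.
Qed.

Let dw2_null j : null 0 T (dw2 j).
Proof.
split; first exact: L2_L1.
by rewrite (ac_end (ltW T0) (w2H j).1) w2T subrr.
Qed.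

Let B_null m v : (forall j, null 0 T (v j)) -> null 0 T (B m v).
Proof.
move=> vn; apply: null_sum => i; apply: null_sum => j.
by apply: nullZ; exact: nullB.
Qed.

(** The deviations have mean zero, and so do the derivatives of periodic functions. *)
Lemma lin_null : null 0 T lin.
Proof.
apply: nullB; last by apply: nullZ; apply: nullD; exact: B_null.
apply: null_sum => j; apply: nullZ; apply: nullB; apply: nullZ.
  by apply: nullD => //; exact: nullZ.
by apply: nullB => //; exact: nullZ.
Qed.

Let sqv1 j : L1 0 T (fun t => v1 j t ^+ 2).
Proof. by apply: L1_continuous; exact: C0X. Qed.
Let sqv2 j : L1 0 T (fun t => v2 j t ^+ 2).
Proof. by apply: L1_continuous; exact: C0X. Qed.
Let sqz j : L1 0 T (fun t => z j t ^+ 2).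
Proof. by apply: L1_continuous; exact: C0X. Qed.

Let Wirtinger_deviation f df m : H1 0 T f df -> f T = f 0 -> (forall t, f (t + 1 / 2) = f t) ->
  Int 0 T (fun t => f t - m) = 0 ->
  0 <= Int 0 T (fun t => df t ^+ 2 - (4 * pi) ^+ 2 * (f t - m) ^+ 2).
Proof.
move=> fH fT fp fI.
have fH' : H1 0 T (fun t => f t - m) df.
  split; last exact: fH.2.
  have := acD fH.1 (ac_cst 0 T (- m)).
  by apply: ac_eq => // t _; rewrite addr0.
have cf : C0 0 T (fun t => f t - m) by exact: H1_C0 (ltW T0) fH'.
have f2 : L1 0 T (fun t => (f t - m) ^+ 2) by apply: L1_continuous; exact: C0X.
rewrite IntB; [|by apply: L2_sq; exact: fH.2|exact: L1Z].
rewrite IntZ// subr_ge0; apply: Wirtinger_periodic fH' _ _ fI.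
  by rewrite fT.
by move=> t; rewrite fp.
Qed.

Let P_L1 j : L1 0 T (P j).
Proof. by apply: L1D; apply: L1B; do ?apply: L1Z => //; exact: L2_sq. Qed.
Let G_L1 j : L1 0 T (G j).
Proof.
by apply: L1D; apply: L2_sq; [apply: L2B|apply: L2D] => //;
  apply: L2Z; exact: L2_continuous.
Qed.
Let V_L1 j : L1 0 T (V j). Proof. exact: L1D. Qed.
Let Z_L1 j : L1 0 T (Z j).
Proof. by apply: L1B; [exact: L2_sq|exact: L1Z]. Qed.

Let P_ge0 j : 0 <= Int 0 T (P j).
Proof.
rewrite IntD; [|by apply: L1B; do ?apply: L1Z => //; exact: L2_sq..].
apply: addr_ge0; apply: Wirtinger_deviation => //; first by case: (v1_null j).
by case: (v2_null j).
Qed.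
Let G_ge0 j : 0 <= Int 0 T (G j).
Proof. by apply: Int_ge0 => t _; rewrite addr_ge0 ?sqr_ge0. Qed.
Let V_ge0 j : 0 <= Int 0 T (V j).
Proof. by apply: Int_ge0 => t _; rewrite addr_ge0 ?sqr_ge0. Qed.
Let Z_ge0 j : 0 <= Int 0 T (Z j).
Proof.
rewrite /Z IntB; [|exact: L2_sq|exact: L1Z].
by rewrite IntZ// subr_ge0; exact: Wirtinger_antiperiodic.
Qed.

Let pos_L1 j : L1 0 T (pos j).
Proof. by apply: L1D => //; apply: L1D; [apply: L1D|]; exact: L1Z. Qed.

Let Int_pos j : Int 0 T (pos j) = (1 - k) * Int 0 T (P j) + k * Int 0 T (G j) +
  ((4 * pi - `|X|) ^+ 2 - (2 * pi) ^+ 2) * Int 0 T (V j) + Int 0 T (Z j).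
Proof.
rewrite /pos IntD//; last by apply: L1D; [apply: L1D|]; exact: L1Z.
rewrite IntD; [|by apply: L1D; exact: L1Z|exact: L1Z].
by rewrite IntD; [rewrite !IntZ|exact: L1Z|exact: L1Z].
Qed.

Let k_gt0 : 0 < k. Proof. by rewrite /k divr_gt0// mulr_gt0. Qed.
Let k_lt1 : k < 1.
Proof.
rewrite /k ltr_pdivrMr ?mulr_gt0//; have := X_le_2pi; have := pi0; lra.
Qed.
Let coef_ge0 : 0 <= (4 * pi - `|X|) ^+ 2 - (2 * pi) ^+ 2.
Proof.
have := X_le_2pi; have := pi0 => ? ?.
by rewrite subr_ge0 ler_sqr ?nnegrE; lra.
Qed.

Let pos_parts j : [/\ 0 <= (1 - k) * Int 0 T (P j), 0 <= k * Int 0 T (G j),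
  0 <= ((4 * pi - `|X|) ^+ 2 - (2 * pi) ^+ 2) * Int 0 T (V j) & 0 <= Int 0 T (Z j)].
Proof.
split=> //.
- by rewrite mulr_ge0// subr_ge0 ltW.
- by rewrite mulr_ge0// ltW.
- by rewrite mulr_ge0.
Qed.

Let pos_ge0 j : 0 <= Int 0 T (pos j).
Proof.
by rewrite Int_pos; have [p1 p2 p3 p4] := pos_parts j; rewrite !addr_ge0.
Qed.

Let gapterm_L1 (i j : 'Z_N) : L1 0 T (fun t => ((a * rho i j) ^+ 3)^-1 / 2 * (dist i j t - a * rho i j) ^+ 2).
Proof.
apply: L1Z; apply: L1_continuous; apply: C0X; apply: C0B; last exact: C0_cst.
exact: dist_C0.
Qed.

Let gap_L1 : L1 0 T gap.
Proof. by apply: L1_sum => i; exact: L1_sum. Qed.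

Let Int_gap : Int 0 T gap = \sum_(i : 'Z_N) \sum_(j : 'Z_N | (i < j)%N)
  Int 0 T (fun t => ((a * rho i j) ^+ 3)^-1 / 2 * (dist i j t - a * rho i j) ^+ 2).
Proof.
rewrite /gap Int_sum; last by move=> i; exact: L1_sum.
by apply: eq_bigr => i _; rewrite Int_sum.
Qed.

Let gapterm_ge0 (i j : 'Z_N) : (i < j)%N ->
  0 <= Int 0 T (fun t => ((a * rho i j) ^+ 3)^-1 / 2 * (dist i j t - a * rho i j) ^+ 2).
Proof.
move=> ij; apply: Int_ge0 => t _; rewrite mulr_ge0 ?sqr_ge0// divr_ge0// invr_ge0.
by rewrite exprn_ge0// mulr_ge0 ?cmod_ge0// ltW.
Qed.

Let gap_ge0 : 0 <= Int 0 T gap.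
Proof.
by rewrite Int_gap; apply: sumr_ge0 => i _; apply: sumr_ge0 => j; exact: gapterm_ge0.
Qed.

Lemma Int_low_ge : E0 * T + 2^-1 * \sum_(j : 'Z_N) Int 0 T (pos j) + Int 0 T gap <=
  Int 0 T low.
Proof.
have l1 : L1 0 T (fun t => E0 + lin t) by apply: L1D; [exact: L1_cst|exact: lin_null.1].
have l2 : L1 0 T (fun t => 2^-1 * \sum_(j : 'Z_N) pos j t).
  by apply: L1Z; exact: L1_sum.
have := Int_le (L1D (L1D l1 l2) gap_L1) low_L1 (fun t _ => low_ge t).
rewrite IntD//; last exact: L1D.
rewrite IntD// IntD; [|exact: L1_cst|exact: lin_null.1].
rewrite (Int_cst _ (ltW T0)) lin_null.2 addr0 subr0 IntZ; last exact: L1_sum.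
by rewrite Int_sum.
Qed.

(** In [low_ge] the linear part integrates to zero.  The other terms are squares or are
nonnegative after integration by Wirtinger's inequality. *)
Theorem energy_ge : E0 * T <= Int 0 T low.
Proof.
apply: le_trans Int_low_ge; rewrite -addrA lerDl addr_ge0// mulr_ge0 ?invr_ge0//.
by apply: sumr_ge0 => j _; exact: pos_ge0.
Qed.

(** All the nonnegative terms of [Int_low_ge] vanish. *)
Theorem energy_eq : Int 0 T low <= E0 * T ->
  [/\ forall i j t, 0 <= t <= T -> dist i j t = a * rho i j,
      forall j, Int 0 T (fun t => dz j t ^+ 2) = (2 * pi) ^+ 2 * Int 0 T (fun t => z j t ^+ 2),
      forall j, Int 0 T (fun t => (dw1 j t - sg * (4 * pi) * v2 j t) ^+ 2) = 0 /\
                Int 0 T (fun t => (dw2 j t + sg * (4 * pi) * v1 j t) ^+ 2) = 0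
    & `|X| < 2 * pi -> forall j t, 0 <= t <= T -> w1 j t = m1 j /\ w2 j t = m2 j].
Proof.
move=> le0; have := le_trans Int_low_ge le0.
have sp0 : 0 <= \sum_(j : 'Z_N) Int 0 T (pos j).
  by apply: sumr_ge0 => j _; exact: pos_ge0.
move=> tot; have gap0 : Int 0 T gap = 0 by have := gap_ge0; lra.
have pos0 j : Int 0 T (pos j) = 0.
  have s0 : \sum_(j : 'Z_N) Int 0 T (pos j) = 0 by have := gap_ge0; lra.
  by apply: (psumr_eq0P _ s0) => // i _; exact: pos_ge0.
have distE (i j : 'Z_N) t : (i < j)%N -> 0 <= t <= T -> dist i j t = a * rho i j.
  move=> ij tT; move: gap0; rewrite Int_gap.
  have row_ge0 (i' : 'Z_N) : true -> 0 <= \sum_(j : 'Z_N | (i' < j)%N)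
      Int 0 T (fun t => ((a * rho i' j) ^+ 3)^-1 / 2 * (dist i' j t - a * rho i' j) ^+ 2).
    by move=> _; apply: sumr_ge0 => j'; exact: gapterm_ge0.
  move=> /(psumr_eq0P row_ge0)/(_ i isT).
  move=> /(psumr_eq0P (fun j' ij' => gapterm_ge0 ij'))/(_ j ij) H.
  have r0 : 0 < rho i j by apply: rhoZ_gt0 => //; rewrite neq_ltn ij.
  have cd : C0 0 T (fun t => dist i j t - a * rho i j).
    by apply: C0B; [exact: dist_C0|exact: C0_cst].
  have k0 : ((a * rho i j) ^+ 3)^-1 / 2 != 0.
    by rewrite gt_eqF// divr_gt0// invr_gt0 exprn_gt0// mulr_gt0.
  move: H; rewrite IntZ; last by apply: L1_continuous; exact: C0X.
  move/eqP; rewrite mulf_eq0 (negbTE k0)/= => /eqP H.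
  by apply/eqP; rewrite -subr_eq0; apply/eqP; exact: Int_sqr_eq0 T0 cd H t tT.
have parts j : [/\ Int 0 T (G j) = 0,
    ((4 * pi - `|X|) ^+ 2 - (2 * pi) ^+ 2) * Int 0 T (V j) = 0 & Int 0 T (Z j) = 0].
  have := pos0 j; rewrite Int_pos; have [p1 p2 p3 p4] := pos_parts j => E.
  have kG : k * Int 0 T (G j) = 0 by lra.
  split; [|lra|lra].
  by move/eqP: kG; rewrite mulf_eq0 gt_eqF//= => /eqP.
split.
- move=> i j t tT; have [ij|ji|/val_inj ->] := ltngtP i j.
  + exact: distE.
  + rewrite rhoZC -(distE _ _ _ ji tT) /dist; congr Num.sqrt.
    by congr (_ + _ + _); rewrite -sqrrN opprB.
  + by rewrite /dist !subrr rhoZii mulr0 !expr0n/= !addr0 sqrtr0.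
- move=> j; have [_ _] := parts j; rewrite /Z IntB; [|exact: L2_sq|exact: L1Z].
  by rewrite IntZ// => /eqP; rewrite subr_eq0 => /eqP.
- move=> j; have [+ _ _] := parts j; rewrite IntD.
  + set x := Int _ _ _; set y := Int _ _ _.
    have : 0 <= x by apply: Int_ge0 => t _; exact: sqr_ge0.
    have : 0 <= y by apply: Int_ge0 => t _; exact: sqr_ge0.
    by move=> ? ? ?; split; lra.
  + by apply: L2_sq; apply: L2B => //; apply: L2Z; exact: L2_continuous.
  + by apply: L2_sq; apply: L2D => //; apply: L2Z; exact: L2_continuous.
- move=> Xlt j t tT; have [_ + _] := parts j.
  move/eqP; rewrite mulf_eq0 => /orP[/eqP|/eqP].
    by have := pi0; nra.
  rewrite IntD//.
  have p1 : 0 <= Int 0 T (fun t => v1 j t ^+ 2) by apply: Int_ge0 => ? _; exact: sqr_ge0.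
  have p2 : 0 <= Int 0 T (fun t => v2 j t ^+ 2) by apply: Int_ge0 => ? _; exact: sqr_ge0.
  move=> s0; have q1 : Int 0 T (fun t => v1 j t ^+ 2) = 0 by lra.
  have q2 : Int 0 T (fun t => v2 j t ^+ 2) = 0 by lra.
  have := Int_sqr_eq0 T0 (@cv1 j) q1 tT; have := Int_sqr_eq0 T0 (@cv2 j) q2 tT.
  by rewrite /v1 /v2 => /eqP; rewrite subr_eq0 => /eqP -> /eqP; rewrite subr_eq0 => /eqP ->.
Qed.

End Energy.

(** * Corotating coordinates and symmetries *)
Lemma conjcM (R : realType) (a b : R[i]) : ((a * b)^*)%C = (a^*)%C * (b^*)%C.
Proof. by case: a => ? ?; case: b => ? ? /=; congr Complex; ring. Qed.

Section Corot.
Context {R : realType} (N : nat).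
Implicit Types (y : motion R N) (j : 'Z_N) (t nu : R).

(** With [nu = X - varpi], this is the horizontal position in the frame in which the
relative equilibrium of frequency [X] is at rest. *)
Definition corot nu y j t : R[i] := expi (- (nu * t)) * (y t j).1.
Definition corot1 nu y j t : R := complex.Re (corot nu y j t).
Definition corot2 nu y j t : R := complex.Im (corot nu y j t).

Definition re_speed y j t := derive1 (fun u => complex.Re (y u j).1) t.
Definition im_speed y j t := derive1 (fun u => complex.Im (y u j).1) t.
Definition vert_speed y j t := derive1 (fun u => (y u j).2) t.

(** The real and imaginary parts of [expi (- (nu * t)) * (h' - i nu h)], where [h] is
the horizontal position. *)
Definition dcorot1 nu y j t : R :=
  cos (nu * t) * (re_speed y j t + nu * complex.Im (y t j).1) +
  sin (nu * t) * (im_speed y j t - nu * complex.Re (y t j).1).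
Definition dcorot2 nu y j t : R :=
  cos (nu * t) * (im_speed y j t - nu * complex.Re (y t j).1) -
  sin (nu * t) * (re_speed y j t + nu * complex.Im (y t j).1).

Lemma corot1E nu y j t : corot1 nu y j t =
  cos (nu * t) * complex.Re (y t j).1 + sin (nu * t) * complex.Im (y t j).1.
Proof.
by rewrite /corot1 /corot /expi cosN sinN; case: (y t j).1 => u v /=; ring.
Qed.

Lemma corot2E nu y j t : corot2 nu y j t =
  cos (nu * t) * complex.Im (y t j).1 - sin (nu * t) * complex.Re (y t j).1.
Proof.
by rewrite /corot2 /corot /expi cosN sinN; case: (y t j).1 => u v /=; ring.
Qed.

Lemma is_derive_cosl nu t : is_derive t (1:R) (fun u => cos (nu * u)) (- nu * sin (nu * t)).
Proof.
have l : is_derive t (1:R) (fun u => nu * u) nu.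
  by apply: is_derive_eq; rewrite /GRing.scale/= mulr1.
have C := is_derive_cos (nu * t).
have : is_derive t (1:R) (cos \o (fun u => nu * u)) (- sin (nu * t) * nu).
  exact: is_derive1_comp.
by move=> H; apply: is_derive_eq; ring.
Qed.

Lemma is_derive_sinl nu t : is_derive t (1:R) (fun u => sin (nu * u)) (nu * cos (nu * t)).
Proof.
have l : is_derive t (1:R) (fun u => nu * u) nu.
  by apply: is_derive_eq; rewrite /GRing.scale/= mulr1.
have C := is_derive_sin (nu * t).
have : is_derive t (1:R) (sin \o (fun u => nu * u)) (cos (nu * t) * nu).
  exact: is_derive1_comp.
by move=> H; apply: is_derive_eq; ring.
Qed.

Lemma continuous_cosl nu : continuous (fun u : R => cos (nu * u)).
Proof.
move=> x; apply/differentiable_continuous/derivable1_diffP.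
by case: (is_derive_cosl nu x).
Qed.

Lemma continuous_sinl nu : continuous (fun u : R => sin (nu * u)).
Proof.
move=> x; apply/differentiable_continuous/derivable1_diffP.
by case: (is_derive_sinl nu x).
Qed.

Lemma ac_cosl (a b : R) nu : a <= b ->
  ac a b (fun u => cos (nu * u)) (fun u => - nu * sin (nu * u)).
Proof.
move=> ab; apply: ac_C1 => // [t _|]; first exact: is_derive_cosl.
by apply: C0M; [exact: C0_cst|apply: C0_continuous; exact: continuous_sinl].
Qed.

Lemma ac_sinl (a b : R) nu : a <= b ->
  ac a b (fun u => sin (nu * u)) (fun u => nu * cos (nu * u)).
Proof.
move=> ab; apply: ac_C1 => // [t _|]; first exact: is_derive_sinl.
by apply: C0M; [exact: C0_cst|apply: C0_continuous; exact: continuous_cosl].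
Qed.

(** The product rule for [exp (- i nu t) (f + i g)], real part.  The imaginary part is
the case of the pair [(g, - f)]. *)
Lemma H1_rotate (a b : R) nu (f g df dg : R -> R) : a <= b ->
  H1 a b f df -> H1 a b g dg ->
  H1 a b (fun t => cos (nu * t) * f t + sin (nu * t) * g t)
    (fun t => cos (nu * t) * (df t + nu * g t) + sin (nu * t) * (dg t - nu * f t)).
Proof.
move=> ab fH gH; have cf := H1_C0 ab fH; have cg := H1_C0 ab gH; split.
  have := acD (acM (ac_cosl nu ab) fH.1) (acM (ac_sinl nu ab) gH.1).
  by apply: ac_eq => // t _; ring.
apply: L2D; apply: L2_bounded.
- by apply: C0_continuous; exact: continuous_cosl.
- by apply: L2D; [exact: fH.2|apply: L2Z; exact: L2_continuous].
- by apply: C0_continuous; exact: continuous_sinl.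
- by apply: L2B; [exact: gH.2|apply: L2Z; exact: L2_continuous].
Qed.

Lemma kineticE (varpi nu : R) y t : kinetic varpi y t =
  2^-1 * \sum_(j : 'Z_N)
   ((dcorot1 nu y j t - (varpi + nu) * corot2 nu y j t) ^+ 2 +
    (dcorot2 nu y j t + (varpi + nu) * corot1 nu y j t) ^+ 2 + vert_speed y j t ^+ 2).
Proof.
rewrite /kinetic; congr (_ * _); apply: eq_bigr => j _.
rewrite /norm3 sqr_sqrtr ?addr_ge0 ?sqr_ge0// cmod_sqr /= mulr0 addr0.
rewrite -/(vert_speed y j t); congr (_ + _).
rewrite corot1E corot2E /dcorot1 /dcorot2 -/(re_speed y j t) -/(im_speed y j t).
case: (y t j).1 => u v /=; have := cos2Dsin2 (nu * t).
move: (cos _) (sin _) => cc ss; set d1 := re_speed _ _ _; set d2 := im_speed _ _ _ => cs.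
have -> : d1 + (varpi * (0 * u - 1 * v) - 0 * (0 * v + 1 * u)) = d1 - varpi * v by ring.
have -> : d2 + (varpi * (0 * v + 1 * u) + 0 * (0 * u - 1 * v)) = d2 + varpi * u by ring.
rewrite -[LHS]mul1r -cs; ring.
Qed.

Lemma norm3_corot nu y t i j : norm3 (y t i - y t j) =
  Num.sqrt ((corot1 nu y i t - corot1 nu y j t) ^+ 2 +
            (corot2 nu y i t - corot2 nu y j t) ^+ 2 +
            ((y t i).2 - (y t j).2) ^+ 2).
Proof.
rewrite /norm3 cmod_sqr !corot1E !corot2E; congr (Num.sqrt (_ + _)) => /=.
case: (y t i).1 => u v; case: (y t j).1 => u' v' /=.
have := cos2Dsin2 (nu * t); move: (cos _) (sin _) => cc ss cs.
rewrite -[LHS]mul1r -cs; ring.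
Qed.

(** [1/q] lies above its tangent at [d], and the potential of a collision is
infinite. *)
Lemma potential_ge (c : config R N) (d : 'Z_N -> 'Z_N -> R) :
  (forall i j : 'Z_N, (i < j)%N -> 0 < d i j) ->
  ((\sum_(i : 'Z_N) \sum_(j : 'Z_N | (i < j)%N)
     (2 / d i j - norm3 (c i - c j) / d i j ^+ 2))%:E <= potential c)%E.
Proof.
move=> d0; rewrite /potential -sumEFin; apply: lee_sum => i _.
rewrite -sumEFin; apply: lee_sum => j ij.
set q := norm3 _; have q0 : 0 <= q by exact: sqrtr_ge0.
have dij := d0 i j ij.
have [q00|qn0] := eqVneq q 0; first by rewrite q00 inve0 leey.
have qp : 0 < q by rewrite lt_neqAle eq_sym qn0.
rewrite inver (negbTE qn0) lee_fin -subr_ge0.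
have -> : q^-1 - (2 / d i j - q / d i j ^+ 2) = (q - d i j) ^+ 2 / (q * d i j ^+ 2).
  by field; rewrite !gt_eqF.
by rewrite divr_ge0 ?sqr_ge0// mulr_ge0 ?sqr_ge0.
Qed.

Lemma potential_ge0 (c : config R N) : (0 <= potential c)%E.
Proof.
apply: sume_ge0 => i _; apply: sume_ge0 => j _.
by rewrite inve_ge0 lee_fin sqrtr_ge0.
Qed.

Lemma kinetic_ge0 (varpi : R) y t : 0 <= kinetic varpi y t.
Proof.
by rewrite /kinetic mulr_ge0 ?invr_ge0//; apply: sumr_ge0 => j _; exact: sqr_ge0.
Qed.

End Corot.

Section Symmetry.
Context {R : realType} (N : nat) (r eta : int) (S : nat).
Hypothesis N2 : (1 < N)%N.
Hypothesis eta1 : eta = 1 \/ eta = -1.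
Variable y : motion R N.
Hypothesis yL : LambdaG r S.+1 N./2 eta y.
Notation T := (S.+1%:R : R).
Implicit Types (j : 'Z_N) (t : R).
Let nu : R := 2 * pi * (r%:~R / (S.+1 : int)%:~R).
Local Notation W := (corot nu y).
Local Notation vert j t := (y t j).2.

(** The symmetry with [theta = - 1/2], [delta = 0] and [beta = 1]. *)
Lemma corot_half j t : W j (t + 1 / 2) = W j t /\ vert j (t + 1 / 2) = - vert j t.
Proof.
have [_ G] := yL; have [|] := G (- (1 / 2)) 0 true false _ j t.
  by exists (-1); rewrite mul0r mulr0 addr0 /=; field.
rewrite /= !expr0 !mul1r addr0 opprK mul0r subr0 => h z.
split; last by rewrite z expr1 mulN1r opprK.
rewrite /corot h mulrA -expiD; congr (expi _ * _).
by rewrite /nu; field; rewrite nat1r pnatr_eq0.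
Qed.

(** A symmetry with [delta = 1] and [beta = 0].  The factor [exp (2 pi i r theta / s)]
is absorbed by the rotation of the frame. *)
Lemma corot_next (m : int) (theta : R) j t :
  theta = (N./2)%:R * eta%:~R / N%:R + m%:~R ->
  W (j + 1) (t - theta) = zeta R N * W j t /\ vert (j + 1) (t - theta) = vert j t.
Proof.
move=> thetaE; have [_ G] := yL.
have one : ((1%R : 'Z_N) : nat) = 1%N by rewrite /= modn_small.
have [|] := G theta 1 false false _ j t.
  by exists m; rewrite one thetaE /= mul0r add0r mul1r.
rewrite one !expr0 !mul1r /= => h z; split=> //.
rewrite /corot h !mulrA zetaE -!expiD; congr (expi _ * _).
by rewrite /nu; field; rewrite nat1r !pnatr_eq0; lia.
Qed.

(** The symmetry with [theta = 0], [delta = 0] and [xi = -1]. *)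
Lemma corot_refl t : W 0 t = ((W 0 (- t))^*)%C /\ vert 0 t = vert 0 (- t).
Proof.
have [_ G] := yL; have [|] := G 0 0 false true _ 0 t.
  by exists 0; rewrite !mul0r mulr0 !add0r.
rewrite /= !expr1 !expr0 !mulN1r !mul1r subr0 mulr0 mul0r subr0 addr0 oppr0 mulr0.
rewrite expi0 mul1r => h z; split=> //.
by rewrite /corot h conjcM -expiN opprK mulrN.
Qed.

Lemma nuT : nu * T = 2 * pi * r%:~R.
Proof. by rewrite /nu; field; rewrite nat1r pnatr_eq0. Qed.

Lemma corot_period j t : W j (t + T) = W j t /\ vert j (t + T) = vert j t.
Proof.
have [[per _ _] _] := yL; have := per t j; rewrite -pmulrn => p.
split; last by rewrite p.
rewrite /corot p mulrDr nuT (_ : - (_ + _) = - (nu * t) + 2 * pi * (- r)%:~R).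
  by rewrite expi2piD.
by rewrite mulrNz; ring.
Qed.

Lemma y_H1 j : [/\ H1 0 T (fun t => complex.Re (y t j).1) (re_speed y j),
  H1 0 T (fun t => complex.Im (y t j).1) (im_speed y j) &
  H1 0 T (fun t => (y t j).2) (vert_speed y j)].
Proof.
have [[_ _ /(_ j)[a b c]] _] := yL.
have TE : T = (S.+1 : int)%:~R by exact: pmulrn.
split; apply: sobolev_H1P; rewrite TE; [exact: a|exact: b|exact: c].
Qed.

Lemma corot1_H1 j : H1 0 T (corot1 nu y j) (dcorot1 nu y j).
Proof.
have [a b _] := y_H1 j; have [ab c] := H1_rotate nu (ler0n _ _) a b.
by split => //; apply: ac_eq ab => // t _; rewrite corot1E.
Qed.

Lemma corot2_H1 j : H1 0 T (corot2 nu y j) (dcorot2 nu y j).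
Proof.
have [a b _] := y_H1 j.
have a' : H1 0 T (fun t => - complex.Re (y t j).1) (fun t => - re_speed y j t).
  split; last by apply: L2N; exact: a.2.
  have := acZ (-1) a.1; apply: ac_eq => t _; exact: mulN1r.
have [ab c] := H1_rotate nu (ler0n _ _) b a'.
have E : dcorot2 nu y j = fun t => cos (nu * t) * (im_speed y j t + nu * - complex.Re (y t j).1) +
  sin (nu * t) * (- re_speed y j t - nu * complex.Im (y t j).1).
  by apply/funext => t; rewrite /dcorot2; ring.
rewrite E; split => //; apply: ac_eq ab => // t _; rewrite corot2E; ring.
Qed.

Definition mean1 j : R := Int 0 T (corot1 nu y j) / T.
Definition mean2 j : R := Int 0 T (corot2 nu y j) / T.
Definition mean j : R[i] := (mean1 j +i* mean2 j)%C.

Let T0 : T != 0. Proof. by rewrite pnatr_eq0. Qed.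
Let T1 : 1 <= T. Proof. by rewrite ler1n. Qed.

(** [corot_next] translates the time, which does not change the mean over a period; [c]
is a representative of the translation between [0] and [1]. *)
Lemma mean_next j : mean (j + 1) = zeta R N * mean j.
Proof.
have [c [c01 cE]] : exists c : R, 0 <= c <= 1 /\ exists m : int,
    - c = (N./2)%:R * eta%:~R / N%:R + m%:~R.
  have n01 : 0 <= ((N./2)%:R / N%:R : R) <= 1.
    rewrite divr_ge0//= ler_pdivrMr ?ltr0n; last by lia.
    by rewrite mul1r ler_nat; lia.
  case: eta1 => ->.
    exists (1 - (N./2)%:R / N%:R); split; first by move: n01; lra.
    by exists (-1); rewrite mulr1; ring.
  exists ((N./2)%:R / N%:R); split => //.
  by exists 0; rewrite mulrN1z addr0; ring.
have [m mE] := cE.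
have nx t := corot_next j t mE.
have cT : 0 <= c <= T by move: c01 T1; lra.
have per1 t : corot1 nu y (j + 1) (t + T) = corot1 nu y (j + 1) t.
  by rewrite /corot1 (corot_period _ _).1.
have per2 t : corot2 nu y (j + 1) (t + T) = corot2 nu y (j + 1) t.
  by rewrite /corot2 (corot_period _ _).1.
have TT : 0 <= T by rewrite ler0n.
have C1 i : L1 0 T (corot1 nu y i) by apply: L1_continuous; exact: H1_C0 (corot1_H1 i).
have C2 i : L1 0 T (corot2 nu y i) by apply: L1_continuous; exact: H1_C0 (corot2_H1 i).
have I1 : Int 0 T (corot1 nu y (j + 1)) =
   complex.Re (zeta R N) * Int 0 T (corot1 nu y j) - complex.Im (zeta R N) * Int 0 T (corot2 nu y j).
  rewrite -(Int_periodic_shift cT per1 (H1_C0 TT (corot1_H1 _))).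
  rewrite -!IntZ// -IntB; [|exact: L1Z|exact: L1Z].
  apply: Int_eq => t _; rewrite {1}/corot1 -[c]opprK (nx t).1.
  by rewrite /corot1 /corot2; case: (W j t) => ? ?.
have I2 : Int 0 T (corot2 nu y (j + 1)) =
   complex.Re (zeta R N) * Int 0 T (corot2 nu y j) + complex.Im (zeta R N) * Int 0 T (corot1 nu y j).
  rewrite -(Int_periodic_shift cT per2 (H1_C0 TT (corot2_H1 _))).
  rewrite -!IntZ// -IntD; [|exact: L1Z|exact: L1Z].
  apply: Int_eq => t _; rewrite {1}/corot2 -[c]opprK (nx t).1.
  by rewrite /corot1 /corot2; case: (W j t) => ? ?.
by rewrite /mean /mean1 /mean2 I1 I2 /zeta /expi /=; congr Complex; field.
Qed.

Lemma meanE j : mean j = zeta R N ^+ j * mean 0.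
Proof.
rewrite -{1}[j]natr_Zp; elim: (j : nat) => [|n IH]; first by rewrite expr0 mul1r.
by rewrite -[n.+1%:R]natr1 mean_next IH exprS mulrA.
Qed.

(** By [meanE] both sides are the square of [|mean 0|] times the value of the form on
the regular polygon. *)
Lemma mean_mode :
  \sum_(i : 'Z_N) \sum_(j : 'Z_N | (i < j)%N) (mean1 i - mean1 j) ^+ 2 / @rhoZ R N i j ^+ 3 +
  \sum_(i : 'Z_N) \sum_(j : 'Z_N | (i < j)%N) (mean2 i - mean2 j) ^+ 2 / @rhoZ R N i j ^+ 3 =
  omega2 N 1 * (\sum_(j : 'Z_N) (mean1 j ^+ 2 + mean2 j ^+ 2)).
Proof.
have -> : \sum_(j : 'Z_N) (mean1 j ^+ 2 + mean2 j ^+ 2) = N%:R * cmod (mean 0) ^+ 2.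
  under eq_bigr => j _.
    rewrite (_ : _ + _ = cmod (mean j) ^+ 2); last by rewrite cmod_sqr.
    rewrite meanE cmodM cmod_zeta mul1r; over.
  by rewrite sumr_const card_ord [X in _ *+ X]Zp_cast// mulr_natl.
set c0 := cmod (mean 0).
rewrite mulrA [_ * N%:R]mulrC -sum_inv_rho// mulr_suml -big_split; apply: eq_bigr => i _ /=.
rewrite mulr_suml -big_split; apply: eq_bigr => j ij /=.
have r0 : 0 < @rhoZ R N i j by apply: rhoZ_gt0 => //; rewrite neq_ltn ij.
have -> : (mean1 i - mean1 j) ^+ 2 / @rhoZ R N i j ^+ 3 + (mean2 i - mean2 j) ^+ 2 / @rhoZ R N i j ^+ 3 =
  cmod (mean i - mean j) ^+ 2 / @rhoZ R N i j ^+ 3.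
  by rewrite -mulrDl cmod_sqr.
rewrite (meanE i) (meanE j) -mulrBl cmodM -/(@rhoZ R N i j) -/c0; field.
by rewrite gt_eqF.
Qed.

End Symmetry.

(** * The lower bound of the action *)
Section Radius.
Context {R : realType} (N : nat).
Hypothesis N3 : (3 <= N)%N.
Let N2 : (2 <= N)%N. Proof. exact: ltnW. Qed.

Lemma omega1E : omega R N 1 = Num.sqrt (omega2 N 1).
Proof. by have := @omega_omega2 R N 1 1 (or_introl erefl); rewrite mulr1. Qed.

Definition polygon_radius (X : R) : R := (omega R N 1 / `|X|) `^ (2 / 3).

Lemma polygon_radius_gt0 X : X != 0 -> 0 < polygon_radius X.
Proof.
move=> X0; rewrite /polygon_radius powR_gt0// divr_gt0 ?normr_gt0//.
by rewrite omega1E sqrtr_gt0 omega2_1_gt0.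
Qed.

(** Kepler's law for the relative equilibrium. *)
Lemma polygon_radius3 X : X != 0 -> polygon_radius X ^+ 3 * X ^+ 2 = omega2 N 1.
Proof.
move=> X0; have q0 : 0 <= omega R N 1 / `|X| by rewrite divr_ge0// omega1E sqrtr_ge0.
rewrite /polygon_radius -powR_mulrn ?powR_ge0// -powRrM.
rewrite (_ : 2 / 3 * 3 = 2); last by field.
rewrite powR_mulrn// omega1E expr_div_n sqr_sqrtr ?ltW ?omega2_1_gt0//.
by rewrite real_normK ?num_real// mulfVK// expf_neq0.
Qed.

(** The element of index [p = 0] bounds the infimum: [V <= 2 pi omega_1 / omega_(N/2)]. *)
Lemma Vbound_sqr (eta : int) (X : R) : eta = 1 \/ eta = -1 ->
  - Vbound R N eta <= X <= Vbound R N eta ->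
  X ^+ 2 * omega2 N N./2 <= (2 * pi) ^+ 2 * omega2 N 1.
Proof.
move=> eta1 XV.
have O10 : 0 < omega2 N 1 :> R by exact: omega2_1_gt0.
have On0 : 0 < omega2 N N./2 :> R by apply: lt_le_trans O10 _; exact: omega2_max.
have absX : `|X| <= Vbound R N eta by rewrite ler_norml.
have : `|X| <= Num.sqrt (omega2 N 1) / Num.sqrt (omega2 N N./2) * (2 * pi).
  apply: le_trans absX _; rewrite /Vbound; apply: ge_inf.
    exists 0 => v [p _ ->].
    by rewrite mulr_ge0// divr_ge0// sqrtr_ge0.
  exists 0%N.
    by rewrite muln0 addn0 mul1n gtnNdvd//; lia.
  rewrite muln0 addn0 mul1n omega_omega2// omega1E mul1r ger0_norm//.
  by rewrite mulr_ge0// pi_ge0.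
have sn0 : 0 < Num.sqrt (omega2 N N./2) :> R by rewrite sqrtr_gt0.
rewrite mulrAC ler_pdivlMr// => H.
have : (`|X| * Num.sqrt (omega2 N N./2)) ^+ 2 <= (Num.sqrt (omega2 N 1) * (2 * pi)) ^+ 2.
  by rewrite ler_sqr ?nnegrE ?mulr_ge0 ?sqrtr_ge0 ?pi_ge0.
rewrite !exprMn !sqr_sqrtr ?(ltW O10) ?(ltW On0)// real_normK ?num_real//.
by rewrite [omega2 N 1 * _]mulrC.
Qed.

End Radius.

Section ActionBound.
Context {R : realType} (N : nat) (r eta : int) (S : nat) (varpi : R).
Hypothesis N3 : (3 <= N)%N.
Hypothesis eta1 : eta = 1 \/ eta = -1.
Notation T := (S.+1%:R : R).
Let nu : R := 2 * pi * (r%:~R / (S.+1 : int)%:~R).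
Let X : R := varpi + nu.
Hypothesis X0 : X != 0.
Hypothesis Xb : X ^+ 2 * omega2 N N./2 <= (2 * pi) ^+ 2 * omega2 N 1.
Let a := polygon_radius N X.
Let N2 : (2 <= N)%N. Proof. exact: ltnW. Qed.
Let a0 : 0 < a. Proof. exact: polygon_radius_gt0. Qed.
Let aE : a ^+ 3 * X ^+ 2 = omega2 N 1. Proof. exact: polygon_radius3. Qed.

(** The Lagrangian along the relative equilibrium, where it is constant. *)
Definition min_lagrangian : R := 2^-1 * N%:R * X ^+ 2 * a ^+ 2 +
  \sum_(i : 'Z_N) \sum_(j : 'Z_N | (i < j)%N) (a * @rhoZ R N i j)^-1.

Variable y : motion R N.
Hypothesis yL : LambdaG r S.+1 N./2 eta y.

Let low t : R := kinetic varpi y t + \sum_(i : 'Z_N) \sum_(j : 'Z_N | (i < j)%N)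
  (2 / (a * @rhoZ R N i j) - norm3 (y t i - y t j) / (a * @rhoZ R N i j) ^+ 2).

Let lowE : low = fun t => 2^-1 * \sum_(j : 'Z_N)
   ((dcorot1 nu y j t - X * corot2 nu y j t) ^+ 2 +
    (dcorot2 nu y j t + X * corot1 nu y j t) ^+ 2 + vert_speed y j t ^+ 2) +
   \sum_(i : 'Z_N) \sum_(j : 'Z_N | (i < j)%N) (2 / (a * @rhoZ R N i j) -
     Num.sqrt ((corot1 nu y i t - corot1 nu y j t) ^+ 2 +
            (corot2 nu y i t - corot2 nu y j t) ^+ 2 +
            ((y t i).2 - (y t j).2) ^+ 2) / (a * @rhoZ R N i j) ^+ 2).
Proof.
apply/funext => t; rewrite /low (kineticE _ nu); congr (_ + _).
by apply: eq_bigr => i _; apply: eq_bigr => j _; rewrite (norm3_corot nu).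
Qed.

Let w1T j : corot1 nu y j T = corot1 nu y j 0.
Proof. by rewrite /corot1 -(corot_period yL j 0).1 add0r. Qed.
Let w2T j : corot2 nu y j T = corot2 nu y j 0.
Proof. by rewrite /corot2 -(corot_period yL j 0).1 add0r. Qed.
Let zT j : (y T j).2 = (y 0 j).2.
Proof. by rewrite -(corot_period yL j 0).2 add0r. Qed.
Let w1p j t : corot1 nu y j (t + 1 / 2) = corot1 nu y j t.
Proof. by rewrite /corot1 (corot_half yL j t).1. Qed.
Let w2p j t : corot2 nu y j (t + 1 / 2) = corot2 nu y j t.
Proof. by rewrite /corot2 (corot_half yL j t).1. Qed.
Let zp j t : (y (t + 1 / 2) j).2 = - (y t j).2.
Proof. exact: (corot_half yL j t).2. Qed.
Let T0 : T != 0. Proof. by rewrite pnatr_eq0. Qed.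
Let m1I j : Int 0 T (corot1 nu y j) = mean1 r S y j * T.
Proof. by rewrite /mean1 mulfVK. Qed.
Let m2I j : Int 0 T (corot2 nu y j) = mean2 r S y j * T.
Proof. by rewrite /mean2 mulfVK. Qed.

Let zH j : H1 0 T (fun t => (y t j).2) (vert_speed y j).
Proof. by case: (y_H1 yL j). Qed.

Let mode := mean_mode N2 eta1 yL.

Let low_int : L1 0 T low.
Proof.
by rewrite lowE; apply: low_L1 (fun j => corot1_H1 yL j) (fun j => corot2_H1 yL j) zH.
Qed.

Lemma Int_low_action : ((Int 0 T low)%:E <= action_of (S.+1 : int) varpi y)%E.
Proof.
rewrite /Int /action_of -[(S.+1 : int)%:~R]pmulrn; apply: Rintegral_le_integral => //.
- move=> t _; apply: adde_ge0; first by rewrite lee_fin kinetic_ge0.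
  exact: potential_ge0.
- move=> t _; rewrite /low EFinD leeD2l//; apply: potential_ge => i j ij.
  by rewrite mulr_gt0// rhoZ_gt0// neq_ltn ij.
Qed.

Theorem action_ge : ((min_lagrangian * T)%:E <= action_of (S.+1 : int) varpi y)%E.
Proof.
apply: le_trans Int_low_action; rewrite lee_fin lowE.
exact: (energy_ge N2 (corot1_H1 yL) (corot2_H1 yL) zH w1T w2T zT w1p w2p zp
  m1I m2I mode X0 Xb a0 aE).
Qed.

Theorem action_eq : action_of (S.+1 : int) varpi y = (min_lagrangian * T)%:E ->
  [/\ forall i j t, 0 <= t <= T -> norm3 (y t i - y t j) = a * rhoZ i j,
      forall j, Int 0 T (fun t => vert_speed y j t ^+ 2) =
        (2 * pi) ^+ 2 * Int 0 T (fun t => (y t j).2 ^+ 2),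
      forall j,
        Int 0 T (fun t => (dcorot1 nu y j t - Num.sg X * (4 * pi) *
          (corot2 nu y j t - mean2 r S y j)) ^+ 2) = 0 /\
        Int 0 T (fun t => (dcorot2 nu y j t + Num.sg X * (4 * pi) *
          (corot1 nu y j t - mean1 r S y j)) ^+ 2) = 0
    & `|X| < 2 * pi -> forall j t, 0 <= t <= T -> corot nu y j t = mean r S y j].
Proof.
move=> E; have := Int_low_action; rewrite E lee_fin lowE => le0.
have [H1_ H2_ H3_ H4_] := energy_eq N2 (corot1_H1 yL) (corot2_H1 yL) zH w1T w2T zT w1p w2p zp
  m1I m2I mode X0 Xb a0 aE le0.
split.
- by move=> i j t tT; rewrite (norm3_corot nu) H1_.
- exact: H2_.
- exact: H3_.
- move=> Xlt j t tT; have [] := H4_ Xlt j t tT.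
  rewrite /corot1 /corot2 /mean; case: (corot nu y j t) => p q /= -> ->.
  by [].
Qed.

End ActionBound.

(** * The relative equilibrium *)
Section RelEq.
Context {R : realType} (N : nat) (r eta : int) (S : nat) (varpi : R).
Hypothesis N3 : (3 <= N)%N.
Notation T := (S.+1%:R : R).
Let nu : R := 2 * pi * (r%:~R / (S.+1 : int)%:~R).
Let X : R := varpi + nu.
Hypothesis X0 : X != 0.
Let a := polygon_radius N X.
Let N2 : (2 <= N)%N. Proof. exact: ltnW. Qed.
Let a0 : 0 < a. Proof. exact: polygon_radius_gt0. Qed.
Let yb := ybar N r (S.+1 : int) varpi.

Lemma ybarE t (j : 'Z_N) :
  yb t j = (a%:C%C * (expi (nu * t) * zeta R N ^+ j), 0).
Proof.
rewrite /yb /ybar /xbar /rotJ /= -/nu -/X -/(polygon_radius N X) -/a; congr (_, _).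
rewrite mulrA -expiD mulrCA; congr (_ * (expi _ * _)).
by rewrite /X; ring.
Qed.

Lemma ybar1E t (j : 'Z_N) : (yb t j).1 = a%:C%C * (expi (nu * t) * zeta R N ^+ j).
Proof. by rewrite ybarE. Qed.

Lemma ybar2E t (j : 'Z_N) : (yb t j).2 = 0.
Proof. by rewrite ybarE. Qed.

Lemma ybar_trig t (j : 'Z_N) : (yb t j).1 =
  ((a * cos (nu * t) * complex.Re (zeta R N ^+ j) - a * sin (nu * t) * complex.Im (zeta R N ^+ j)) +i*
   (a * sin (nu * t) * complex.Re (zeta R N ^+ j) + a * cos (nu * t) * complex.Im (zeta R N ^+ j)))%C.
Proof.
rewrite ybarE /expi; case: (zeta R N ^+ j) => p q /=.
by congr Complex; ring.
Qed.

Lemma is_derive_trig (A B t : R) : is_derive t (1:R)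
  (fun u => A * cos (nu * u) + B * sin (nu * u))
  (nu * (B * cos (nu * t) - A * sin (nu * t))).
Proof.
have C := is_derive_cosl nu t; have D := is_derive_sinl nu t.
by apply: is_derive_eq; rewrite /GRing.scale/=; ring.
Qed.

Lemma sobolev_trig (A B : R) (f : R -> R) :
  f = (fun u => A * cos (nu * u) + B * sin (nu * u)) ->
  sobolev_H1 T f.
Proof.
move=> ->; apply: (sobolev_C1 _ (is_derive_trig A B)); first by rewrite ler0n.
move=> x; apply: cvgM; first exact: cvg_cst.
apply: cvgB; apply: cvgM; do ?exact: cvg_cst; [exact: continuous_cosl|exact: continuous_sinl].
Qed.

Lemma sum_zeta : \sum_(j : 'Z_N) zeta R N ^+ j = 0.
Proof.
rewrite -[RHS](@sum_zeta_eq0 R N N2 1); last by rewrite oner_neq0.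
by apply: eq_bigr => j _; rewrite /= modn_small// mul1n.
Qed.

(** In the corotating frame body [j] is at rest at [a * zeta ^+ j], a configuration
that the rotation of the labels and the reflection preserve. *)
Lemma ybar_LambdaG (n : nat) : LambdaG r (S.+1 : int) n eta yb.
Proof.
split; first split.
- move=> t j; rewrite !ybarE; congr (_ * (_ * _), _).
  have -> : nu * (t + (S.+1 : int)%:~R) = nu * t + 2 * pi * r%:~R.
    by rewrite /nu; field; rewrite nat1r pnatr_eq0.
  by rewrite expi2piD.
- move=> t; under eq_bigr do rewrite ybarE.
  under [X in _ /\ X = _]eq_bigr do rewrite ybarE.
  by rewrite -!mulr_sumr sum_zeta !mulr0 big1.
- move=> j; rewrite -[(S.+1 : int)%:~R]pmulrn; split.
  + apply: (@sobolev_trig (a * complex.Re (zeta R N ^+ j)) (- (a * complex.Im (zeta R N ^+ j)))).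
    by apply/funext => t; rewrite ybar_trig /=; ring.
  + apply: (@sobolev_trig (a * complex.Im (zeta R N ^+ j)) (a * complex.Re (zeta R N ^+ j))).
    by apply/funext => t; rewrite ybar_trig /=; ring.
  + apply: (@sobolev_trig 0 0).
    by apply/funext => t; rewrite ybarE /=; ring.
- move=> theta delta beta x _ j t; cbv zeta; rewrite !ybar1E !ybar2E.
  split; last by rewrite mulr0.
  set alpha := _ - _.
  have alphaE : 2 * pi * alpha = nu * theta - 2 * pi * (delta : nat)%:R / N%:R.
    by rewrite /alpha /nu; ring.
  have zd : zeta R N ^+ delta * expi (2 * pi * alpha) = expi (nu * theta).
    by rewrite zetaX -expiD alphaE; congr expi; ring.
  case: x.
  + rewrite expr1 !mulN1r zetaZN// (zetaZD N2).
    rewrite !conjcM !conjcK -[(expi (nu * _))^*%C]expiN mulrN opprK.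
    rewrite (_ : (a%:C^*)%C = a%:C%C); last by rewrite /real_complex_def /= oppr0.
    rewrite [RHS](_ : _ = a%:C%C * (expi (nu * (t - theta)) *
      (zeta R N ^+ delta * expi (2 * pi * alpha)) * zeta R N ^+ j)); last by ring.
    by rewrite zd -expiD; congr (_ * (expi _ * _)); ring.
  + rewrite expr0 !mul1r (zetaZD N2).
    rewrite [RHS](_ : _ = a%:C%C * (expi (nu * (t - theta)) *
      (zeta R N ^+ delta * expi (2 * pi * alpha)) * zeta R N ^+ j)); last by ring.
    by rewrite zd -expiD; congr (_ * (expi _ * _)); ring.
Qed.

Lemma norm3_ybar t i j : norm3 (yb t i - yb t j) = a * rhoZ i j.
Proof.
rewrite !ybarE /norm3 /= subrr expr0n addr0 sqrtr_sqr ger0_norm ?cmod_ge0//.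
by rewrite -mulrBr -mulrBr !cmodM cmod_real cmod_expi mul1r ger0_norm// ltW.
Qed.

Lemma kinetic_ybar t : kinetic varpi yb t = 2^-1 * N%:R * X ^+ 2 * a ^+ 2.
Proof.
rewrite (kineticE _ nu) -/X.
have E (j : 'Z_N) : (dcorot1 nu yb j t - X * corot2 nu yb j t) ^+ 2 +
    (dcorot2 nu yb j t + X * corot1 nu yb j t) ^+ 2 + vert_speed yb j t ^+ 2 = X ^+ 2 * a ^+ 2.
  have dv : vert_speed yb j t = 0.
    have -> : vert_speed yb j t = derive1 (cst 0) t.
      by congr (derive1 _ t); apply/funext => u; exact: ybar2E.
    by rewrite derive1_cst.
  have zz := @cmod_zeta R N j; have := cmod_sqr (zeta R N ^+ j).
  set p := complex.Re _; set q := complex.Im _; rewrite zz expr1n => pq.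
  have d1 : re_speed yb j t = - nu * complex.Im (yb t j).1.
    have -> : re_speed yb j t = derive1 (fun u => (a * p) * cos (nu * u) + (- (a * q)) * sin (nu * u)) t.
      congr (derive1 _ t); apply/funext => u; rewrite ybar_trig -/p -/q /=; ring.
    rewrite derive1E; case: (is_derive_trig (a * p) (- (a * q)) t) => _ ->.
    by rewrite ybar_trig -/p -/q /=; ring.
  have d2 : im_speed yb j t = nu * complex.Re (yb t j).1.
    have -> : im_speed yb j t = derive1 (fun u => (a * q) * cos (nu * u) + (a * p) * sin (nu * u)) t.
      congr (derive1 _ t); apply/funext => u; rewrite ybar_trig -/p -/q /=; ring.
    rewrite derive1E; case: (is_derive_trig (a * q) (a * p) t) => _ ->.
    by rewrite ybar_trig -/p -/q /=; ring.
  rewrite dv /dcorot1 /dcorot2 d1 d2 corot1E corot2E ybar_trig -/p -/q /=.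
  have := cos2Dsin2 (nu * t); move: (cos _) (sin _) => cc ss cs.
  transitivity (X ^+ 2 * a ^+ 2 * (cc ^+ 2 + ss ^+ 2) ^+ 2 * (p ^+ 2 + q ^+ 2)); first by ring.
  by rewrite cs -pq; ring.
under eq_bigr do rewrite E.
have -> : \sum_(j : 'Z_N) X ^+ 2 * a ^+ 2 = N%:R * (X ^+ 2 * a ^+ 2).
  by rewrite sumr_const card_ord [Y in _ *+ Y = _]Zp_cast// mulr_natl.
by ring.
Qed.

Lemma action_ybar : action_of (S.+1 : int) varpi yb = (min_lagrangian N r S varpi * T)%:E.
Proof.
rewrite /action_of -[(S.+1 : int)%:~R]pmulrn.
have -> : min_lagrangian N r S varpi * T = Int 0 T (fun=> min_lagrangian N r S varpi).
  by rewrite Int_cst ?subr0// ler0n.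
rewrite /Int /Rintegral fineK; last first.
  by apply: integrable_fin_num => //; exact: L1_cst.
apply: eq_integral => t _; rewrite kinetic_ybar /min_lagrangian -/nu -/X -/a EFinD.
congr (_ + _)%E; rewrite /potential -sumEFin; apply: eq_bigr => i _.
rewrite -sumEFin; apply: eq_bigr => j ij; rewrite norm3_ybar inver.
by rewrite gt_eqF// mulr_gt0// rhoZ_gt0// neq_ltn ij.
Qed.

End RelEq.

(** * Paths with constant mutual distances *)
(** Reduction of a time to [[0, T]] by the integer part of [t / T]. *)
Lemma periodic_cst (R : realType) (A : Type) (T : R) (F : R -> A) (c : A) :
  0 < T -> (forall t, F (t + T) = F t) -> (forall t, 0 <= t <= T -> F t = c) ->
  forall t, F t = c.
Proof.
move=> T0 FT F0 t.
have per (m : int) u : F (u + m%:~R * T) = F u.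
  have pern (n : nat) v : F (v + n%:R * T) = F v.
    elim: n => [|n IH]; first by rewrite mul0r addr0.
    by rewrite -natr1 mulrDl mul1r addrA FT IH.
  case: m => n; first exact: pern.
  rewrite NegzE -[LHS](pern n.+1); congr F.
  by rewrite mulrNz -pmulrn; ring.
rewrite -(per (- Num.floor (t / T))); apply: F0.
have /andP[f1 f2] := floor_itv (t / T).
move: f1 f2; rewrite mulrNz ler_pdivlMr// intrD ltr_pdivrMr// mulrDl mul1r => f1 f2.
by apply/andP; split; lra.
Qed.

Section Equality.
Context {R : realType} (N : nat) (r eta : int) (S : nat) (varpi : R).
Hypothesis N3 : (3 <= N)%N.
Hypothesis eta1 : eta = 1 \/ eta = -1.
Notation T := (S.+1%:R : R).
Let nu : R := 2 * pi * (r%:~R / (S.+1 : int)%:~R).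
Let X : R := varpi + nu.
Hypothesis X0 : X != 0.
Let a := polygon_radius N X.
Let N2 : (2 <= N)%N. Proof. exact: ltnW. Qed.
Let a0 : 0 < a. Proof. exact: polygon_radius_gt0. Qed.
Let yb := ybar N r (S.+1 : int) varpi.
Variable y : motion R N.
Hypothesis yL : LambdaG r S.+1 N./2 eta y.
Hypothesis congruent : forall i j t, 0 <= t <= T ->
  norm3 (y t i - y t j) = a * rhoZ i j.
Let T0 : 0 < T. Proof. by rewrite ltr0n. Qed.

Lemma dist_sqr i j t : 0 <= t <= T ->
  cmod (corot nu y i t - corot nu y j t) ^+ 2 + ((y t i).2 - (y t j).2) ^+ 2 =
  a ^+ 2 * rhoZ i j ^+ 2.
Proof.
move=> tT; rewrite -exprMn -(congruent _ _ tT) (norm3_corot nu).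
rewrite sqr_sqrtr ?addr_ge0 ?sqr_ge0// cmod_sqr /corot1 /corot2.
by case: (corot nu y i t) => ? ?; case: (corot nu y j t).
Qed.

Lemma center_of_mass t : \sum_(j : 'Z_N) corot nu y j t = 0 /\ \sum_(j : 'Z_N) (y t j).2 = 0.
Proof.
have [[_ com _] _] := yL; have [c1 c2] := com t.
by split=> //; rewrite /corot -mulr_sumr c1 mulr0.
Qed.

(** The parallelogram identity for [zeta + 1] and [zeta - 1], as
[zeta^2 - 1 = (zeta - 1)(zeta + 1)]. *)
Lemma rho2_lt : @rho R N 2 ^+ 2 < 4 * @rho R N 1 ^+ 2.
Proof.
have r1 : 0 < @rho R N 1 by apply: rho_gt0; lia.
have -> : @rho R N 2 = @rho R N 1 * cmod (zeta R N + 1).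
  rewrite /rho -cmodM; congr cmod; ring.
rewrite exprMn mulrC ltr_pM2r ?exprn_gt0//.
have key (w : R[i]) : cmod w = 1 -> cmod (w + 1) ^+ 2 + cmod (w - 1) ^+ 2 = 4.
  move=> /(congr1 (fun x => x ^+ 2)); rewrite !cmod_sqr expr1n.
  by case: w => p q /=; rewrite !subr0 !addr0 => pq; nra.
have := key (zeta R N) (cmod_expi _).
have : 0 < cmod (zeta R N - 1) ^+ 2 by rewrite exprn_gt0.
lra.
Qed.

(** The horizontal distances are [|M| rho_ij], so the height differences are proportional
to [rho_ij], up to sign.  Two consecutive differences are then equal in absolute
value, and the height difference of second neighbours is zero or twice as large.
As [rho_2] lies strictly between [0] and [2 rho_1], all the heights agree, and the center
of mass puts them at zero. *)
Lemma steady_eq_ybar (M : R[i]) : (forall j t, corot nu y j t = zeta R N ^+ j * M) ->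
  (forall t j, y t j = yb t j) \/ (forall t j, y t j = - yb t j).
Proof.
move=> WE.
have r1 : 0 < @rho R N 1 by apply: rho_gt0; lia.
have r2 : 0 < @rho R N 2 by apply: rho_gt0; lia.
have one : ((1%R : 'Z_N) : nat) = 1%N by rewrite /= modn_small.
have two : (((1 + 1)%R : 'Z_N) : nat) = 2%N.
  by rewrite /= [(1 %% _)%N]modn_small//= modn_small// Zp_cast.
have rho1 (j : 'Z_N) : @rhoZ R N (j + 1) j = rho R N 1.
  rewrite rhoZE// (_ : j + 1 - j = 1 :> 'Z_N) ?one//.
  by rewrite addrAC subrr add0r.
have rho2 (j : 'Z_N) : @rhoZ R N (j + 1 + 1) j = rho R N 2.
  rewrite rhoZE// (_ : j + 1 + 1 - j = 1 + 1 :> 'Z_N) ?two//.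
  by rewrite -(addrA j) addrAC subrr add0r.
have Wd i j t : cmod (corot nu y i t - corot nu y j t) = rhoZ i j * cmod M.
  by rewrite !WE -mulrBl cmodM.
pose k := a ^+ 2 - cmod M ^+ 2.
have zd i j t : 0 <= t <= T -> ((y t i).2 - (y t j).2) ^+ 2 = k * rhoZ i j ^+ 2.
  by move=> tT; have := dist_sqr i j tT; rewrite Wd exprMn /k; lra.
have k0 : k = 0.
  have tT : 0 <= (0 : R) <= T by rewrite lexx ltW.
  have := zd (0 + 1) 0 _ tT; have := zd (0 + 1 + 1) (0 + 1) _ tT; have := zd (0 + 1 + 1) 0 _ tT.
  rewrite !rho1 rho2.
  set z0 := (y 0 0).2; set z1 := (y 0 (0 + 1)).2; set z2 := (y 0 (0 + 1 + 1)).2.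
  have := rho2_lt; have : 0 < rho R N 2 ^+ 2 by rewrite exprn_gt0.
  set A := rho R N 1 ^+ 2; set B := rho R N 2 ^+ 2 => B0 BA e20 e21 e10.
  have : (z2 - z1 - (z1 - z0)) * (z2 - z1 + (z1 - z0)) = 0.
    by rewrite -subr_sqr e21 e10 subrr.
  move/eqP; rewrite mulf_eq0 => /orP[/eqP q|/eqP q].
    (* Equally spaced heights. *)
    have : k * (B - 4 * A) = 0.
      rewrite mulrBr -e20 mulrCA -e10.
      have -> : z2 = z1 + (z1 - z0) by lra.
      by ring.
    by move/eqP; rewrite mulf_eq0 => /orP[/eqP//|/eqP]; lra.
  have : k * B = 0 by rewrite -e20 (_ : z2 - z0 = 0) ?expr0n//; lra.
  by move/eqP; rewrite mulf_eq0 => /orP[/eqP//|/eqP]; lra.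
have zE t j : 0 <= t <= T -> (y t j).2 = 0.
  move=> tT; have eqz i : (y t i).2 = (y t j).2.
    apply/eqP; rewrite -subr_eq0 -sqrf_eq0; apply/eqP.
    by rewrite zd// k0 mul0r.
  have := (center_of_mass t).2; under eq_bigr do rewrite eqz.
  rewrite sumr_const => /eqP; rewrite mulrn_eq0 card_ord /= => /eqP//.
have zE' t j : (y t j).2 = 0.
  apply: (periodic_cst (F := fun t => (y t j).2) T0) => // u.
    exact: (corot_period yL j u).2.
  exact: zE.
have [m ME] : exists m : R, M = (m%:C)%C.
  have := (corot_refl yL 0).1; rewrite -/nu oppr0 WE expr0 mul1r.
  case: M {WE Wd k zd k0} => p q /= [/eqP]; rewrite -addr_eq0 => /eqP q0.
  by exists p; have -> : q = 0 by lra.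
have m2 : m ^+ 2 = a ^+ 2.
  by move: k0; rewrite /k ME cmod_real real_normK ?num_real//; lra.
have yE t j : y t j = ((m%:C)%C * (expi (nu * t) * zeta R N ^+ j), 0).
  rewrite [LHS]surjective_pairing zE'; congr (_, _).
  have := WE j t; rewrite /corot ME => /(congr1 (fun w => expi (nu * t) * w)).
  by rewrite mulrA expiNK mul1r => ->; ring.
move/eqP: m2; rewrite eqf_sqr => /orP[/eqP ma|/eqP ma]; [left|right] => t j.
  by rewrite yE /yb ybarE ma.
rewrite yE /yb ybarE ma; congr (_, _); last by rewrite oppr0.
by rewrite rmorphN mulNr.
Qed.

End Equality.

(** * Equality cases of the integral inequalities *)
Section Rot.
Context {R : realType}.

(** The vectors [(f, g)] and [(c f + s g, s f - c g)] have the same norm. *)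
Lemma Int_sqr_rot_eq0 (a b p : R) (f g : R -> R) : L2 a b f -> L2 a b g ->
  Int a b (fun t => f t ^+ 2) = 0 -> Int a b (fun t => g t ^+ 2) = 0 ->
  Int a b (fun t => (cos (p * t) * f t + sin (p * t) * g t) ^+ 2) = 0.
Proof.
move=> f2 g2 f0 g0.
have c0 : C0 a b (fun t => cos (p * t)) by apply: C0_continuous; exact: continuous_cosl.
have s0 : C0 a b (fun t => sin (p * t)) by apply: C0_continuous; exact: continuous_sinl.
apply/eqP; rewrite eq_le; apply/andP; split; last first.
  by apply: Int_ge0 => t _; exact: sqr_ge0.
have -> : 0 = Int a b (fun t => f t ^+ 2 + g t ^+ 2).
  by rewrite IntD ?f0 ?g0 ?addr0//; exact: L2_sq.
apply: Int_le => [||t _].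
- by apply: L2_sq; apply: L2D; exact: L2_bounded.
- by apply: L1D; exact: L2_sq.
have := cos2Dsin2 (p * t); move: (cos _) (sin _) => c s cs.
have -> : f t ^+ 2 + g t ^+ 2 = (c * f t + s * g t) ^+ 2 + (s * f t - c * g t) ^+ 2.
  by rewrite -[LHS]mul1r -cs; ring.
by rewrite lerDl sqr_ge0.
Qed.

(** The integrals say that [v' = - i p v], for [v = v1 + i v2], so the density of
[exp (i p t) v] has a vanishing square integral. *)
Lemma twisting_solution (b p : R) (v1 v2 d1 d2 : R -> R) : 0 <= b ->
  H1 0 b v1 d1 -> H1 0 b v2 d2 ->
  Int 0 b (fun t => (d1 t - p * v2 t) ^+ 2) = 0 ->
  Int 0 b (fun t => (d2 t + p * v1 t) ^+ 2) = 0 ->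
  forall t, 0 <= t <= b ->
  (v1 t +i* v2 t)%C = expi (- (p * t)) * (v1 0 +i* v2 0)%C.
Proof.
move=> b0 h1 h2 q1 q2 t tb.
have c1 := H1_C0 b0 h1; have c2 := H1_C0 b0 h2.
have h2N : H1 0 b (fun t => - v2 t) (fun t => - d2 t).
  split; last by apply: L2N; exact: h2.2.
  by have := acZ (-1) h2.1; apply: ac_eq => u _; exact: mulN1r.
have l1 : L2 0 b (fun t => d1 t - p * v2 t).
  by apply: L2B; [exact: h1.2|apply: L2Z; exact: L2_continuous].
have l2 : L2 0 b (fun t => d2 t + p * v1 t).
  by apply: L2D; [exact: h2.2|apply: L2Z; exact: L2_continuous].
have l2N : L2 0 b (fun t => - (d2 t + p * v1 t)) by exact: L2N.
have q2N : Int 0 b (fun t => (- (d2 t + p * v1 t)) ^+ 2) = 0.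
  by rewrite -[RHS]q2; apply: Int_eq => u _; rewrite sqrrN.
have e1 : cos (p * t) * v1 t + sin (p * t) * - v2 t = v1 0.
  have := Int_dsqr_eq0 (H1_rotate p b0 h1 h2N) _ tb.
  rewrite mulr0 cos0 sin0 mul1r mul0r addr0; apply.
  rewrite -[RHS](Int_sqr_rot_eq0 p l1 l2N q1 q2N).
  by apply: Int_eq => u _; congr (_ ^+ 2); ring.
have e2 : cos (p * t) * v2 t + sin (p * t) * v1 t = v2 0.
  have := Int_dsqr_eq0 (H1_rotate p b0 h2 h1) _ tb.
  rewrite mulr0 cos0 sin0 mul1r mul0r addr0; apply.
  by rewrite -[RHS](Int_sqr_rot_eq0 p l2 l1 q2 q1).
rewrite -e1 -e2 /expi cosN sinN /=; have := cos2Dsin2 (p * t).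
move: (cos _) (sin _) => c s cs.
congr Complex.
  by rewrite -[LHS]mul1r -cs; ring.
by rewrite -[LHS]mul1r -cs; ring.
Qed.

(** Subtract [f 0 * cos (2 pi t)].  The difference [g] is still extremal, as the cross
terms integrate to zero by parts.  But [g] vanishes at all multiples of [1/4]: at
[1/4] by symmetry and at [0] by construction.  For such functions the constant of
Wirtinger's inequality is [(4 pi)^2], so [g] vanishes identically. *)
Lemma antiperiodic_extremal (S : nat) (f df : R -> R) : H1 0 S.+1%:R f df ->
  f S.+1%:R = f 0 -> (forall t, f (t + 1 / 2) = - f t) -> f (- (1 / 4)) = f (1 / 4) ->
  Int 0 S.+1%:R (fun t => df t ^+ 2) =
    (2 * pi) ^+ 2 * Int 0 S.+1%:R (fun t => f t ^+ 2) ->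
  forall t, 0 <= t <= S.+1%:R -> f t = f 0 * cos (2 * pi * t).
Proof.
move=> fH fS fa fe fI t tS.
pose b := f 0; have S0 : 0 < S.+1%:R :> R by rewrite ltr0n.
have f14 : f (1 / 4) = 0.
  have := fa (- (1 / 4)); rewrite fe (_ : - (1 / 4) + 1 / 2 = 1 / 4); last by field.
  lra.
pose g t := f t - b * cos (2 * pi * t).
pose dg t := df t - b * (- (2 * pi) * sin (2 * pi * t)).
have gH : H1 0 S.+1%:R g dg.
  split.
    have := acD fH.1 (acZ (- b) (ac_cosl (2 * pi) (ltW S0))).
    by apply: ac_eq => u _; rewrite /g /dg; ring.
  apply: L2B; first exact: fH.2.
  apply: L2_continuous; apply: C0M; first exact: C0_cst.
  by apply: C0M; [exact: C0_cst|apply: C0_continuous; exact: continuous_sinl].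
have cosper u : cos (2 * pi * (u + 1 / 2)) = - cos (2 * pi * u) :> R.
  by rewrite (_ : _ * (_ + _) = 2 * pi * u + pi) ?cosDpi//; field.
have sinS : sin (2 * pi * S.+1%:R) = 0 :> R.
  have := congr1 (@complex.Im R) (@expi2pi R (S.+1 : int)).
  by rewrite -pmulrn.
have cosS : cos (2 * pi * S.+1%:R) = 1 :> R.
  have := congr1 (@complex.Re R) (@expi2pi R (S.+1 : int)).
  by rewrite -pmulrn.
have g0 : g 0 = 0 by rewrite /g /b mulr0 cos0; ring.
have gS : g S.+1%:R = g 0 by rewrite g0 /g cosS fS /b; ring.
have g14 : g (0 + 1 / 4) = 0.
  rewrite /g add0r f14 (_ : 2 * pi * (1 / 4) = pi / 2) ?cos_pihalf; [ring|by field].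
have gz u : g u = 0 -> g (u + 1 / 2) = 0 by rewrite /g fa cosper; lra.
have quarter : 0 <= (0 : R) <= 1 / 4 by apply/andP; split; lra.
have W := Wirtinger_zeros_quarter gH gS quarter g0 g14 gz.
have cf := H1_C0 (ltW S0) fH.
have cg := H1_C0 (ltW S0) gH.
have ccos : C0 0 S.+1%:R (fun t : R => cos (2 * pi * t)).
  by apply: C0_continuous; exact: continuous_cosl.
have csin : C0 0 S.+1%:R (fun t : R => sin (2 * pi * t)).
  by apply: C0_continuous; exact: continuous_sinl.
(* [dg^2 - (2 pi)^2 g^2] and the same expression for [f] differ by the density of
   this function times [2 pi b], and the function vanishes at both ends. *)
have cross : ac 0 S.+1%:R (fun t => (2 * f t - b * cos (2 * pi * t)) * sin (2 * pi * t))
   (fun t => (2 * df t + b * (2 * pi * sin (2 * pi * t))) * sin (2 * pi * t) +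
     (2 * f t - b * cos (2 * pi * t)) * (2 * pi * cos (2 * pi * t))).
  have A := acD (acZ 2 fH.1) (acZ (- b) (ac_cosl (2 * pi) (ltW S0))).
  have := acM A (ac_sinl (2 * pi) (ltW S0)).
  by apply: ac_eq => u _; ring.
have cross0 := ac_end (ltW S0) cross.
rewrite sinS [2 * pi * 0]mulr0 sin0 !mulr0 subrr in cross0.
have key : Int 0 S.+1%:R (fun t => dg t ^+ 2) =
    (2 * pi) ^+ 2 * Int 0 S.+1%:R (fun t => g t ^+ 2).
  have s1 : L1 0 S.+1%:R (fun t => f t ^+ 2) by apply: L1_continuous; exact: C0X.
  have s2 : L1 0 S.+1%:R (fun t => g t ^+ 2) by apply: L1_continuous; exact: C0X.
  have s3 : L1 0 S.+1%:R (fun t => df t ^+ 2) by apply: L2_sq; exact: fH.2.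
  have s4 : L1 0 S.+1%:R (fun t => dg t ^+ 2) by apply: L2_sq; exact: gH.2.
  apply/eqP; rewrite -subr_eq0 -IntZ// -IntB//; last exact: L1Z.
  rewrite (_ : Int _ _ _ = Int 0 S.+1%:R (fun t => (df t ^+ 2 - (2 * pi) ^+ 2 * f t ^+ 2) +
    (2 * pi * b) * ((2 * df t + b * (2 * pi * sin (2 * pi * t))) * sin (2 * pi * t) +
     (2 * f t - b * cos (2 * pi * t)) * (2 * pi * cos (2 * pi * t))))); last first.
    by apply: Int_eq => u _; rewrite /g /dg; ring.
  rewrite IntD; [|by apply: L1B => //; exact: L1Z|by apply: L1Z; exact: cross.1].
  rewrite IntZ; last exact: cross.1.
  rewrite cross0 mulr0 addr0 IntB//; last exact: L1Z.
  by rewrite IntZ// fI subrr.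
have I0 : Int 0 S.+1%:R (fun t => g t ^+ 2) = 0.
  have i0 : 0 <= Int 0 S.+1%:R (fun t => g t ^+ 2) by apply: Int_ge0 => u _; exact: sqr_ge0.
  move: W; rewrite key; move: (Int _ _ (fun t => g t ^+ 2)) i0 => I i0 W.
  have p2 : 0 < (pi : R) ^+ 2 by rewrite exprn_gt0// pi_gt0.
  have : (pi : R) ^+ 2 * I <= 0 by lra.
  by rewrite pmulr_rle0// => ?; apply/eqP; rewrite eq_le i0 andbT.
by have /eqP := Int_sqr_eq0 S0 cg I0 tS; rewrite /g subr_eq0 => /eqP.
Qed.

End Rot.

(** * The triangle at the critical frequency *)
(** Three bodies at the frequency [X = e * 2 pi], where the constants [4 pi - |X|] and
[2 pi] coincide and the deviation from the mean may survive. *)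
Section Triangle.
Context {R : realType} (r eta e : int) (S : nat) (varpi : R).
Hypothesis eta1 : eta = 1 \/ eta = -1.
Hypothesis e1 : e = 1 \/ e = -1.
Notation T := (S.+1%:R : R).
Let nu : R := 2 * pi * (r%:~R / (S.+1 : int)%:~R).
Let X : R := varpi + nu.
Hypothesis XE : X = e%:~R * (2 * pi).
Let a := polygon_radius 3 X.
Variable y : motion R 3.
Hypothesis yL : LambdaG r S.+1 3./2 eta y.
Hypothesis congruent : forall i j t, 0 <= t <= T ->
  norm3 (y t i - y t j) = a * rhoZ i j.
Hypothesis twist : forall j,
  Int 0 T (fun t => (dcorot1 nu y j t - Num.sg X * (4 * pi) *
          (corot2 nu y j t - mean2 r S y j)) ^+ 2) = 0 /\
  Int 0 T (fun t => (dcorot2 nu y j t + Num.sg X * (4 * pi) *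
          (corot1 nu y j t - mean1 r S y j)) ^+ 2) = 0.
Hypothesis vertical : forall j, Int 0 T (fun t => vert_speed y j t ^+ 2) =
        (2 * pi) ^+ 2 * Int 0 T (fun t => (y t j).2 ^+ 2).
Let T0 : 0 < T. Proof. by rewrite ltr0n. Qed.
Let pi0 : 0 < pi :> R. Proof. exact: pi_gt0. Qed.
Let N2 : (1 < 3)%N. Proof. by []. Qed.
Local Notation W := (corot nu y).
Local Notation M j := (mean r S y j).

Let e1r : (e%:~R : R) = 1 \/ (e%:~R : R) = -1.
Proof. by case: e1 => ->; [left|right]. Qed.

Let X0 : X != 0.
Proof.
by rewrite XE mulf_neq0//; [case: e1r => ->; rewrite ?oppr_eq0 oner_neq0|rewrite gt_eqF ?mulr_gt0].
Qed.

Let sgX : Num.sg X * (4 * pi) = 2 * X.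
Proof.
rewrite XE sgrM (@gtr0_sg _ (2 * pi)) ?mulr_gt0// mulr1.
by case: e1r => ->; rewrite ?sgrN sgr1; ring.
Qed.

Let a0 : 0 < a. Proof. exact: polygon_radius_gt0. Qed.

Let twist_amp (j : 'Z_3) : R[i] := W j 0 - M j.

(** [twisting_solution] with [p = 2 X]. *)
Lemma corot_twist j t : W j t = M j + expi (- (2 * X * t)) * twist_amp j.
Proof.
have meanT t' : W j t' - M j =
    ((corot1 nu y j t' - mean1 r S y j) +i* (corot2 nu y j t' - mean2 r S y j))%C.
  by rewrite /corot1 /corot2 /mean; case: (W j t').
have cst_H1 (f df : R -> R) (c : R) : H1 0 T f df -> H1 0 T (fun u => f u - c) df.
  move=> fH; split; last exact: fH.2.
  by have := acD fH.1 (ac_cst 0 T (- c)); apply: ac_eq => // u _; rewrite addr0.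
suff : expi (2 * X * t) * (W j t - M j) = twist_amp j.
  move=> <-; rewrite mulrA [expi (- _) * _]mulrC expiNK mul1r; ring.
apply: (periodic_cst (F := fun t => expi (2 * X * t) * (W j t - M j)) T0) => u.
  rewrite (corot_period yL j u).1; congr (_ * _).
  rewrite mulrDr (_ : 2 * X * T = 2 * pi * ((2 * S.+1)%N%:Z * e)%:~R) ?expi2piD//.
  by rewrite XE intrM -pmulrn natrM; ring.
move=> uT; have [q1 q2] := twist j; rewrite sgX in q1 q2.
have := twisting_solution (ltW T0) (cst_H1 _ _ (mean1 r S y j) (corot1_H1 yL j))
  (cst_H1 _ _ (mean2 r S y j) (corot2_H1 yL j)) q1 q2 uT.
rewrite -!meanT => ->.
by rewrite mulrA expiNK mul1r.
Qed.

Let third : R := 2 * pi / 3.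
Let zetaE3 : zeta R 3 = expi third. Proof. by []. Qed.

(** [corot_next] at time [0], after subtraction of the means. *)
Lemma twist_amp_next j : expi (2 * X * (eta%:~R / 3)) * twist_amp (j + 1) =
  zeta R 3 * twist_amp j.
Proof.
have thE : eta%:~R / 3 = (3./2)%:R * eta%:~R / 3%:R + (0 : int)%:~R :> R.
  by rewrite mul1r addr0.
have := (corot_next N2 eta1 yL j 0 thE).1; rewrite -/nu corot_twist (mean_next N2 eta1 yL).
rewrite [W j 0]corot_twist [zeta R 3 * (_ + _)]mulrDr => /addrI.
rewrite sub0r mulrN opprK => ->.
by rewrite mulr0 oppr0 expi0 mul1r.
Qed.

Let ind3 (F : 'Z_3 -> R[i]) (c : R[i]) : (forall j, F (j + 1) = c * F j) ->
  forall j : 'Z_3, F j = c ^+ j * F 0.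
Proof.
move=> FS j; rewrite -{1}[j]natr_Zp; elim: (j : nat) => [|n IH].
  by rewrite expr0 mul1r.
by rewrite -[n.+1%:R]natr1 FS IH exprS mulrA.
Qed.

(** Here [twist_amp_next] makes the amplitude independent of the body.  The mean
positions have their center of mass at the origin, so the common amplitude is
zero. *)
Lemma untwisted_steady : e = - eta -> forall j t, W j t = zeta R 3 ^+ j * M 0.
Proof.
move=> eE.
have U1 j : twist_amp (j + 1) = 1 * twist_amp j.
  have := twist_amp_next j.
  have -> : 2 * X * (eta%:~R / 3) = - (2 * third).
    by rewrite XE eE mulrNz /third; case: eta1 => ->; rewrite ?mulrN1z; field.
  move=> /(congr1 (fun w => expi (2 * third) * w)).
  rewrite mulrA expiNK mul1r zetaE3 mulrA -expiD => ->.
  by rewrite (_ : 2 * third + third = 2 * pi * 1%:~R) ?expi2pi// /third; field.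
have U0 j : twist_amp j = twist_amp 0 by rewrite (ind3 U1 j) expr1n mul1r.
have Uz : twist_amp 0 = 0.
  have := (center_of_mass yL 0).1; rewrite -/nu.
  have -> : \sum_(j : 'Z_3) W j 0 = \sum_(j : 'Z_3) (zeta R 3 ^+ j * M 0 + twist_amp 0).
    by apply: eq_bigr => j _; rewrite corot_twist mulr0 oppr0 expi0 mul1r U0 -(meanE N2 eta1 yL).
  rewrite big_split/= -mulr_suml (sum_zeta (R := R) (N := 3))// mul0r add0r sumr_const card_ord.
  by move/eqP; rewrite mulrn_eq0 /= => /eqP.
by move=> j t; rewrite corot_twist U0 Uz mulr0 addr0 (meanE N2 eta1 yL).
Qed.

Let phase (j : 'Z_3) (t : R) : R := X * t + j%:R * third.

(** For [e = eta] the amplitudes rotate with the labels in the direction opposite to the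
means. *)
Lemma twisted_amp : e = eta -> forall j, twist_amp j = expi (- (j%:R * third)) * twist_amp 0.
Proof.
move=> eE; have U1 j : twist_amp (j + 1) = expi (- third) * twist_amp j.
  have := twist_amp_next j.
  have -> : 2 * X * (eta%:~R / 3) = 2 * third.
    by rewrite XE eE /third; case: eta1 => ->; rewrite ?mulrN1z; field.
  move=> /(congr1 (fun w => expi (- (2 * third)) * w)).
  rewrite mulrA -expiD addNr expi0 mul1r zetaE3 mulrA -expiD => ->.
  by congr (expi _ * _); ring.
by move=> j; rewrite (ind3 U1 j) expiX mulrN.
Qed.

(** The reflection symmetry at the times [0] and [1/8], where [exp (2 i X t)] is [1] and
[e * i]. *)
Lemma real_amplitudes : e = eta -> exists m u : R,
  M 0 = (m%:C)%C /\ twist_amp 0 = (u%:C)%C.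
Proof.
move=> eE; have WE t : W 0 t = M 0 + expi (- (2 * X * t)) * twist_amp 0 by exact: corot_twist.
have := (corot_refl yL 0).1; have := (corot_refl yL (1 / 8)).1.
rewrite -/nu oppr0 !WE.
have -> : 2 * X * (1 / 8) = e%:~R * (pi / 2) by rewrite XE; field.
have -> : 2 * X * - (1 / 8) = - (e%:~R * (pi / 2)) by rewrite XE; field.
rewrite mulr0 oppr0 expi0 mul1r opprK.
have -> : expi (- (e%:~R * (pi / 2))) = (0 +i* - e%:~R)%C :> R[i].
  by case: e1r => ->; rewrite ?mulN1r ?mul1r /expi ?opprK ?cosN ?sinN cos_pihalf sin_pihalf ?opprK.
have -> : expi (e%:~R * (pi / 2)) = (0 +i* e%:~R)%C :> R[i].
  by case: e1r => ->; rewrite ?mulN1r ?mul1r /expi ?cosN ?sinN cos_pihalf sin_pihalf.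
case: (M 0) => p q; case: (twist_amp 0) => u v /= [E1 _] [E2].
have v0 : v = 0 by case: e1r => E; rewrite E in E1; lra.
have q0 : q = 0 by lra.
by exists p, u; rewrite v0 q0.
Qed.

(** The height of body [0] is even and extremal, hence a multiple of [cos (2 pi t)]; the
other heights are its translates. *)
Lemma vertical_mode : e = eta -> forall j t, (y t j).2 = (y 0 0).2 * cos (phase j t).
Proof.
move=> eE; set b := (y 0 0).2.
have z0 t : (y t 0).2 = b * cos (2 * pi * t).
  apply/eqP; rewrite -subr_eq0; apply/eqP.
  apply: (periodic_cst (F := fun t => (y t 0).2 - b * cos (2 * pi * t)) T0) => u.
    rewrite (corot_period yL 0 u).2 (_ : 2 * pi * (u + T) = 2 * pi * u + pi *+ 2 *+ S.+1).
      by rewrite (periodicn (@cosD2pi R)).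
    by rewrite -[_ *+ S.+1]mulr_natr -[pi *+ 2]mulr_natr; ring.
  move=> uT; have [_ _ zH] := y_H1 yL 0.
  rewrite (antiperiodic_extremal zH) ?subrr//.
  - by have := (corot_period yL 0 0).2; rewrite add0r.
  - by move=> t'; exact: (corot_half yL 0 t').2.
  - by rewrite -(corot_refl yL (1 / 4)).2.
have thE : eta%:~R / 3 = (3./2)%:R * eta%:~R / 3%:R + (0 : int)%:~R :> R.
  by rewrite mul1r addr0.
have zn (n : nat) t : (y t n%:R).2 = (y (t + n%:R * (eta%:~R / 3)) 0).2.
  elim: n t => [|n IH] t; first by rewrite mul0r addr0.
  have := (corot_next N2 eta1 yL n%:R (t + eta%:~R / 3) thE).2.
  rewrite addrK natr1 => ->; rewrite IH; congr (y _ _).2.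
  by rewrite -[n.+1%:R]natr1; ring.
move=> j t; rewrite -{1}[j]natr_Zp zn z0; congr (_ * _).
rewrite /phase XE eE /third; case: eta1 => ->; first by congr cos; ring.
by rewrite -cosN; congr cos; rewrite mulrN1z; ring.
Qed.

(** With [tau = exp (i phase)], the positions are [(m + u) Re tau + i (m - u) Im tau]
in the plane and [b Re tau] in height: a linear image of the triangle.  The mutual
distances at time [0] show that the linear map is an isometry of the plane
into space, which [g] extends to space. *)
Lemma extremal_triangle_congruent : e = eta ->
  exists2 g : space3 R -> space3 R,
    forall p q, norm3 (g p - g q) = norm3 (p - q)
  & forall t j, rotJ (varpi * t) (y t j) = g (xbar 3 X t j).
Proof.
move=> eE; have [m [u [ME UE]]] := real_amplitudes eE.
set b := (y 0 0).2; have zE := vertical_mode eE; rewrite -/b in zE.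
have zeta_phase (j : 'Z_3) : zeta R 3 ^+ j = expi (j%:R * third) by rewrite zetaE3 expiX.
have XW j t : expi (X * t) * W j t =
    ((m + u) * cos (phase j t) +i* ((m - u) * sin (phase j t)))%C.
  rewrite corot_twist (meanE N2 eta1 yL) (twisted_amp eE) ME UE zeta_phase.
  rewrite (_ : expi (X * t) * _ = (expi (X * t) * expi (j%:R * third)) * (m%:C)%C +
    (expi (X * t) * expi (- (2 * X * t)) * expi (- (j%:R * third))) * (u%:C)%C); last by ring.
  rewrite -!expiD -/(phase j t).
  rewrite (_ : X * t + - (2 * X * t) + - (j%:R * third) = - phase j t); last by rewrite /phase; ring.
  by rewrite /expi cosN sinN /=; congr Complex; ring.
have dist0 (i j : 'Z_3) : ((m + u) * (cos (i%:R * third) - cos (j%:R * third))) ^+ 2 +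
    ((m - u) * (sin (i%:R * third) - sin (j%:R * third))) ^+ 2 +
    (b * (cos (i%:R * third) - cos (j%:R * third))) ^+ 2 =
    a ^+ 2 * ((cos (i%:R * third) - cos (j%:R * third)) ^+ 2 +
     (sin (i%:R * third) - sin (j%:R * third)) ^+ 2).
  have tT : 0 <= (0 : R) <= T by rewrite lexx ltW.
  have := dist_sqr congruent i j tT; rewrite -/nu -/X -/a /rhoZ !zeta_phase.
  have W0 k : W k 0 = ((m + u) * cos (k%:R * third) +i* ((m - u) * sin (k%:R * third)))%C.
    by have := XW k 0; rewrite /phase !mulr0 add0r expi0 mul1r.
  rewrite !W0 !zE /phase !mulr0 !add0r !cmod_sqr /expi /= => <-; ring.
have third2 : cos (2 * third) = cos third /\ sin (2 * third) = - sin third.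
  rewrite (_ : 2 * third = - third + pi *+ 2); last by rewrite -mulr_natr /third; field.
  by rewrite cosD2pi sinD2pi cosN sinN.
have s0 : 0 < sin third.
  by apply: sin_gt0_pi; rewrite /third; apply/andP; split; have := pi0; lra.
have c1 : cos third < 1.
  have := cos2Dsin2 third; have := cos_le1 third; have : 0 < sin third ^+ 2 by rewrite exprn_gt0.
  by nra.
(* Bodies 1 and 2 have the same abscissa in the triangle at time 0. *)
have mu2 : (m - u) ^+ 2 = a ^+ 2.
  have := dist0 1 2; rewrite mul1r third2.1 third2.2 => D.
  have : ((m - u) ^+ 2 - a ^+ 2) * (4 * sin third ^+ 2) = 0 by lra.
  by move/eqP; rewrite mulf_eq0 => /orP[/eqP|/eqP]; [lra|have : 0 < sin third ^+ 2 by [rewrite exprn_gt0]; lra].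
have mub2 : (m + u) ^+ 2 + b ^+ 2 = a ^+ 2.
  have := dist0 0 1; rewrite mul0r mul1r cos0 sin0 !exprMn mu2 => D.
  have : ((m + u) ^+ 2 + b ^+ 2 - a ^+ 2) * (1 - cos third) ^+ 2 = 0 by lra.
  move/eqP; rewrite mulf_eq0 => /orP[/eqP|/eqP]; first by lra.
  have : 0 < (1 - cos third) ^+ 2 by rewrite exprn_gt0// subr_gt0.
  lra.
pose P := (m + u) / a; pose Q := b / a; pose E := (m - u) / a.
have PQ : P ^+ 2 + Q ^+ 2 = 1.
  by rewrite /P /Q !expr_div_n -mulrDl mub2 divff// expf_neq0// gt_eqF.
have E2 : E ^+ 2 = 1 by rewrite /E expr_div_n mu2 divff// expf_neq0// gt_eqF.
pose g (p : space3 R) : space3 R :=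
  (((P * complex.Re p.1 - Q * p.2) +i* (E * complex.Im p.1))%C,
   Q * complex.Re p.1 + P * p.2).
exists g.
  move=> [[p1 p2] p3] [[q1 q2] q3]; rewrite /norm3 !cmod_sqr /g /=; congr Num.sqrt.
  transitivity ((P ^+ 2 + Q ^+ 2) * ((p1 - q1) ^+ 2 + (p3 - q3) ^+ 2) + E ^+ 2 * (p2 - q2) ^+ 2).
    by ring.
  by rewrite PQ E2; ring.
move=> t j.
have -> : xbar 3 X t j = ((a * cos (phase j t) +i* (a * sin (phase j t)))%C, 0).
  rewrite /xbar /rotJ /= -/(polygon_radius 3 X) -/a; congr (_, _).
  rewrite mulrCA zeta_phase -expiD -/(phase j t) /expi /=.
  by congr Complex; ring.
have -> : rotJ (varpi * t) (y t j) = (expi (X * t) * W j t, (y t j).2).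
  rewrite /rotJ /corot mulrA -expiD; congr (expi _ * _, _).
  by rewrite /X; ring.
rewrite XW zE /g /=; congr (_, _); last by rewrite /Q; field; rewrite gt_eqF.
by rewrite /P /E; congr Complex; field; rewrite gt_eqF.
Qed.

End Triangle.

(** * The minimizer *)
Lemma rotJK (R : realType) (phi : R) (p : space3 R) : rotJ phi (rotJ (- phi) p) = p.
Proof. by rewrite /rotJ /= mulrA expiNK mul1r -surjective_pairing. Qed.

Lemma norm3N (R : realType) (p : space3 R) : norm3 (- p) = norm3 p.
Proof. by case: p => h z; rewrite /norm3 /= cmodN sqrrN. Qed.

Lemma congruent_ybar (R : realType) (N : nat) (r s : int) (varpi : R) (y : motion R N) :
  let yb := ybar N r s varpi in
  (forall t j, y t j = yb t j) \/ (forall t j, y t j = - yb t j) ->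
  exists2 g : space3 R -> space3 R,
    forall p q, norm3 (g p - g q) = norm3 (p - q)
  & forall t j, rotJ (varpi * t) (y t j) =
      g (xbar N (varpi + 2 * pi * (r%:~R / s%:~R)) t j).
Proof.
move=> yb [yE|yE].
  by exists id => // t j; rewrite yE /yb /ybar rotJK.
exists (fun p => - p) => [p q|t j]; first by rewrite -opprD norm3N.
have rotN phi (p : space3 R) : rotJ phi (- p) = - rotJ phi p.
  by rewrite /rotJ /= mulrN.
by rewrite yE rotN /yb /ybar rotJK.
Qed.

(** If [2 pi <= |X|] then the hypothesis makes [omega2 N N./2] at most [omega2 N 1], and
[omega2] is strictly increasing up to [N/2]. *)
Lemma critical_triangle (R : realType) (N : nat) (X : R) : (3 <= N)%N ->
  X ^+ 2 * omega2 N N./2 <= (2 * pi) ^+ 2 * omega2 N 1 -> 2 * pi <= `|X| ->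
  N = 3%N /\ `|X| = 2 * pi.
Proof.
move=> N3 Xb Xge; have N2 : (1 < N)%N by exact: ltnW.
have O10 : 0 < omega2 N 1 :> R by exact: omega2_1_gt0.
have pi0 := @pi_gt0 R.
have X2 : (2 * pi) ^+ 2 <= X ^+ 2.
  rewrite -[leRHS]real_normK ?num_real// ler_sqr ?nnegrE//.
  by rewrite mulr_ge0// ltW.
have p2 : 0 < (2 * pi : R) ^+ 2 by rewrite exprn_gt0// mulr_gt0.
have On : omega2 N N./2 <= omega2 N 1 :> R.
  rewrite -(ler_pM2l p2); apply: le_trans Xb; rewrite ler_wpM2r//.
  by apply/ltW/(lt_le_trans O10); exact: omega2_max.
split.
  have [n2|n2] := leqP 2 N./2; last by lia.
  by have := @omega2_lt R N N2 1 N./2 n2 (leqnn _); rewrite ltNge On.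
apply/eqP; rewrite eq_le Xge andbT -ler_sqr ?nnegrE ?mulr_ge0 ?pi_ge0//.
rewrite real_normK ?num_real// -(ler_pM2r O10); apply: le_trans Xb.
by rewrite ler_wpM2l ?sqr_ge0// omega2_max.
Qed.

Theorem corollary24 (R : realType) (N : nat) (eta r s : int) (varpi : R) :
  (3 <= N)%N ->
  eta = 1 \/ eta = -1 ->
  1 <= s -> coprimez r s ->
  let n := N./2 in
  let X := varpi + 2 * pi * (r%:~R / s%:~R) in
  X != 0 ->
  - Vbound R N eta <= X <= Vbound R N eta ->
  let yb := ybar N r s varpi in
  [/\ LambdaG r s n eta yb,
      forall y : motion R N, LambdaG r s n eta y ->
        (action_of s varpi yb <= action_of s varpi y)%E
    & forall y : motion R N, LambdaG r s n eta y ->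
        action_of s varpi y = action_of s varpi yb ->
        (exists2 g : space3 R -> space3 R,
           forall p q, norm3 (g p - g q) = norm3 (p - q)
         & forall t j, rotJ (varpi * t) (y t j) = g (xbar N X t j))
        /\ (~ (N = 3%N /\ X = eta%:~R * (2 * pi)) ->
            (forall t j, y t j = yb t j) \/ (forall t j, y t j = - yb t j))].
Proof.
move=> N3 eta1 s1 _ n X X0 XV yb.
have [S sE] : exists S : nat, s = S.+1 by case: s s1 {X X0 XV yb} => [[|S]|S]// _; exists S.
subst s; have Xb := Vbound_sqr N3 eta1 XV.
have AE := action_ybar N3 X0.
split.
- exact: ybar_LambdaG.
- by move=> y yL; rewrite /yb AE; exact: (action_ge N3 eta1 X0 Xb yL).
move=> y yL; rewrite /yb AE => Ay.
have [cong vert twist steady] := action_eq N3 eta1 X0 Xb yL Ay.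
suff [pm|[N3E [XE [g gi gE]]]] :
    ((forall t j, y t j = yb t j) \/ (forall t j, y t j = - yb t j)) \/
    (N = 3%N /\ X = eta%:~R * (2 * pi) /\ exists2 g : space3 R -> space3 R,
       forall p q, norm3 (g p - g q) = norm3 (p - q)
       & forall t j, rotJ (varpi * t) (y t j) = g (xbar N X t j)).
- by split => //; exact: (congruent_ybar pm).
- by split; [exists g|move=> H; exfalso; exact: H].
have [Xlt|Xge] := ltP `|X| (2 * pi).
  left; apply: (steady_eq_ybar N3 eta1 X0 yL cong (M := mean r S y 0)) => j.
  move=> t; rewrite -(meanE (ltnW N3) eta1 yL).
  apply: (periodic_cst (F := corot _ y j) (ltr0Sn R S)) => u.
    exact: (corot_period yL j u).1.
  exact: steady.
have [N3E absX] := critical_triangle N3 Xb Xge; subst N.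
have [e [e1 XE]] : exists e : int, (e = 1 \/ e = -1) /\ X = e%:~R * (2 * pi).
  have [X_ge|X_lt] := lerP 0 X.
    by rewrite ger0_norm// in absX; exists 1; split; [left|rewrite mul1r].
  rewrite ltr0_norm// in absX; exists (-1); split; first by right.
  by rewrite mulrN1z mulN1r -absX opprK.
have [ee|ee] : e = eta \/ e = - eta.
  by case: e1 => ->; case: eta1 => ->; [left|right|right|left].
- right; split=> //; split; first by rewrite -ee.
  exact: (extremal_triangle_congruent eta1 e1 XE yL cong twist vert ee).
- left; apply: (steady_eq_ybar N3 eta1 X0 yL cong (M := mean r S y 0)).
  exact: (untwisted_steady eta1 e1 XE yL twist ee).
Qed.
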